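(* Let $\mathcal{A}\subset\mathbb{N}$ be an infinite set of integers for which there exist a set of primes $\mathcal{P}\subseteq\mathbb{P}$ and real numbers $\varepsilon,\delta,\rho>0$ such that the following three conditions hold. (I) For all sufficiently large $k\in\mathbb{N}$: every $n\in\mathcal{A}$ with $n\ge 2^k$ is divisible by no prime $p\in\mathcal{P}$ with $p\le 2^{\rho k}$. (II) As $x\to\infty$, $$\frac{1}{(\log x)^{\delta}}\gg\frac{\#\{x\le n<2x:\ n\in\mathcal{A}\}}{x}\asymp\prod_{\substack{p\in\mathcal{P}\\ p\le x}}\left(1-\frac1p\right).$$ (III) For all $\alpha\in BAD$, $$\sup_{0\le a<b\le 1}\Big|\#\{n\in\mathcal{A}\cap[0,x]:\{n\alpha\}\in[a,b]\}-\#\{n\in\mathcal{A}\cap[0,x]\}\cdot(b-a)\Big|\ll_{\alpha}x^{1-\varepsilon}.$$ Then $$BAD\subseteq\bigcap_{\psi\in\mathcal{M}_{\mathcal{A}}}\mathcal{K}_{\mathcal{A}}(\psi)\subseteq BAD_{\mathcal{P}}.$$ In particular, $\bigcap_{\psi\in\mathcal{M}_{\mathcal{A}}}\mathcal{K}_{\mathcal{A}}(\psi)$ has Lebesgue measure $0$ but Hausdorff dimension $1$.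
   Context: $\mathbb{N}$ is the set of positive integers, $\mathbb{P}$ the set of primes, $\lVert x\rVert$ the distance from the real number $x$ to the nearest integer, $\{x\}$ (in condition (III)) the fractional part of $x$, and $\lambda$ the one-dimensional Lebesgue measure. ''Monotonically decreasing'' means non-increasing. $f\ll g$ means $f=O(g)$, $f\gg g$ means $g\ll f$, and $f\asymp g$ means both; implied constants do not depend on $x$, and subscripts indicate allowed dependence of the implied constant. $BAD:=\{\alpha\in[0,1):\liminf_{n\to\infty}n\lVert n\alpha\rVert>0\}$ is the set of badly approximable numbers in $[0,1)$. For infinite $\mathcal{A}\subseteq\mathbb{N}$: $\mathcal{M}_{\mathcal{A}}:=\{\psi:\mathbb{N}\to[0,\infty)\text{ monotonically decreasing},\ \sum_{n\in\mathcal{A}}\psi(n)=\infty\}$. For $\psi:\mathbb{N}\to[0,\infty)$ and $\alpha\in\mathbb{R}$, $T_{\mathcal{A}}(\psi,\alpha):=\{\gamma\in[0,1):\lVert n\alpha+\gamma\rVert\le\psi(n)\text{ for infinitely many }n\in\mathcal{A}\}$, and $\mathcal{K}_{\mathcal{A}}(\psi):=\{\alpha\in[0,1):\lambda(T_{\mathcal{A}}(\psi,\alpha))=1\}$. For a set of primes $\mathcal{P}$, $f_{\mathcal{P}}(n):=\prod_{p\in\mathcal{P},\,p\le n}\left(1+\frac1p\right)$ and $BAD_{\mathcal{P}}:=\{\alpha\in[0,1):\liminf_{n\to\infty}n\lVert n\alpha\rVert f_{\mathcal{P}}(n)>0\}$. *)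

(* Defs.v *)
From HB Require Import structures.
From mathcomp Require Export all_boot all_order all_algebra finmap.
From mathcomp Require Export all_classical all_reals all_analysis.
Export Order.TTheory GRing.Theory Num.Theory.
Export numFieldNormedType.Exports.

Set Implicit Arguments.
Unset Strict Implicit.
Unset Printing Implicit Defensive.

Local Open Scope classical_set_scope.
Local Open Scope ring_scope.

(* The positive integers are represented inside nat: subsets of them are sets
   A : set nat with 0 not in A, and a function on them is a function on nat
   whose value at 0 is irrelevant. *)

Section Notions.
Context {R : realType}.
Implicit Types (x alpha gamma : R) (A P : set nat) (psi : nat -> R).

(* f << g, i.e. f = O(g), as x -> +oo. (pinfty_nbhs carries no canonical
   filter_on structure, so the =O_F notation does not apply.) *)
Definition vinogradov (f g : R -> R) : Prop :=
  exists2 C : R, 0 < C & \forall x \near +oo, `|f x| <= C * `|g x|.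

Definition dist_int x : R := inf [set (`|x - m%:~R|) | m in [set: int]].

Definition frac_part x : R := x - (Num.floor x)%:~R.

(* Only meaningful for finite S (fset_set of an infinite set is empty). *)
Definition card_nat (S : set nat) : nat := #|` fset_set S|%fset.

(* The lower limit is taken in \bar R because, with the factor f_prod, it may
   be +oo; the term n = 0 does not affect it. *)
Definition BAD : set R := [set alpha | (alpha \in `[0, 1[) /\
  (0 < limn_einf (fun n : nat => (n%:R * dist_int (n%:R * alpha))%:E))%E].

Definition f_prod P (n : nat) : R :=
  \prod_(0 <= p < n.+1 | p \in P) (1 + p%:R^-1).

Definition BAD_of P : set R := [set alpha | (alpha \in `[0, 1[) /\
  (0 < limn_einf
    (fun n : nat => (n%:R * dist_int (n%:R * alpha) * f_prod P n)%:E))%E].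

Definition M_class A : set (nat -> R) := [set psi |
  [/\ forall n, (0 < n)%N -> 0 <= psi n,
      forall m n, (0 < m)%N -> (m <= n)%N -> psi n <= psi m &
      (\esum_(n in A) (psi n)%:E)%E = +oo%E]].

Definition T_set A psi alpha : set R := [set gamma | (gamma \in `[0, 1[) /\
  infinite_set [set n | A n /\ dist_int (n%:R * alpha + gamma) <= psi n]].

(* T_set A psi alpha is a Borel set. *)
Definition K_set A psi : set R := [set alpha | (alpha \in `[0, 1[) /\
  lebesgue_measure (T_set A psi alpha) = 1%E].

(* sup over intervals of the (unnormalised) discrepancy of (n alpha)_(n in A)
   up to x. *)
Definition discrepancy A alpha x : R :=
  sup [set r | exists a b : R, [/\ 0 <= a, a < b, b <= 1 &
    r = `| (card_nat [set n | [/\ A n, n%:R <= x &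
                  frac_part (n%:R * alpha) \in `[a, b]]])%:R
           - (card_nat [set n | A n /\ n%:R <= x])%:R * (b - a) |]].

Local Open Scope ereal_scope.

(* -oo on the empty set. *)
Definition diam (U : set R) : \bar R :=
  ereal_sup [set (`|x - y|)%:E | x in U & y in U].

(* Infimum over countable delta-covers; empty members contribute 0, whatever
   the value of s. *)
Definition hausdorff_premeasure (s delta : R) (E : set R) : \bar R :=
  ereal_inf [set \sum_(0 <= i <oo | U i != set0) diam (U i) `^ s
    | U in [set U : nat -> set R |
             E `<=` \bigcup_i U i /\ forall i, diam (U i) <= delta%:E]].

Definition hausdorff_measure (s : R) (E : set R) : \bar R :=
  ereal_sup [set hausdorff_premeasure s delta E
    | delta in [set delta : R | (0 < delta)%R]].

Definition hausdorff_dim (E : set R) : \bar R :=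
  ereal_inf [set s%:E
    | s in [set s : R | (0 <= s)%R /\ hausdorff_measure s E = 0]].

End Notions.

Arguments BAD R : clear implicits.

(* Main.v *)
Require Import Defs.
From mathcomp Require Import measurable_realfun ring lra zify.

(** Let X be the intersection in the theorem, f the product [f_prod P] and
    E_k the product of the 1 - 1/p over the primes p <= 2^k of P. By the density
    condition, A has about s_k = 2^k E_k elements in the block [2^k, 2^(k+1)).

    BAD is contained in X ([T_set_full]). Let alpha be badly approximable.
    Replace psi on the k-th block by r_k = min (psi(2^(k+1)), 1 / s_k), and
    keep the blocks for which a_k = s_k r_k is at least 1 / k^2; then the sum of
    the a_k still diverges. A second moment form of the Borel-Cantelli lemma
    ([l2_borel_cantelli]) reduces the claim to two facts about the targets of
    radius r_k around the points -n alpha: each dyadic interval receives its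
    share of them, which is the discrepancy condition, and pairwise
    intersections add up to O((sum a_k)^2). For blocks k and l with l >= K k the
    second fact follows from the power saving in the discrepancy condition. For
    closer blocks one must count pairs m, m + h in A with h in the Bohr set
    of the h <= 2^(l+1) such that h alpha is within 2 r_k of an integer. As A
    has no small prime factors in P, a sieve of Brun-Hooley type
    ([sieve_pairs]) bounds the number of m for given h by s_k E_k times the
    singular factor prod_(p | h) (1 + 1/p). To average this factor over the Bohr
    set, its elements divisible by d are counted: in a short window they come
    from collinear lattice points, and bad approximability spaces them out
    ([window_count]). The outcome ([bohr_sing]) is O(S^2 + S V), with S^2 of order
    r_k 2^l and V of order log k. The second term exceeds the first only for S
    below V, and the sum over those l is a geometric series bounded by a power
    of V, which the factor (log x)^-delta in the density condition absorbs.

    X is contained in BAD_P ([bigcap_K_set_sub_BAD_of]). If q dist_int (q alpha) f(q)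
    is tiny, the points n alpha with n up to 2x, x about t q f(q), cluster
    around the q multiples of 1 / q, while A has at least of the order of t q
    elements in [x, 2x). A function psi equal to the inverse of that number on
    [x, 2x) contributes 1 to the divergent sum, but its targets cover a set of
    measure O(1 / t) only. Concatenating such blocks gives a psi for which alpha
    fails.

    BAD_P is null ([BAD_of_negligible]): f(n) = O(log n) by Mertens, so that
    a divergence statement of Khinchin type applies; it follows from the same
    Borel-Cantelli lemma for neighbourhoods of reduced fractions.

    Finally BAD contains, for each s < 1, a Cantor set with a parametrisation
    by the unit interval whose inverse is s-Hoelder ([branch_hoelder]), so every
    set between BAD and [0, 1) has dimension 1 ([hausdorff_dim_eq1]). *)

Local Open Scope classical_set_scope.
Local Open Scope ring_scope.

Set Implicit Arguments.
Unset Strict Implicit.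
Unset Printing Implicit Defensive.

(** * Prime products of Chebyshev and Mertens type *)


Lemma prod_primes_dvd (s : seq nat) (m : nat) :
  uniq s -> all prime s -> all (fun p => p %| m)%N s ->
  (\prod_(p <- s) p %| m)%N.
Proof.
elim: s => [|p s IH] /=; first by rewrite big_nil dvd1n.
move=> /andP[ps us] /andP[pp ap] /andP[pm am].
rewrite big_cons Gauss_dvd ?pm ?IH//.
rewrite big_seq; apply: (big_ind (fun x => coprime p x)).
- by rewrite coprimen1.
- by move=> x y cx cy; rewrite coprimeMr cx.
- move=> q qs; rewrite prime_coprime// dvdn_prime2//; last by move/allP: ap; exact.
  by apply: contraNneq ps => ->.
Qed.

Lemma prime_dvd_fact p n : prime p -> (p %| n`!)%N -> (p <= n)%N.
Proof.
move=> pp; elim: n => [|n IH]; first by rewrite dvdn1 => /eqP p1; rewrite p1 in pp.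
by rewrite factS Euclid_dvdM// => /orP[/dvdn_leq->//|/IH /leqW].
Qed.

Definition dyadic_primes (k : nat) := [seq p <- index_iota (2 ^ k) (2 ^ k.+1) | prime p].

Lemma not_prime_pow2 (k : nat) : (1 < k)%N -> ~~ prime (2 ^ k).
Proof.
move=> k1; apply/negP => /primeP[_ /(_ 2)]; rewrite -{1}(prednK (ltnW k1)) expnS dvdn_mulr// => /(_ isT).
move=> /orP[//|/eqP h].
have : (2 ^ 1 < 2 ^ k)%N by rewrite ltn_exp2l.
by rewrite -h.
Qed.

(** Chebyshev's argument: every prime strictly between n = 2^k and 2n divides
    the binomial coefficient C(2n, n), which is at most 4^n. *)
Lemma dyadic_primes_count (k : nat) : (k * size (dyadic_primes k) <= 2 ^ k.+1)%N.
Proof.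
case: k => [|[|k]]; first by rewrite mul0n.
  by rewrite /dyadic_primes /index_iota.
set n := (2 ^ k.+2)%N; set s := dyadic_primes _.
have sP p : p \in s -> [/\ prime p, (n < p)%N & (p < 2 * n)%N].
  rewrite mem_filter mem_index_iota -/n => /andP[pp /andP[np pn]]; split => //.
    rewrite ltn_neqAle np andbT; apply/negP => /eqP h; move: pp; rewrite -h; apply/negP.
    exact: not_prime_pow2.
have h1 : (\prod_(p <- s) p %| 'C(2 * n, n))%N.
  apply: prod_primes_dvd.
  - by rewrite filter_uniq// iota_uniq.
  - by apply/allP => p /sP[].
  - apply/allP => p /sP[pp np pn].
    have le : (n <= 2 * n)%N by rewrite leq_pmull.
    have h := bin_fact le.
    have : (p %| (2 * n)`!)%N by apply: dvdn_fact; rewrite prime_gt0// ltnW.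
    rewrite -h !Euclid_dvdM// => /or3P[//| |].
    + by move=> /(prime_dvd_fact pp); rewrite leqNgt np.
    + have -> : (2 * n - n = n)%N by lia.
      by move=> /(prime_dvd_fact pp); rewrite leqNgt np.
have h2 : (n ^ size s <= \prod_(p <- s) p)%N.
  have : all (fun p => (n <= p)%N) s by apply/allP => p /sP[_ /ltnW].
  elim: (s) => [|p t IH] /=; first by rewrite big_nil expn0.
  by rewrite big_cons expnS => /andP[np /IH]; exact: leq_mul.
have h3 : ('C(2 * n, n) <= 2 ^ (2 * n))%N.
  have -> : (2 ^ (2 * n) = (1 + 1) ^ (2 * n))%N by [].
  rewrite expnDn.
  have ln : (n < (2 * n).+1)%N by rewrite ltnS leq_pmull.
  rewrite (bigD1 (Ordinal ln))//= !exp1n muln1 muln1; exact: leq_addr.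
have := leq_trans h2 (leq_trans (dvdn_leq _ h1) h3).
rewrite bin_gt0 leq_pmull// => /(_ isT).
by rewrite /n -expnM leq_exp2l// -expnS.
Qed.

(** The prime p divides n! at least n %/ p times, and n! <= n^n; taking base 2
    logarithms for n = 2^K gives an upper half of Mertens' first theorem in
    natural numbers. *)
Lemma sum_primes_fact (K : nat) :
  (\sum_(p <- [seq p <- iota 1 (2 ^ K) | prime p]) trunc_log 2 p * (2 ^ K %/ p) <= K * 2 ^ K)%N.
Proof.
set n := (2 ^ K)%N; set s := [seq p <- _ | prime p].
have sP p : p \in s -> [/\ prime p, (0 < p)%N & (p <= n)%N].
  by rewrite mem_filter mem_iota => /andP[? /andP[? ?]]; split => //; lia.
rewrite -(@leq_exp2l 2)// [X in (_ <= X)%N](_ : _ = n ^ n)%N; last by rewrite /n -expnM.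
have h1 : (\prod_(p <- s) p ^ (n %/ p) %| n`!)%N.
  have h : all (fun p => p ^ (n %/ p) %| n`!)%N s.
    apply/allP => p /sP[pp p0 pn]; rewrite pfactor_dvdn ?fact_gt0// logn_fact//.
    by rewrite big_ltn ?expn1 ?leq_addr// ltnS; exact: leq_trans pn.
  have : all prime s by apply/allP => p /sP[].
  have : uniq s by rewrite filter_uniq// iota_uniq.
  elim: (s) h => [|p t IH] /=; first by rewrite big_nil dvd1n.
  move=> /andP[ph th] /andP[pt ut] /andP[pp tp]; rewrite big_cons Gauss_dvd ?ph ?IH//.
  rewrite big_seq; apply: (big_ind (fun x => coprime _ x)).
  - by rewrite coprimen1.
  - by move=> x y cx cy; rewrite coprimeMr cx.
  - move=> q qs; rewrite coprimeXl// coprimeXr//.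
    rewrite prime_coprime// dvdn_prime2//; last by move/allP: tp; exact.
    by apply: contraNneq pt => ->.
have h2 : (n`! <= n ^ n)%N.
  rewrite fact_prod -[X in (_ <= _ ^ X)%N](_ : \sum_(1 <= i < n.+1) 1 = n)%N; last by rewrite sum_nat_const_nat muln1; lia.
  rewrite expn_sum big_seq [X in (_ <= X)%N]big_seq; apply: leq_prod => i.
  by rewrite mem_index_iota expn1; lia.
apply: leq_trans h2; apply: leq_trans (dvdn_leq (fact_gt0 _) h1).
rewrite expn_sum big_seq [X in (_ <= X)%N]big_seq; apply: leq_prod => p /sP[pp p0 _].
rewrite expnM; have [->//|e0] := posnP (n %/ p)%N.
by rewrite leq_exp2r// trunc_logP.
Qed.

Section Real.
Context {R : realType}.

Definition dsum (k : nat) : R := \sum_(p <- dyadic_primes k) p%:R^-1.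

Lemma mem_dyadic (k p : nat) : p \in dyadic_primes k ->
  [/\ prime p, (2 ^ k <= p)%N & (p < 2 ^ k.+1)%N].
Proof. by rewrite mem_filter mem_index_iota => /andP[-> /andP[-> ->]]. Qed.

Lemma dsum_ge0 k : 0 <= dsum k.
Proof. by apply: sumr_ge0 => p _; rewrite invr_ge0. Qed.

Lemma dsum_le (k : nat) : dsum k <= 2 / k%:R.
Proof.
have [->|k0] := posnP k.
  by rewrite /dsum /dyadic_primes /index_iota/= big_nil invr0 mulr0.
rewrite ler_pdivlMr ?ltr0n//.
have h : dsum k <= (size (dyadic_primes k))%:R / (2 ^ k)%:R.
  rewrite /dsum [X in _ <= X](_ : _ = \sum_(p <- dyadic_primes k) ((2 ^ k)%:R : R)^-1).
    rewrite big_seq [X in _ <= X]big_seq; apply: ler_sum => p /mem_dyadic[_ h1 _].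
    by rewrite lef_pV2 ?posrE ?ltr0n ?expn_gt0// ?ler_nat//; apply: leq_trans h1; rewrite expn_gt0.
  by rewrite big_const_seq count_predT iter_addr_0 mulr_natl.
apply: le_trans (ler_wpM2r _ h) _; first by rewrite ler0n.
rewrite mulrAC ler_pdivrMr ?ltr0n ?expn_gt0// -!natrM ler_nat mulnC -expnS.
exact: dyadic_primes_count.
Qed.

Lemma trunc_log_dyadic k p : p \in dyadic_primes k -> trunc_log 2 p = k.
Proof. by move=> /mem_dyadic[_ a b]; apply: trunc_log_eq => //; apply/andP. Qed.

Lemma big_dyadic (T : Type) (idx : T) (op : Monoid.law idx) (F : nat -> T) (a b : nat) :
  (a <= b)%N ->
  \big[op/idx]_(2 ^ a <= p < 2 ^ b | prime p) F p =
  \big[op/idx]_(a <= j < b) \big[op/idx]_(p <- dyadic_primes j) F p.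
Proof.
elim: b => [|b IH]; first by rewrite leqn0 => /eqP ->; rewrite !big_geq.
rewrite leq_eqVlt => /orP[/eqP<-|ab]; first by rewrite !big_geq.
rewrite big_nat_recr//= -IH// (@big_cat_nat _ _ _ (2 ^ b)) ?leq_exp2l//.
by congr (op _ _); rewrite /dyadic_primes big_filter.
Qed.

(** The quotients n %/ p of the preceding lemma differ from n / p by at most 1,
    and the sum of these errors is controlled by the count of primes. *)
Lemma mertens_dyadic (K : nat) : \sum_(1 <= j < K) j%:R * dsum j <= K%:R + 2.
Proof.
set n := (2 ^ K)%N.
have n0 : (0 : R) < n%:R by rewrite ltr0n expn_gt0.
have h1 : (\sum_(1 <= j < K) \sum_(p <- dyadic_primes j) j * (n %/ p) <= K * n)%N.
  apply: leq_trans (sum_primes_fact K).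
  rewrite (eq_bigr (fun j => \sum_(p <- dyadic_primes j) trunc_log 2 p * (n %/ p))%N); last first.
    by move=> j _; rewrite big_seq [RHS]big_seq; apply: eq_bigr => p /trunc_log_dyadic ->.
  have [|K1] := leqP K 0; first by rewrite leqn0 => /eqP ->; rewrite big_geq.
  rewrite -(@big_dyadic nat 0%N addn (fun p => trunc_log 2 p * (n %/ p))%N)// big_filter expn1.
  rewrite [X in (_ <= X)%N](_ : _ = \sum_(1 <= p < n.+1 | prime p) trunc_log 2 p * (n %/ p))%N; last first.
    by rewrite /index_iota subSS subn0.
  have n2 : (2 <= n)%N by rewrite -[2%N]expn1 leq_exp2l.
  rewrite [X in (_ <= X)%N](@big_cat_nat _ _ _ 2)//=; last exact: ltnW.
  by rewrite [X in (_ <= _ + X)%N](@big_cat_nat _ _ _ n)//= addnCA leq_addr.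
have h2 : \sum_(1 <= j < K) j%:R * dsum j <=
   \sum_(1 <= j < K) \sum_(p <- dyadic_primes j) (j * (n %/ p))%:R / n%:R
   + \sum_(1 <= j < K) (2 ^ j.+1)%:R / n%:R.
  rewrite -big_split/=; apply: ler_sum => j _.
  have h : j%:R * dsum j <= \sum_(p <- dyadic_primes j) ((j * (n %/ p))%:R / n%:R + j%:R / n%:R).
    rewrite /dsum big_distrr/= big_seq [X in _ <= X]big_seq; apply: ler_sum => p /mem_dyadic[pp _ _].
    rewrite natrM -mulrA -mulrDr; apply: ler_wpM2l => //.
    rewrite -[X in _ <= _ + X]mul1r -mulrDl.
    rewrite ler_pdivlMr// ler_pdivrMl ?ltr0n ?prime_gt0//.
    rewrite mulrDr mulr1 -natrM -natrD ler_nat {1}(divn_eq n p) mulnC leq_add2l.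
    by rewrite ltnW// ltn_mod prime_gt0.
  apply: le_trans h _; rewrite big_split/= lerD2l big_const_seq count_predT iter_addr_0.
  rewrite -[X in X <= _]mulr_natr mulrAC ler_pM2r ?invr_gt0// -natrM ler_nat; exact: dyadic_primes_count.
apply: le_trans h2 _; apply: lerD.
  under eq_bigr do rewrite -big_distrl/= -natr_sum.
  rewrite -big_distrl/= -natr_sum ler_pdivrMr// -natrM ler_nat; exact: h1.
rewrite -big_distrl/= -natr_sum ler_pdivrMr// -natrM ler_nat.
rewrite /n; elim: (K) => [|k IH]; first by rewrite big_geq.
case: k IH => [|k] IH; first by rewrite big_geq.
rewrite big_nat_recr//=; rewrite [in X in (_ <= X)%N]expnS mulnA.
have -> : (2 * 2 * 2 ^ k.+1 = 2 * 2 ^ k.+1 + 2 ^ k.+2)%N by rewrite (expnS 2 k.+1); lia.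
by rewrite leq_add2r.
Qed.

(** Partial summation of [mertens_dyadic] with the constant 1 in front of the
    harmonic sum: it is this constant that makes the product over all primes
    below 2^K linear in K, which the Khinchin type argument depends on. *)
Lemma sum_dsum_le (K : nat) : (0 < K)%N ->
  \sum_(1 <= j < K.+1) dsum j <= \sum_(1 <= j < K.+1) j%:R^-1 + 6.
Proof.
move=> K0.
suff h : \sum_(1 <= j < K.+1) dsum j - (\sum_(1 <= j < K.+1) j%:R * dsum j) / K%:R <=
   \sum_(1 <= j < K) j%:R^-1 + 2 - 2 / K%:R.
  have h2 := mertens_dyadic K.+1.
  have k0 : (0 : R) < K%:R by rewrite ltr0n.
  have : (\sum_(1 <= j < K.+1) j%:R * dsum j) / K%:R <= 4.
    rewrite ler_pdivrMr//; apply: le_trans h2 _.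
    have : (1 : R) <= K%:R by rewrite (ler_nat _ 1).
    by rewrite -[K.+1]addn1 natrD; lra.
  rewrite [X in _ -> _ <= X + _]big_nat_recr//=.
  have : 0 < (K%:R : R)^-1 by rewrite invr_gt0.
  lra.
elim: K K0 => // [[|K] IH] _.
  rewrite !big_nat1 big_geq// mulr1n invr1; lra.
have {IH} := IH isT; set L := \sum_(1 <= j < K.+2) j%:R * dsum j => IH.
have -> : \sum_(1 <= j < K.+3) dsum j = \sum_(1 <= j < K.+2) dsum j + dsum K.+2 by rewrite big_nat_recr.
have -> : \sum_(1 <= j < K.+3) j%:R * dsum j = L + K.+2%:R * dsum K.+2 by rewrite big_nat_recr.
have -> : \sum_(1 <= j < K.+2) (j%:R : R)^-1 = \sum_(1 <= j < K.+1) j%:R^-1 + K.+1%:R^-1 by rewrite big_nat_recr.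
have hL : L <= K.+1%:R + 3.
  by apply: le_trans (mertens_dyadic _) _; rewrite -[K.+2]addn1 natrD; lra.
have k0 : (0 : R) < K.+1%:R by rewrite ltr0n.
have k2 : (K.+2%:R : R) = K.+1%:R + 1 by rewrite -[K.+2]addn1 natrD.
move: IH hL; rewrite k2; move: (dsum K.+2) (\sum_(1 <= _ < K.+2) dsum _) (\sum_(1 <= _ < K.+1) _^-1) L.
move: (K.+1%:R) k0 => x x0 d S H L IH hL.
have -> : S + d - (L + (x + 1) * d) / (x + 1) = (S - L / x) + L / (x * (x + 1)).
  by field; apply/andP; split; lra.
have -> : H + x^-1 + 2 - 2 / (x + 1) = (H + 2 - 2 / x) + (x + 3) / (x * (x + 1)).
  by field; apply/andP; split; lra.
apply: lerD => //; rewrite ler_pM2r ?invr_gt0//; nra.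
Qed.

Lemma expR_harmonic (K : nat) : (0 < K)%N ->
  expR (\sum_(1 <= j < K.+1) j%:R^-1) <= expR 1 * K%:R :> R.
Proof.
elim: K => // [[|K] IH] _; first by rewrite big_nat1 invr1 mulr1.
rewrite big_nat_recr//= expRD; apply: le_trans (ler_wpM2r _ (IH isT)) _; first exact: expR_ge0.
rewrite -mulrA ler_wpM2l ?expR_ge0//.
have k0 : (0 : R) < K.+1%:R by rewrite ltr0n.
have h := @expR_ge1Dx R (- K.+2%:R^-1).
rewrite -(@ler_pM2r _ (expR (- K.+2%:R^-1))) ?expR_gt0// -mulrA -expRD subrr expR0 mulr1.
apply: le_trans (ler_wpM2l _ h); last by rewrite ler0n.
rewrite mulrBr mulr1 divff ?pnatr_eq0// -[K.+2]addn1 natrD; lra.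
Qed.


Lemma prod_recr_cond (Q : pred nat) (F : nat -> R) n :
  \prod_(0 <= p < n.+1 | Q p) F p =
  \prod_(0 <= p < n | Q p) F p * (if Q n then F n else 1).
Proof. by rewrite big_mkcond big_nat_recr//= -big_mkcond. Qed.

(** The full product, an upper bound for [f_prod P] with any set of primes P;
    it grows logarithmically by [mert_le]. *)
Definition mert (n : nat) : R := \prod_(0 <= p < n | prime p) (1 + p%:R^-1).

Definition eul (P : set nat) (n : nat) : R :=
  \prod_(0 <= p < n | p \in P) (1 - p%:R^-1).

Lemma mert_le K : (0 < K)%N -> mert (2 ^ K) <= expR 7 * K%:R.
Proof.
move=> K0; rewrite /mert (@big_cat_nat _ _ _ 2)//=; last by rewrite -{1}[2%N]expn1 leq_exp2l.
rewrite !prod_recr_cond big_geq//= !mul1r -{1}[2%N]expn1 big_dyadic//.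
apply: (@le_trans _ _ (expR (\sum_(1 <= j < K.+1) dsum j))); last first.
  apply: (@le_trans _ _ (expR (\sum_(1 <= j < K.+1) j%:R^-1 + 6))).
    by rewrite ler_expR; exact: sum_dsum_le.
  rewrite expRD mulrC; have -> : (7 : R) = 6 + 1 by ring.
  by rewrite (expRD 6 1) -mulrA ler_wpM2l ?expR_ge0//; exact: expR_harmonic.
apply: (@le_trans _ _ (expR (\sum_(1 <= j < K) dsum j))); last first.
  by rewrite ler_expR [X in _ <= X]big_nat_recr//= lerDl dsum_ge0.
rewrite expR_sum; apply: ler_prod => j _; apply/andP; split.
  by apply: prodr_ge0 => p _; rewrite addr_ge0.
by rewrite expR_sum; apply: ler_prod => p _; rewrite addr_ge0//= expR_ge1Dx.
Qed.

Lemma mert_ge1 n : 1 <= mert n.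
Proof.
rewrite /mert; elim: n => [|n IH]; first by rewrite big_geq.
rewrite prod_recr_cond; case: ifP => _; rewrite ?mulr1//.
by apply: (le_trans IH); rewrite ler_peMr ?lerDl ?invr_ge0// (le_trans _ IH).
Qed.

Lemma mert_homo m n : (m <= n)%N -> mert m <= mert n.
Proof.
elim: n => [|n IH]; first by rewrite leqn0 => /eqP ->.
rewrite leq_eqVlt => /orP[/eqP->//|/IH h]; apply: le_trans h _.
rewrite {2}/mert prod_recr_cond -/(mert n); case: ifP => _; rewrite ?mulr1//.
by rewrite ler_peMr ?lerDl ?invr_ge0// (le_trans ler01)// mert_ge1.
Qed.

Section P.
Variable P : set nat.
Hypothesis PP : P `<=` [set p | prime p].

Lemma P_ge2 p : p \in P -> (2 <= p)%N.
Proof. by rewrite inE => /PP/prime_gt1. Qed.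

Lemma invP p : p \in P -> 0 < (p%:R : R)^-1 <= 2^-1.
Proof.
move=> /P_ge2 h; rewrite invr_gt0 ltr0n (ltnW h)/=.
by rewrite lef_pV2 ?posrE ?ltr0n ?(ltnW h)// ler_nat.
Qed.

Lemma f_prod_ge1 n : 1 <= f_prod P n :> R.
Proof.
rewrite /f_prod; elim: (n.+1) => [|k IH]; first by rewrite big_geq.
rewrite prod_recr_cond; case: ifP => _; rewrite ?mulr1//.
by apply: (le_trans IH); rewrite ler_peMr ?lerDl ?invr_ge0// (le_trans _ IH).
Qed.

Lemma f_prod_mert n : f_prod P n <= mert n.+1.
Proof.
rewrite /f_prod /mert; elim: (n.+1) => [|k IH]; first by rewrite !big_geq.
rewrite !prod_recr_cond.
case: ifP => [|_]; first rewrite inE => /PP ->.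
  by apply: ler_wpM2r IH; rewrite addr_ge0.
rewrite mulr1; case: ifP => _; rewrite ?mulr1//; apply: le_trans IH _.
by rewrite ler_peMr ?lerDl ?invr_ge0// (le_trans ler01)// -/(mert k) mert_ge1.
Qed.

Lemma f_prod_leS n : f_prod P n <= n.+1%:R :> R.
Proof.
elim: n => [|n IH].
  rewrite /f_prod prod_recr_cond big_geq// mul1r; case: ifP => //.
  by move=> /P_ge2.
rewrite /f_prod prod_recr_cond; case: ifP => _; last first.
  by rewrite mulr1; apply: le_trans IH _; rewrite ler_nat.
apply: le_trans (ler_wpM2r _ IH) _; first by rewrite addr_ge0.
by rewrite mulrDr mulr1 divff ?pnatr_eq0// [X in _ <= X]mulrSr.
Qed.

Lemma eul_gt0 n : 0 < eul P n.
Proof.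
rewrite /eul; elim: n => [|k IH]; first by rewrite big_geq.
rewrite prod_recr_cond; case: ifP => h; rewrite ?mulr1//.
by apply: mulr_gt0 => //; have := invP h; lra.
Qed.

Lemma eul_nincr m n : (m <= n)%N -> eul P n <= eul P m.
Proof.
elim: n => [|n IH]; first by rewrite leqn0 => /eqP ->.
rewrite leq_eqVlt => /orP[/eqP->//|/IH h]; apply: le_trans _ h.
rewrite {1}/eul prod_recr_cond -/(eul P n); case: ifP => hp; rewrite ?mulr1//.
by rewrite ler_piMr ?ltW ?eul_gt0//; have := invP hp; lra.
Qed.

Lemma eul_le1 n : eul P n <= 1.
Proof. by apply: le_trans (eul_nincr (leq0n n)) _; rewrite /eul big_geq. Qed.

(** Up to a factor 2, [f_prod P] is the inverse of the Euler product, since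
    the product of the 1 - p^-2 is at least 1/2 (telescoping over all integers). *)
Lemma f_eul n : 2^-1 <= f_prod P n * eul P n.+1.
Proof.
rewrite /f_prod /eul -big_split/=.
rewrite (eq_bigr (fun p => 1 - p%:R^-1 ^+ 2)); last by move=> p _; ring.
suff h k : (k.+2%:R / (2 * k.+1%:R)) <= \prod_(0 <= p < k.+2 | p \in P) (1 - p%:R^-1 ^+ 2) :> R.
  case: n => [|n].
    by rewrite prod_recr_cond big_geq// mul1r; case: ifP => [/P_ge2//|_]; lra.
  apply: le_trans (h n); rewrite ler_pdivlMr ?mulr_gt0 ?ltr0n//.
  by rewrite mulrA mulVf ?pnatr_eq0// mul1r ler_nat.
elim: k => [|k IH].
  rewrite prod_recr_cond prod_recr_cond big_geq// mul1r.
  case: ifP => [/P_ge2//|_]; case: ifP => [/P_ge2//|_]; rewrite !mulr1 divff//.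
rewrite prod_recr_cond.
have k0 : (0 : R) < k.+1%:R by rewrite ltr0n.
have e : (k.+2%:R : R) = k.+1%:R + 1 by rewrite -[k.+2]addn1 natrD.
have e3 : (k.+3%:R : R) = k.+1%:R + 2 by rewrite -[k.+3]addn2 natrD.
move: IH; set Q := \prod_(_ <= _ < _ | _) _; move: Q => Q; rewrite e3 e.
move: (k.+1%:R) k0 => x x0 IH.
have -> : (x + 2) / (2 * (x + 1)) = (x + 1) / (2 * x) * (1 - (x + 1)^-1 ^+ 2).
  by field; apply/andP; split; lra.
have hx : 0 < (x + 1)^-1 < 1.
  by apply/andP; split; rewrite ?invr_gt0 ?invf_lt1; lra.
have Q0 : 0 <= Q by apply: le_trans IH; rewrite divr_ge0; lra.
have h1 : 0 <= 1 - (x + 1)^-1 ^+ 2 <= 1.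
  move: hx; move: (x + 1)^-1 => y hy; rewrite expr2; nra.
apply: le_trans (ler_wpM2r _ IH) _; first by case/andP: h1.
case: ifP => _; first exact: lexx.
by rewrite mulr1 ler_piMr//; case/andP: h1.
Qed.

Lemma one_sub_expR (x : R) : 0 <= x <= 2^-1 -> expR (- (2 * x)) <= 1 - x.
Proof.
move=> hx; rewrite expRN -[X in _ <= X]invrK.
have x1 : 0 < 1 - x by lra.
rewrite lef_pV2 ?posrE ?expR_gt0 ?invr_gt0//.
apply: le_trans (expR_ge1Dx _).
rewrite -(ler_pM2r x1) mulVf ?lt0r_neq0//; nra.
Qed.

(** The Euler product is slowly varying: between 2^a and 2^b with b / a bounded
    it loses a constant factor only, because each of the b - a dyadic blocks of
    primes contributes O(1 / a) to the sum of 1 / p. *)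
Lemma eul_dyadic a b : (0 < a)%N -> (a <= b)%N ->
  eul P (2 ^ a) * expR (- (4 * (b%:R / a%:R))) <= eul P (2 ^ b).
Proof.
move=> a0 ab.
rewrite [X in _ <= X]/eul (@big_cat_nat _ _ _ (2 ^ a))//= ?leq_exp2l// -/(eul P _).
apply: ler_wpM2l; first exact/ltW/eul_gt0.
apply: (@le_trans _ _ (\prod_(2 ^ a <= p < 2 ^ b | prime p) expR (- (2 * p%:R^-1)))); last first.
  rewrite [X in X <= _]big_mkcond [X in _ <= X]big_mkcond/=; apply: ler_prod => p _.
  apply/andP; split; first by case: ifP => _ //; exact: expR_ge0.
  case: ifP => h; case: ifP => hP //.
  - by move: hP => /invP hp; apply: one_sub_expR; case/andP: hp => /ltW -> ->.
  - by move: hP; rewrite inE => /PP/=; rewrite h.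
rewrite (@big_dyadic R 1 *%R (fun p => expR (- (2 * p%:R^-1))))//.
apply: (@le_trans _ _ (\prod_(a <= j < b) expR (- (4 / a%:R)))).
  rewrite prodr_const_nat -expRM_natl ler_expR -mulr_natl.
  rewrite natrB// mulrN lerN2 mulrCA; apply: ler_wpM2l => //.
  rewrite ler_wpM2r// lerBlDr lerDl//.
rewrite big_nat [X in _ <= X]big_nat; apply: ler_prod => j /andP[aj _]; rewrite expR_ge0/=.
rewrite -expR_sum ler_expR sumrN lerN2 -big_distrr/=.
have := dsum_le j; rewrite /dsum => h.
have h2 : 2 / j%:R <= 2 / a%:R :> R.
  by rewrite ler_wpM2l// lef_pV2 ?posrE ?ltr0n ?ler_nat// (leq_trans a0).
lra.
Qed.

Lemma eul_ge k : (0 < k)%N -> (2 * expR 7)^-1 / k%:R <= eul P (2 ^ k).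
Proof.
move=> k0.
have e : (2 ^ k = (2 ^ k).-1.+1)%N by rewrite prednK// expn_gt0.
have h := f_eul (2 ^ k).-1.
have h2 : f_prod P (2 ^ k).-1 <= expR (7 : R) * k%:R.
  by apply: le_trans (f_prod_mert _) _; rewrite -e; exact: mert_le.
rewrite e; have := eul_gt0 (2 ^ k).-1.+1; move: (eul P _) h => E h E0.
have k0' : (0 : R) < k%:R by rewrite ltr0n.
have := expR_gt0 (7 : R); move: (expR 7) h2 => c h2 c0.
rewrite ler_pdivrMr// -[X in X <= _]mul1r ler_pdivrMr ?mulr_gt0//.
have := ler_wpM2r (ltW E0) h2; lra.
Qed.
End P.
End Real.

(** * A second moment Borel-Cantelli lemma *)


Lemma bigsetU_ordP (T : Type) (n : nat) (S : pred nat) (F : nat -> set T) (x : T) :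
  (\big[setU/set0]_(i < n | S i) F i) x <-> exists2 i, (i < n)%N && S i & F i x.
Proof.
rewrite big_mkcond; elim: n => [|n IH].
  by rewrite big_ord0; split => // -[].
rewrite big_ord_recr/=; split.
  move=> [/IH[i /andP[a b] c]|]; first by exists i => //; rewrite ltnS ltnW.
  by case: ifP => // Sn Fn; exists n; rewrite // ltnSn.
move=> [i]; rewrite ltnS leq_eqVlt => /andP[/orP[/eqP->|a] b] c; first by right; rewrite b.
by left; apply/IH; exists i; rewrite // a.
Qed.

Section BC.
Context {R : realType}.
Notation mu := (@lebesgue_measure R).
Let D : set R := `[0, 1[.

Definition cell (j i : nat) : set R := `[i%:R / 2 ^+ j, i.+1%:R / 2 ^+ j[.

Lemma mu_le (A B : set R) : measurable A -> measurable B -> A `<=` B -> (mu A <= mu B)%E.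
Proof. by move=> mA mB AB; apply: le_measure; rewrite ?inE. Qed.

Lemma measurable_indicE (A E : set R) : measurable A ->
  measurable_fun E (fun x => (\1_A x : R)%:E).
Proof. by move=> mA; apply/measurable_EFinP; exact: measurable_indic. Qed.

Lemma measurable_cell j i : measurable (cell j i).
Proof. exact: measurable_itv. Qed.

Lemma pow2_gt0 j : (0 : R) < 2 ^+ j.
Proof. by rewrite exprn_gt0. Qed.

Lemma cellP j i x : cell j i x <-> i%:R <= x * 2 ^+ j < i.+1%:R.
Proof.
by rewrite /cell/= in_itv/= ler_pdivrMr ?pow2_gt0// ltr_pdivlMr ?pow2_gt0.
Qed.

Lemma cell_uniq j i i' x : cell j i x -> cell j i' x -> i = i'.
Proof.
rewrite !cellP => /andP[a b] /andP[c d].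
have h1 := le_lt_trans a d; have h2 := le_lt_trans c b.
by move: h1 h2; rewrite !ltr_nat !ltnS => h1 h2; apply/eqP; rewrite eqn_leq h1 h2.
Qed.

Lemma cell_exists j x : D x -> exists2 i, (i < 2 ^ j)%N & cell j i x.
Proof.
rewrite /D/= in_itv/= => /andP[x0 x1].
have h0 : 0 <= x * 2 ^+ j by rewrite mulr_ge0// ltW// pow2_gt0.
have /andP[h1 h2] := truncn_itv h0.
exists (Num.truncn (x * 2 ^+ j)); last by apply/cellP; rewrite h1 h2.
by rewrite -(ltr_nat R) natrX (le_lt_trans h1)// gtr_pMl// pow2_gt0.
Qed.

Lemma cell_sub j i : (i < 2 ^ j)%N -> cell j i `<=` D.
Proof.
move=> ij x /cellP/andP[h1 h2]; rewrite /D/= in_itv/=; apply/andP; split.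
  by rewrite -(pmulr_lge0 _ (pow2_gt0 j)) (le_trans _ h1).
rewrite -(ltr_pM2r (pow2_gt0 j)) mul1r (lt_le_trans h2)//.
by rewrite -natrX ler_nat.
Qed.

Lemma mu_cell j i : mu (cell j i) = (2 ^- j)%:E.
Proof.
rewrite /cell lebesgue_measure_itv/= lte_fin ltr_pM2r ?invr_gt0 ?pow2_gt0//.
by rewrite ltr_nat ltnSn -EFinB -mulrBl -natrB// subSnn mul1r.
Qed.

Lemma cellS j i x : cell j.+1 i x -> cell j i./2 x.
Proof.
rewrite !cellP exprS => /andP[h1 h2].
have e := odd_double_half i.
have e1 : (i%:R : R) = (odd i)%:R + i./2%:R * 2.
  by rewrite -{1}e natrD -muln2 natrM.
have : (odd i)%:R <= 1 :> R by rewrite lern1 leq_b1.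
have : 0 <= (odd i)%:R :> R by [].
move: h1 h2; rewrite -[i.+1]addn1 -[(i./2).+1]addn1 !natrD e1.
move: (2 ^+ j) (odd i)%:R (i./2%:R) => a b c; rewrite mulrCA => h1 h2 h3 h4.
have : c * 2 <= 2 * (x * a) by lra.
lra.
Qed.

(** All the moment computations below are finite, so that the only integration
    needed is that of a pointwise inequality between sums of indicators. *)
Lemma indic_le (I J : Type) (r : seq I) (q : seq J) (A : I -> set R) (B : J -> set R)
    (b : J -> R) :
  (forall i, measurable (A i)) -> (forall j, measurable (B j)) ->
  (forall j, 0 <= b j) ->
  (forall x, D x -> \sum_(i <- r) \1_(A i) x <= \sum_(j <- q) b j * \1_(B j) x) ->
  (\sum_(i <- r) mu (A i `&` D) <= \sum_(j <- q) (b j)%:E * mu (B j `&` D))%E.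
Proof.
move=> mA mB b0 h.
have mD : measurable D by exact: measurable_itv.
have -> : (\sum_(i <- r) mu (A i `&` D) = \sum_(i <- r) \int[mu]_(x in D) (\1_(A i) x)%:E)%E.
  by apply: eq_bigr => i _; rewrite integral_indic; [|exact: mD|exact: mA].
have -> : (\sum_(j <- q) (b j)%:E * mu (B j `&` D) =
    \sum_(j <- q) \int[mu]_(x in D) ((b j)%:E * (\1_(B j) x)%:E))%E.
  apply: eq_bigr => j _; rewrite ge0_integralZl_EFin//.
    by rewrite integral_indic; [|exact: mD|exact: mB].
  exact: measurable_indicE.
rewrite -!ge0_integral_sum//.
- apply: ge0_le_integral => //.
  + by move=> x _; apply: sume_ge0 => i _; rewrite lee_fin.
  + by apply: emeasurable_sum => i; apply: measurable_indicE.
  + apply: emeasurable_sum => j; apply: emeasurable_funM => //.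
    exact: measurable_indicE.
  + by move=> x Dx; rewrite !sumEFin lee_fin; exact: h.
- move=> j; apply: emeasurable_funM => //.
  exact: measurable_indicE.
- by move=> j x _; rewrite mule_ge0// lee_fin.
- by move=> i; apply: measurable_indicE.
Qed.

(** Outer regularity: an open set slightly larger than E is the increasing
    union of the dyadic cells of level j that it contains. *)
Lemma cells_approx (E : set R) (e eta : R) : measurable E -> E `<=` D ->
  0 < eta -> (e%:E < mu E)%E ->
  exists j (S : pred nat),
    [/\ (forall i, S i -> (i < 2 ^ j)%N),
     (mu (\big[setU/set0]_(i < 2 ^ j | S i) cell j i `\` E) < eta%:E)%E &
     (e%:E < mu (\big[setU/set0]_(i < 2 ^ j | S i) cell j i))%E].
Proof.
move=> mE ED eta0 eE.
have mD : measurable D by exact: measurable_itv.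
have muD : mu D = 1%E by rewrite lebesgue_measure_itv/= lte01 -EFinB subr0.
have Efin : (mu E < +oo)%E.
  by apply: (@le_lt_trans _ _ (mu D)); [apply: le_measure; rewrite ?inE|rewrite muD ltry].
have [U [oU EU muU]] := lebesgue_regularity_outer mE Efin eta0.
pose S j i := (i < 2 ^ j)%N && `[< cell j i `<=` U >].
pose V j := \big[setU/set0]_(i < 2 ^ j | S j i) cell j i.
have VP j x : V j x <-> exists2 i, S j i & cell j i x.
  rewrite /V; split.
    by move/bigsetU_ordP => [i /andP[ij Si] ci]; exists i.
  by move=> [i Si ci]; apply/bigsetU_ordP; exists i; rewrite // Si andbT; case/andP: Si.
have mV j : measurable (V j).
  by apply: bigsetU_measurable => i _; exact: measurable_cell.
have Vmono : {homo V : n m / (n <= m)%N >-> (n <= m)%O}.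
  apply: homo_leq => [A|A B C|j]; [exact: lexx|exact: le_trans|].
  apply/subsetPset => x /VP[i /andP[ij /asboolP iU] ci]; apply/VP.
  have Dx : D x by exact: cell_sub ci.
  have [i' i'j ci'] := cell_exists j.+1 Dx.
  exists i' => //; rewrite /S i'j; apply/asboolP => y /cellS cy.
  by apply: iU; rewrite (cell_uniq ci (cellS ci')).
have EV : E `<=` \bigcup_j V j.
  move=> x Ex; have Ux := EU _ Ex.
  have /nbhs_ballP[r /= r0 rU] := open_nbhs_nbhs (conj oU Ux).
  have [j hj] : exists j : nat, 2 ^- j < r.
    exists (Num.truncn r^-1).+1.
    rewrite invf_plt ?posrE ?pow2_gt0//.
    apply: lt_le_trans (truncnS_gt _) _.
    by rewrite -natrX ler_nat ltnW// ltn_expl.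
  exists j => //; apply/VP.
  have [i ij ci] := cell_exists j (ED _ Ex).
  exists i => //; rewrite /S ij; apply/asboolP => y cy; apply: rU.
  apply: le_lt_trans hj; rewrite -[_^-1]mul1r ler_pdivlMr ?pow2_gt0//.
  rewrite -(gtr0_norm (pow2_gt0 j)) -normrM mulrBl ler_norml.
  move: ci cy; rewrite !cellP -[i.+1]addn1 natrD; lra.
have mbig : measurable (\bigcup_j V j) by exact: bigcup_measurable.
have cv := @nondecreasing_cvg_mu _ _ _ (@lebesgue_measure R) V mV mbig Vmono.
have eV : (e%:E < mu (\bigcup_j V j))%E.
  by apply: lt_le_trans eE _; apply: le_measure; rewrite ?inE.
have [j hj] : exists j, (e%:E < (mu \o V) j)%E.
  apply: contrapT => no; move: eV; apply/negP; rewrite -leNgt.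
  rewrite -(cvg_lim _ cv)//; apply: lime_le; first by apply/cvg_ex; eexists; exact: cv.
  by apply: nearW => j /=; rewrite leNgt; apply/negP => h; apply: no; exists j.
exists j, (S j); split.
- by move=> i /andP[].
- apply: le_lt_trans muU; apply: mu_le.
  + by apply: measurableD; [exact: mV|].
  + by apply: measurableD => //; exact: open_measurable.
  + by move=> x [/VP[i /andP[_ /asboolP h] ci] nE]; split => //; exact: h.
- exact: hj.
Qed.

Definition nhits (T : Type) (B : T -> set R) (l : seq T) (x : R) : R :=
  \sum_(t <- l) \1_(B t) x.

Lemma nhits_ge0 T (B : T -> set R) l x : 0 <= nhits B l x.
Proof. exact: sumr_ge0. Qed.

Lemma measurable_nhits T (B : T -> set R) l : (forall t, measurable (B t)) ->
  measurable_fun setT (nhits B l).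
Proof.
by move=> mB; apply: measurable_sum => t; exact: measurable_indic.
Qed.

Definition hits_le T (B : T -> set R) (L : nat -> seq T) (M : R) : set R :=
  D `&` \bigcap_N [set x | nhits B (L N) x <= M].

Lemma measurable_hits_le T (B : T -> set R) L M : (forall t, measurable (B t)) ->
  measurable (hits_le B L M).
Proof.
move=> mB; apply: measurableI; first exact: measurable_itv.
apply: bigcap_measurable => // N _.
rewrite -[X in measurable X]setTI.
have := measurable_nhits (L N) mB; move=> /(_ measurableT `]-oo, M]%classic).
by move=> /(_ (measurable_itv _)); congr measurable.
Qed.

(** With F the number of hits, V the union of the chosen cells and any tau > 0,
    F 1_V <= M + F^2 / (2 tau) + (tau / 2) 1_(V \ E) holds pointwise: on E
    because F <= M, and on V \ E because F <= (F^2 / tau + tau) / 2. Integrate. *)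
Lemma second_moment_ineq (T : Type) (B : T -> set R) (l : seq T) (j : nat) (S : pred nat)
    (E : set R) (M tau : R) :
  (forall t, measurable (B t)) -> measurable E -> 0 <= M -> 0 < tau ->
  (forall x, E x -> nhits B l x <= M) ->
  (\sum_(i < 2 ^ j | S i) \sum_(t <- l) mu (B t `&` cell j i `&` D) <=
   M%:E + (2 * tau)^-1%:E * \sum_(t <- l) \sum_(u <- l) mu (B t `&` B u `&` D)
   + (tau / 2)%:E * mu ((\big[setU/set0]_(i < 2 ^ j | S i) cell j i `\` E) `&` D))%E.
Proof.
move=> mB mE M0 tau0 FM.
set V := \big[_/_]_(i < _ | _) _.
have mV : measurable V by apply: bigsetU_measurable => i _; exact: measurable_cell.
have mD : measurable D by exact: measurable_itv.
have muD : mu D = 1%E by rewrite lebesgue_measure_itv/= lte01 -EFinB subr0.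
pose r := [seq (i, t) | i <- [seq i <- index_iota 0 (2 ^ j) | S i], t <- l].
pose A (p : nat * T) := B p.2 `&` cell j p.1.
pose q := None :: Some None :: [seq Some (Some (t, u)) | t <- l, u <- l].
pose Bq (o : option (option (T * T))) := match o with None => D | Some None => V `\` E
  | Some (Some p) => B p.1 `&` B p.2 end.
pose b (o : option (option (T * T))) := match o with None => M | Some None => tau / 2
  | Some (Some p) => (2 * tau)^-1 end.
have i2 : 0 < (2 * tau)^-1 by rewrite invr_gt0 mulr_gt0.
have := @indic_le _ _ r q A Bq b.
have mA p : measurable (A p) by apply: measurableI => //; exact: measurable_cell.
have mBq o : measurable (Bq o).
  by case: o => [[p|]|] //=; [exact: measurableI|exact: measurableD].
have b0 o : 0 <= b o by case: o => [[p|]|] //=; rewrite ?ltW// divr_gt0.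
move=> /(_ mA mBq b0).
have sumr (Z : nmodType) (F : nat * T -> Z) :
    \sum_(p <- r) F p = \sum_(i < 2 ^ j | S i) \sum_(t <- l) F (val i, t).
  by rewrite /r big_allpairs_dep big_filter big_mkord.
have sumq (Z : nmodType) (F : option (option (T * T)) -> Z) :
    \sum_(o <- q) F o = F None + (F (Some None) + \sum_(t <- l) \sum_(u <- l) F (Some (Some (t, u)))).
  by rewrite /q !big_cons big_allpairs_dep.
rewrite sumr sumq setIid muD mule1 => main.
apply: (le_trans (main _)); last first.
  rewrite -addeA; apply: leeD => //; rewrite [X in (_ <= X)%E]addeC; apply: leeD => //.
  rewrite ge0_sume_distrr; last by move=> t _; exact: sume_ge0.
  by apply: lee_sum => t _; rewrite ge0_sume_distrr.
move=> x Dx {main}; rewrite sumr sumq.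
have N0 := nhits_ge0 B l x.
have -> : \sum_(i < 2 ^ j | S i) \sum_(t <- l) \1_(A (val i, t)) x =
   nhits B l x * \sum_(i < 2 ^ j | S i) \1_(cell j i) x :> R.
  rewrite mulr_sumr; apply: eq_bigr => i _; rewrite /nhits mulr_suml.
  by apply: eq_bigr => t _; rewrite /A indicI.
have -> : \sum_(t <- l) \sum_(u <- l) b (Some (Some (t, u))) * \1_(Bq (Some (Some (t, u)))) x =
   (2 * tau)^-1 * (nhits B l x) ^+ 2.
  rewrite /nhits expr2 mulr_suml mulr_sumr; apply: eq_bigr => t _.
  rewrite !mulr_sumr; apply: eq_bigr => u _.
  by rewrite /Bq indicI.
have -> : b None * \1_(Bq None) x = M by rewrite /= indicE mem_set// mulr1.
have V1 : \sum_(i < 2 ^ j | S i) \1_(cell j i) x = \1_V x :> R.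
  have [Vx|nVx] := pselect (V x).
    rewrite [RHS]indicE mem_set//; move/bigsetU_ordP : Vx => [i /andP[ij Si] ci].
    rewrite (bigD1 (Ordinal ij))//= indicE mem_set// big1 ?addr0// => i' /andP[Si' ne].
    rewrite indicE memNset// => ci'; move/negP : ne; apply; apply/eqP/val_inj => /=.
    exact: cell_uniq ci' ci.
  rewrite [RHS]indicE memNset// big1// => i Si; rewrite indicE memNset// => ci.
  by apply: nVx; apply/bigsetU_ordP; exists i => //; rewrite ltn_ord.
rewrite V1; set F := nhits B l x in N0 *.
have sq0 : 0 <= (2 * tau)^-1 * F ^+ 2 by rewrite mulr_ge0 ?sqr_ge0// ltW.
have t2 : 0 <= tau / 2 * \1_(V `\` E) x by rewrite mulr_ge0// ltW// divr_gt0.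
have [Vx|nVx] := pselect (V x); last first.
  by rewrite indicE (memNset nVx) mulr0 addr_ge0// addr_ge0.
rewrite [X in _ * X <= _]indicE mem_set// mulr1.
have [Ex|nEx] := pselect (E x).
  by apply: le_trans (FM _ Ex) _; rewrite lerDl addr_ge0.
rewrite /= [X in _ <= _ + (_ * X + _)]indicE mem_set// mulr1.
apply: (@le_trans _ _ (tau / 2 + (2 * tau)^-1 * F ^+ 2)); last by rewrite lerDr.
have -> : tau / 2 + (2 * tau)^-1 * F ^+ 2 = F + (2 * tau)^-1 * (tau - F) ^+ 2.
  by field; lra.
by rewrite lerDl mulr_ge0 ?sqr_ge0// ltW.
Qed.

(** If the expected number of hits in every cell is eventually proportional to
    |cell| s_N, with a constant independent of the cell, and the second moment
    is O(s_N^2), then almost every point is hit unboundedly often. Were the set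
    E of points with at most M hits of positive measure, it would nearly fill
    a union V of cells; then [second_moment_ineq] with tau a large multiple of
    s_N contradicts the lower bound on V. *)
Theorem l2_borel_cantelli (T : Type) (B : T -> set R) (L : nat -> seq T) (s : nat -> R)
    (c C : R) :
  (forall t, measurable (B t)) -> 0 < c -> 0 <= C ->
  (forall K, exists N0, forall N, (N0 <= N)%N -> K <= s N) ->
  (forall j i, (i < 2 ^ j)%N -> exists N0, forall N, (N0 <= N)%N ->
     ((c / 2 ^+ j * s N)%:E <= \sum_(t <- L N) mu (B t `&` cell j i `&` D))%E) ->
  (exists N0, forall N, (N0 <= N)%N ->
     (\sum_(t <- L N) \sum_(u <- L N) mu (B t `&` B u `&` D) <= (C * s N ^+ 2)%:E)%E) ->
  forall M, mu (hits_le B L M) = 0%E.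
Proof.
move=> mB c0 C0 sinf first second M.
suff: forall M, 0 <= M -> mu (hits_le B L M) = 0%E.
  move=> h; have [M0|M0] := leP 0 M; first exact: h.
  have := h 0 (lexx _) => h0; apply: subset_measure0 h0 => //.
  - exact: measurable_hits_le.
  - exact: measurable_hits_le.
  - by move=> x [Dx hx]; split=> // N _; apply: le_trans (hx N _) (ltW M0).
move=> {}M M0.
set E := hits_le B L M.
have mE : measurable E by exact: measurable_hits_le.
have mD : measurable D by exact: measurable_itv.
have muD : mu D = 1%E by rewrite lebesgue_measure_itv/= lte01 -EFinB subr0.
have ED : E `<=` D by move=> x [].
apply/eqP; rewrite eq_le measure_ge0 andbT leNgt; apply/negP => E0.
have [e e0 eE] : exists2 e : R, 0 < e & (e%:E < mu E)%E.
  have E1 : (mu E <= 1)%E by rewrite -muD; apply: le_measure; rewrite ?inE.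
  move: E0 E1; case: (mu E) => [x| |]//=; rewrite lte_fin => x0 _.
  by exists (x / 2); rewrite ?divr_gt0// lte_fin; lra.
(* tau = theta * s N makes the second moment term at most a quarter of the
   first moment on V; eta then does the same for the exceptional set V \ E. *)
pose theta := 2 * (C + 1) / (c * e).
have ce0 : 0 < c * e by exact: mulr_gt0.
have theta0 : 0 < theta by rewrite divr_gt0// mulr_gt0// ltr_wpDl.
pose eta := c * e / (2 * theta).
have eta0 : 0 < eta by rewrite divr_gt0// mulr_gt0.
have [j [S [Sj VE eV]]] := cells_approx mE ED eta0 eE.
set V := \big[_/_]_(i < _ | _) _ in VE eV.
have [N1 h1] : exists N0, forall N, (N0 <= N)%N -> forall i, (i < 2 ^ j)%N ->
     ((c / 2 ^+ j * s N)%:E <= \sum_(t <- L N) mu (B t `&` cell j i `&` D))%E.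
  have h (i : 'I_(2 ^ j)) := first j i (ltn_ord i).
  have [f hf] := choice h.
  exists (\max_i f i) => N hN i ij; apply: (hf (Ordinal ij)).
  by apply: leq_trans hN; exact: leq_bigmax.
have [N2 h2] := second.
have [N3 h3] := sinf (4 * (M + 1) / (c * e)).
pose N := maxn N1 (maxn N2 N3).
have {}h1 := h1 N (leq_maxl _ _).
have {}h2 := h2 N (leq_trans (leq_maxl _ _) (leq_maxr _ _)).
have {}h3 := h3 N (leq_trans (leq_maxr _ _) (leq_maxr _ _)).
have s0 : 0 < s N by apply: lt_le_trans h3; rewrite divr_gt0// mulr_gt0// ltr_wpDl.
pose tau := theta * s N.
have tau0 : 0 < tau by exact: mulr_gt0.
have FM x : E x -> nhits B (L N) x <= M by move=> [_ /(_ N I)].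
have main := second_moment_ineq j S mB mE M0 tau0 FM.
pose n := \sum_(i < 2 ^ j | S i) (2 ^+ j)^-1 : R.
have nV : e < n.
  rewrite -lte_fin; apply: (lt_le_trans eV).
  rewrite /n -sumEFin /V big_mkcond [X in (_ <= X)%E]big_mkcond/=.
  have mF i : measurable (if S i then cell j i else set0).
    by case: ifP => _; [exact: measurable_cell|exact: measurable0].
  apply: (le_trans (@Boole_inequality _ _ _ (@lebesgue_measure R)
    (fun i => if S i then cell j i else set0) (2 ^ j) (fun i _ => mF i))).
  by apply: lee_sum => i _; case: (S i); [rewrite -(mu_cell j i)|rewrite measure0].
have lower : ((c * s N * n)%:E <= \sum_(i < 2 ^ j | S i) \sum_(t <- L N) mu (B t `&` cell j i `&` D))%E.
  rewrite /n mulr_sumr -sumEFin; apply: lee_sum => i _.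
  by have := h1 i (ltn_ord i); rewrite mulrAC.
have upper : (M%:E + (2 * tau)^-1%:E * \sum_(t <- L N) \sum_(u <- L N) mu (B t `&` B u `&` D)
   + (tau / 2)%:E * mu ((V `\` E) `&` D) <= (M + (2 * tau)^-1 * (C * s N ^+ 2) + tau / 2 * eta)%:E)%E.
  rewrite !EFinD; apply: leeD; first apply: leeD => //.
    by rewrite EFinM; apply: lee_wpmul2l => //; rewrite lee_fin invr_ge0 mulr_ge0// ltW.
  rewrite (EFinM (tau / 2)); apply: lee_wpmul2l; first by rewrite lee_fin divr_ge0// ltW.
  apply: le_trans (ltW VE); apply: mu_le.
  - apply: measurableI => //; apply: measurableD => //.
    by apply: bigsetU_measurable => i _; exact: measurable_cell.
  - apply: measurableD => //.
    by apply: bigsetU_measurable => i _; exact: measurable_cell.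
  - by move=> x [].
have := le_trans lower (le_trans main upper); rewrite lee_fin; apply/negP; rewrite -ltNge.
have -> : (2 * tau)^-1 * (C * s N ^+ 2) = C / (C + 1) * (c * e) * s N / 4.
  rewrite /tau /theta; field.
  by rewrite !lt0r_neq0// ltr_wpDl.
have -> : tau / 2 * eta = c * e * s N / 4.
  rewrite /tau /eta; field; by rewrite lt0r_neq0.
have C1 : C / (C + 1) <= 1 by rewrite ler_pdivrMr ?ltr_wpDl// mul1r lerDl.
have hM : M < c * e * s N / 4.
  move: h3; rewrite ler_pdivrMr//; lra.
have := ler_wpM2r (ltW (mulr_gt0 ce0 s0)) C1.
have := ltr_pM2l (mulr_gt0 c0 s0) e n; rewrite nV.
lra.
Qed.
End BC.

(** * Distance to the nearest integer and badly approximable numbers *)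


Section Dist.
Context {R : realType}.
Notation mu := (@lebesgue_measure R).
Notation D := (`[0%R, 1%R[%classic : set R).
Implicit Types x y r a : R.

Lemma dist_int_le x (m : int) : dist_int x <= `|x - m%:~R|.
Proof.
apply: ge_inf; last by exists m.
by exists 0 => _ [m' _ <-].
Qed.

Lemma dist_int_attained x : exists m : int, dist_int x = `|x - m%:~R|.
Proof.
pose m := Num.floor (x + 2^-1); exists m; apply/eqP; rewrite eq_le dist_int_le/=.
apply: lb_le_inf; first by exists `|x - 0%:~R|, 0.
move=> _ [m' _ <-].
have /andP[h1 h2] := mem_rg1_floor (x + 2^-1).
rewrite -/m in h1 h2.
have h3 : `|x - m%:~R| <= 2^-1 by rewrite ler_norml; apply/andP; split; lra.
have [->//|ne] := eqVneq m' m.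
have : 1 <= `|m'%:~R - m%:~R| :> R.
  by rewrite -intrB -intr_norm (ler_int _ 1) -gtz0_ge1 normr_gt0 subr_eq0.
have := ler_distD x (m'%:~R) (m%:~R : R); rewrite (distrC (m'%:~R) x); lra.
Qed.

Lemma dist_int_ge0 x : 0 <= dist_int x.
Proof. by have [m ->] := dist_int_attained x. Qed.

Lemma dist_intP x r : dist_int x <= r <-> exists m : int, `|x - m%:~R| <= r.
Proof.
split; first by have [m ->] := dist_int_attained x; exists m.
by move=> [m h]; apply: le_trans h; exact: dist_int_le.
Qed.

Lemma dist_intN x : dist_int (- x) = dist_int x.
Proof.
apply/eqP; rewrite eq_le; apply/andP; split.
- have [m ->] := dist_int_attained x.
  by apply: le_trans (dist_int_le _ (- m)) _; rewrite mulrNz -opprD normrN.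
- have [m ->] := dist_int_attained (- x).
  apply: le_trans (dist_int_le _ (- m)) _; rewrite mulrNz opprK -normrN.
  by rewrite [X in `|X|]opprD.
Qed.

Lemma dist_intD x y : dist_int (x + y) <= dist_int x + dist_int y.
Proof.
have [m ->] := dist_int_attained x; have [m' ->] := dist_int_attained y.
apply: le_trans (dist_int_le _ (m + m')) _; rewrite rmorphD/= opprD addrACA.
exact: ler_normD.
Qed.

Lemma dist_intB x y : dist_int (x - y) <= dist_int x + dist_int y.
Proof. by rewrite -(dist_intN y); exact: dist_intD. Qed.

Lemma dist_int_addz x (m : int) : dist_int (x + m%:~R) = dist_int x.
Proof.
have dm (k : int) : dist_int (k%:~R : R) <= 0.
  by apply: le_trans (dist_int_le _ k) _; rewrite subrr normr0.
apply/eqP; rewrite eq_le; apply/andP; split.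
- by apply: le_trans (dist_intD _ _) _; rewrite -[X in _ <= X]addr0 lerD2l.
- rewrite -{1}[x](addrK (m%:~R)); apply: le_trans (dist_intB _ _) _.
  by rewrite -[X in _ <= X]addr0 lerD2l.
Qed.

Lemma frac_part_itv x : 0 <= frac_part x < 1.
Proof.
by have /andP[h1 h2] := mem_rg1_floor x; rewrite /frac_part; apply/andP; split; lra.
Qed.

(** The targets of the inhomogeneous problem, as subsets of the whole line; they
    are 1-periodic. *)
Definition hit r a : set R := [set g | dist_int (a + g) <= r].

Lemma hitE r a : hit r a = \bigcup_(m : int) `[m%:~R - a - r, m%:~R - a + r]%classic.
Proof.
apply/seteqP; split => g /=.
  by move/dist_intP => [m h]; exists m => //=; rewrite in_itv/=; move: h; rewrite ler_norml; lra.
move=> [m _] /=; rewrite in_itv/= => h; apply/dist_intP; exists m.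
by rewrite ler_norml; lra.
Qed.

Lemma measurable_hit r a : measurable (hit r a).
Proof.
rewrite hitE; exact: (@countable_bigcupT_measurable _ _ int).
Qed.

(** For r < 1/2 at most three of the intervals of [hitE], of length 2 r each, meet
    the unit interval; for larger r the bound exceeds 1. *)
Lemma mu_hit_le r a : 0 <= r -> (mu (hit r a `&` D) <= (6 * r)%:E)%E.
Proof.
move=> r0.
have mD : measurable D by exact: measurable_itv.
have [hr|hr] := leP r 2^-1; last first.
  apply: le_trans (mu_le _ mD (@subIsetr _ _ _)) _.
    by apply: measurableI => //; exact: measurable_hit.
  by rewrite lebesgue_measure_itv/= lte01 -EFinB subr0 lee_fin; lra.
pose I (i : nat) : set R := `[(Num.floor a)%:~R + i%:R - a - r, (Num.floor a)%:~R + i%:R - a + r]%classic.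
have mI i : measurable (I i) by exact: measurable_itv.
have sub : hit r a `&` D `<=` \big[setU/set0]_(i < 3) I i.
  move=> g [/dist_intP[m h]]; rewrite /= in_itv/= => g01.
  have /andP[h1 h2] := mem_rg1_floor a.
  set f := Num.floor a in h1 h2 *.
  have : (f - 1 < m < f + 3)%R.
    rewrite -!(ltr_int R) !rmorphD/= rmorphN/=; move: h; rewrite ler_norml; lra.
  move=> /andP[m1 m2].
  have [i i3 mi] : exists2 i : nat, (i < 3)%N & m = f + i%:Z.
    exists `|m - f|%N; lia.
  apply/(bigsetU_ordP 3 xpredT); exists i; first by rewrite i3.
  rewrite /I/= in_itv/=; move: h; rewrite mi rmorphD/= -pmulrn ler_norml; lra.
apply: le_trans (mu_le _ _ sub) _.
- by apply: measurableI => //; exact: measurable_hit.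
- by apply: bigsetU_measurable => i _; exact: mI.
apply: (le_trans (@Boole_inequality _ _ _ (@lebesgue_measure R) I 3 (fun i _ => mI i))).
have muI i : (mu (I i) <= (2 * r)%:E)%E.
  rewrite /I lebesgue_measure_itv/=; case: ifP => _; rewrite -?EFinB lee_fin; lra.
apply: (@le_trans _ _ (\sum_(i < 3) (2 * r)%:E)%E); first by apply: lee_sum => i _; exact: muI.
by rewrite sumEFin lee_fin big_const_ord iter_addr_0 -mulr_natr; lra.
Qed.

Lemma mu_hit_ge r a (u v : R) : 0 < r -> u + r <= 1 - frac_part a <= v - r ->
  ((2 * r)%:E <= mu (hit r a `&` `[u, v[))%E.
Proof.
move=> r0 h.
pose x := 1 - frac_part a.
have -> : (2 * r)%:E = mu `]x - r, x + r[.
  rewrite lebesgue_measure_itv/= lte_fin ifT; last lra.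
  by rewrite -EFinB; congr EFin; lra.
apply: mu_le.
- exact: measurable_itv.
- by apply: measurableI; [exact: measurable_hit|exact: measurable_itv].
- move=> g /=; rewrite !in_itv/= => hg; split; last by move: h hg; rewrite -/x; lra.
  apply/dist_intP; exists (Num.floor a + 1); rewrite rmorphD/=.
  by move: hg; rewrite /x /frac_part ler_norml; lra.
Qed.

Lemma limn_einf_gt0 (u : nat -> R) : (0 < limn_einf (fun n => (u n)%:E))%E ->
  exists2 c : R, 0 < c & exists N, forall n, (N <= n)%N -> c <= u n.
Proof.
rewrite limn_einf_lim => h.
have [N hN] : exists N, (0 < einfs (fun n => (u n)%:E) N)%E.
  apply: contrapT => no; move: h; apply/negP; rewrite -leNgt.
  apply: lime_le; first exact: is_cvg_einfs.
  by apply: nearW => n; rewrite leNgt; apply/negP => h; apply: no; exists n.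
have lb n : (N <= n)%N -> (einfs (fun n => (u n)%:E) N <= (u n)%:E)%E.
  by move=> Nn; apply: ereal_inf_lbound; exists n.
move: hN lb; case: (einfs _ N) => [c| |]//=.
- by rewrite lte_fin => c0 lb; exists c => //; exists N => n /lb; rewrite lee_fin.
- by move=> _ /(_ N (leqnn N)).
Qed.

Lemma gt0_limn_einf (u : nat -> R) (c : R) N : 0 < c ->
  (forall n, (N <= n)%N -> c <= u n) -> (0 < limn_einf (fun n => (u n)%:E))%E.
Proof.
move=> c0 h; apply: (@lt_le_trans _ _ c%:E); first by rewrite lte_fin.
rewrite limn_einf_lim; apply: lime_ge; first exact: is_cvg_einfs.
exists N => // n /= Nn; apply: le_ereal_inf_tmp => _ [k /= nk <-].
by rewrite lee_fin h// (leq_trans Nn).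
Qed.

(** The lower limit controls large n; the finitely many small n are harmless
    because a zero of dist_int (n alpha) would recur along all multiples of n. *)
Lemma BAD_const alpha : BAD R alpha ->
  exists2 c : R, 0 < c & forall n, (0 < n)%N -> c <= n%:R * dist_int (n%:R * alpha).
Proof.
move=> [_ /limn_einf_gt0[c c0 [N hN]]].
have pos n : (0 < n)%N -> 0 < n%:R * dist_int (n%:R * alpha).
  move=> n0; rewrite mulr_gt0 ?ltr0n// lt_neqAle dist_int_ge0 andbT eq_sym.
  apply/negP => /eqP d0.
  have mul k : dist_int ((k * n)%:R * alpha) = 0.
    apply/eqP; rewrite eq_le dist_int_ge0 andbT.
    have [m] := dist_int_attained (n%:R * alpha); rewrite d0 => /esym/eqP.
    rewrite normr_eq0 subr_eq0 => /eqP e.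
    apply: le_trans (dist_int_le _ (m * k%:Z)) _.
    have -> : (k * n)%:R * alpha - (m * k)%:~R = k%:R * (n%:R * alpha - m%:~R).
      by rewrite natrM rmorphM/= -pmulrn; ring.
    by rewrite e subrr mulr0 normr0.
  have := hN (N.+1 * n)%N; rewrite mul mulr0; rewrite leNgt c0 => /(_ _)/negP.
  by move=> H; have := H (leq_trans (leqnSn N) (leq_pmulr _ n0)).
elim: N {-2}N (leqnn N) c c0 hN => [|M IH] N NM c c0 hN.
  by exists c => // n _; apply: hN; move: NM; rewrite leqn0 => /eqP ->.
case: N NM hN => [_ hN|N NM hN]; first by exists c => // n _; exact: hN.
have [N0|N0] := posnP N.
  by exists c => // n n0; apply: hN; rewrite N0.
pose c' := Num.min c (N%:R * dist_int (N%:R * alpha)).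
apply: (IH N NM c'); first by rewrite lt_min c0 pos.
move=> n; rewrite leq_eqVlt => /orP[/eqP<-|/hN h].
  by rewrite /c' ge_min lexx orbT.
by rewrite /c' ge_min h.
Qed.
End Dist.

(** * Numbers outside BAD_P are not in the intersection *)


Lemma card_nat_seq (S : set nat) (s : seq nat) :
  uniq s -> (forall n, S n <-> n \in s) -> card_nat S = size s.
Proof.
move=> us h; rewrite /card_nat.
have -> : fset_set S = [fset x in s]%fset.
  apply/fsetP => n; rewrite in_fset_set; last first.
    apply: (@sub_finite_set _ _ [set` s]); last exact: finite_seq.
    by move=> k /h.
  rewrite !inE; apply/idP/idP; first by rewrite inE => /h.
  by move=> ns; rewrite inE; apply/h.
by rewrite card_fseq undup_id.
Qed.

Definition cnt (A : set nat) (a b : nat) : nat := (\sum_(a <= n < b | n \in A) 1)%N.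

Lemma cnt_size A a b : cnt A a b = size [seq n <- index_iota a b | n \in A].
Proof. by rewrite /cnt -big_filter sum1_size. Qed.

Lemma card_nat_itv A a b (S : set nat) :
  (forall n, S n <-> [/\ A n, (a <= n)%N & (n < b)%N]) -> card_nat S = cnt A a b.
Proof.
move=> h; rewrite cnt_size; apply: card_nat_seq; first by rewrite filter_uniq// iota_uniq.
move=> n; rewrite mem_filter mem_index_iota h; split.
  by move=> [An -> ->]; rewrite !andbT inE.
by move=> /and3P[]; rewrite inE.
Qed.

Lemma cnt_le A a b : (cnt A a b <= b - a)%N.
Proof.
by rewrite cnt_size size_filter (leq_trans (count_size _ _))// size_iota.
Qed.

Lemma cnt_cat A a b c : (a <= b)%N -> (b <= c)%N -> cnt A a c = (cnt A a b + cnt A b c)%N.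
Proof. by move=> ab bc; rewrite /cnt (@big_cat_nat _ _ _ b). Qed.

Lemma infinite_natP (S : set nat) :
  infinite_set S <-> forall M, exists2 n, (M <= n)%N & S n.
Proof.
split => [h M|h fS].
  apply: contrapT => no; apply: h; apply: (@sub_finite_set _ _ `I_M); last exact: finite_II.
  by move=> n Sn /=; rewrite ltnNge; apply/negP => Mn; apply: no; exists n.
have [n h1 h2] := h (\max_(k <- fset_set S) k).+1.
have : n \in fset_set S by rewrite in_fset_set// inE.
move=> /(@leq_bigmax_seq _ _ xpredT (fun k => k)) /(_ isT) h3.
by move: (leq_trans h1 h3); rewrite ltnn.
Qed.

Section Tset.
Context {R : realType}.
Notation mu := (@lebesgue_measure R).
Notation D := (`[0%R, 1%R[%classic : set R).

Lemma T_setE A (psi : nat -> R) alpha : T_set A psi alpha =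
  D `&` \bigcap_M \bigcup_(n in [set n | (M <= n)%N /\ A n]) hit (psi n) (n%:R * alpha).
Proof.
apply/seteqP; split => g.
  move=> [g01 /infinite_natP h]; split=> // M _.
  by have [n Mn [An hn]] := h M; exists n.
move=> [g01 h]; split=> //; apply/infinite_natP => M.
by have [n [Mn An] hn] := h M I; exists n.
Qed.

Lemma measurable_T_set A (psi : nat -> R) alpha : measurable (T_set A psi alpha).
Proof.
rewrite T_setE; apply: measurableI; first exact: measurable_itv.
apply: bigcap_measurable => // M _; apply: bigcup_measurable => n _.
exact: measurable_hit.
Qed.

Lemma esum_ge_nat (A : set nat) (F : nat -> R) n : (forall k, A k -> 0 <= F k) ->
  ((\sum_(0 <= k < n | k \in A) F k)%:E <= \esum_(k in A) (F k)%:E)%E.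
Proof.
move=> F0; rewrite -big_filter.
apply: ereal_sup_ubound; exists [set` [seq k <- index_iota 0 n | k \in A]].
  split; first exact: finite_seq.
  by move=> k /=; rewrite mem_filter => /andP[]; rewrite inE.
by rewrite -fsbig_seq ?filter_uniq ?iota_uniq//= sumEFin.
Qed.
End Tset.

Section Subset.
Context {R : realType}.
Notation mu := (@lebesgue_measure R).
Notation D := (`[0%R, 1%R[%classic : set R).
Variables (A P : set nat).
Hypothesis PP : P `<=` [set p | prime p].
Variables (C : R) (x0 : nat).
Hypothesis C0 : 0 < C.
Hypothesis dens : forall x : nat, (x0 <= x)%N ->
   x%:R * eul P x.+1 <= C * (cnt A x (2 * x))%:R.

(** Since q alpha is close to an integer p, n alpha is within
    n dist_int (q alpha) / q of the multiple n p / q of 1 / q. *)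
Lemma approx_rational (alpha : R) (q n : nat) (r : R) : (0 < q)%N ->
  exists2 j, (j < q)%N &
    hit r (n%:R * alpha) `<=` hit (r + n%:R * dist_int (q%:R * alpha) / q%:R) (j%:R / q%:R).
Proof.
move=> q0; have [p ep] := dist_int_attained (q%:R * alpha).
have q0' : (0 : R) < q%:R by rewrite ltr0n.
pose j := `|(p * n%:Z %% q%:Z)%Z|%N.
have qz : (q%:Z != 0) by rewrite eqz_nat -lt0n.
have ej : j%:Z = (p * n%:Z %% q%:Z)%Z by rewrite /j gez0_abs// modz_ge0.
exists j; first by rewrite -ltz_nat ej ltz_pmod// ltz_nat.
move=> g; rewrite /hit/= => hg.
have e : (p * n%:Z) = (p * n%:Z %/ q%:Z)%Z * q%:Z + j%:Z by rewrite ej -divz_eq.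
set d := (p * n%:Z %/ q%:Z)%Z in e.
have er : n%:R * p%:~R = d%:~R * q%:R + j%:R :> R.
  by have := congr1 (fun z : int => z%:~R : R) e; rewrite rmorphM rmorphD/= rmorphM/= -!pmulrn mulrC.
have -> : j%:R / q%:R + g = (n%:R * alpha + g) - (n%:R * (q%:R * alpha - p%:~R) / q%:R) + (- d)%:~R.
  rewrite rmorphN/=.
  have -> : j%:R = n%:R * p%:~R - d%:~R * q%:R :> R by rewrite er; ring.
  by field; rewrite lt0r_neq0.
rewrite dist_int_addz; apply: le_trans (dist_intB _ _) _; apply: lerD => //.
apply: le_trans (dist_int_le _ 0) _; rewrite subr0 normrM normfV normrM (ger0_norm (ltW q0')).
by rewrite -ep ger0_norm.
Qed.

(** An extremely good denominator q makes the points n alpha, n < 2x, cluster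
    around the q multiples of 1 / q as long as x dist_int (q alpha) is small.
    With x about t q f(q), the block [x, 2x) still contains at least a constant
    times t q elements of A, so that intervals of radius 1 / #(A in [x, 2x))
    around them, whose total length is 2, cover together only O(1 / t). *)
Lemma sparse_block (alpha : R) :
  (forall (c : R) N, 0 < c -> exists2 q, (N <= q)%N & q%:R * dist_int (q%:R * alpha) * f_prod P q < c) ->
  forall (e : R) (X : nat), 0 < e -> exists x : nat,
    [/\ (X <= x)%N, (0 < cnt A x (2 * x))%N, (X <= cnt A x (2 * x))%N &
    exists U : set R, [/\ measurable U, (mu U <= e%:E)%E &
      forall n, (n < 2 * x)%N -> hit (cnt A x (2 * x))%:R^-1 (n%:R * alpha) `&` D `<=` U]].
Proof.
move=> hq e X e0.
pose c1 : R := expR (- 32) / (2 * C).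
have c10 : 0 < c1 by rewrite divr_gt0 ?expR_gt0// mulr_gt0.
(* t makes the radii contribute at most e / 2; eps, chosen after t, does the
   same for the spread of the points around the multiples of 1 / q. *)
pose t := (Num.truncn (12 / (c1 * e)) + X.+1)%N.
have ht : 12 / (c1 * e) < t%:R.
  by apply: lt_le_trans (truncnS_gt _) _; rewrite ler_nat /t addnS ltnS leq_addr.
have t0 : (0 : R) < t%:R by rewrite ltr0n /t addnS.
pose eps := e / (48 * t%:R).
have eps0 : 0 < eps by rewrite divr_gt0// mulr_gt0.
have [q Nq hqe] := hq eps (maxn (maxn t X) (maxn x0 (Num.truncn (X%:R / c1)).+2)) eps0.
move: Nq; rewrite !geq_max => /andP[/andP[qt qX] /andP[qx0 qc]].
have q0 : (0 < q)%N by exact: leq_ltn_trans (leq0n _) qc.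
have q0' : (0 : R) < q%:R by rewrite ltr0n.
set f := f_prod P q in hqe.
have f1 : 1 <= f by exact: f_prod_ge1.
have f0 : 0 < f by apply: lt_le_trans f1.
pose m := (Num.truncn f).+1.
have m1 : f <= m%:R by apply/ltW/truncnS_gt.
have m2 : m%:R <= 2 * f.
  have := truncn_itv (ltW f0) => /andP[h _].
  by rewrite /m -addn1 natrD; lra.
pose x := (t * q * m)%N.
have xq : (q <= x)%N by rewrite /x mulnAC leq_pmull// muln_gt0 /t addnS.
have hx : (x%:R : R) = t%:R * q%:R * m%:R by rewrite /x !natrM.
pose a := trunc_log 2 q.
have a0 : (0 < a)%N by rewrite trunc_log_gt0//=; exact: leq_ltn_trans (ltn0Sn _) qc.
have qa1 : (2 ^ a <= q)%N by exact: trunc_logP.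
have qa2 : (q < 2 ^ a.+1)%N by exact: trunc_log_ltn.
have mq : (m <= 2 * q.+1)%N.
  rewrite -(ler_nat R) natrM; apply: le_trans m2 _; rewrite ler_wpM2l//.
  exact: f_prod_leS.
(* x is polynomially bounded in q, hence eul P x is comparable to eul P q. *)
have xb : (x.+1 <= 2 ^ (8 * a))%N.
  apply: (@leq_trans ((2 ^ a.+1) * (2 ^ a.+1) * (2 * 2 ^ a.+1))).
    rewrite /x; apply: (@leq_ltn_trans (q * q * (2 * q.+1))).
      by rewrite !leq_mul.
    apply: (@leq_ltn_trans (q * q * (2 * 2 ^ a.+1))); first by rewrite leq_mul// leq_mul.
    by rewrite ltn_mul2r; apply/andP; split; [rewrite muln_gt0 expn_gt0|rewrite ltn_mul].
  by rewrite -expnS -!expnD leq_exp2l//; clear -a0; lia.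
have eulx : expR (- 32) / 2 <= eul P x.+1 * f.
  have h1 : eul P q.+1 <= eul P (2 ^ a) :> R by apply: eul_nincr => //; exact: leqW.
  have h2 : eul P (2 ^ (8 * a)) <= eul P x.+1 :> R by exact: eul_nincr.
  have h3 := @eul_dyadic R P PP a (8 * a) a0 (leq_pmull _ _).
  have {}h3 := h3 isT.
  have e8 : 4 * ((8 * a)%:R / a%:R) = 32 :> R.
    by rewrite natrM mulfK ?pnatr_eq0 -?lt0n// -natrM.
  rewrite e8 in h3.
  have h4 := @f_eul R P PP q; rewrite -/f in h4.
  have h5 := expR_gt0 (- 32 : R).
  have h6 : eul P q.+1 * expR (- 32) <= eul P x.+1 :> R.
    by apply: le_trans h2; apply: le_trans h3; rewrite ler_pM2r.
  apply: le_trans (ler_wpM2r (ltW f0) h6).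
  by rewrite mulrAC mulrC ler_pM2r// mulrC.
have hN : c1 * t%:R * q%:R <= (cnt A x (2 * x))%:R.
  have := dens (leq_trans qx0 xq) => h.
  have h1 : C * (c1 * t%:R * q%:R) <= x%:R * eul P x.+1.
    have -> : C * (c1 * t%:R * q%:R) = (t%:R * q%:R) * (expR (- 32) / 2).
      by rewrite /c1; field; rewrite lt0r_neq0.
    rewrite hx -[X in _ <= X]mulrA; apply: ler_wpM2l; first by rewrite mulr_ge0// ltW.
    by apply: le_trans eulx _; rewrite mulrC ler_pM2r// eul_gt0.
  by rewrite -(ler_pM2l C0); exact: le_trans h1 h.
set N := cnt A x (2 * x) in hN *.
have N0 : (0 : R) < N%:R by apply: lt_le_trans hN; exact: mulr_gt0 (mulr_gt0 c10 t0) q0'.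
have XN : (X <= N)%N.
  rewrite -(ler_nat R); apply: le_trans hN.
  have h1 : X%:R / c1 <= q%:R.
    by apply: le_trans (ltW (truncnS_gt _)) _; rewrite ler_nat ltnW.
  rewrite ler_pdivrMr// in h1; apply: le_trans h1 _.
  have t1 : (0 : R) <= t%:R - 1 by rewrite subr_ge0 ler1n /t addnS.
  have := mulr_ge0 t1 (mulr_ge0 (ltW c10) (ltW q0')); lra.
exists x; split.
- exact: leq_trans qX xq.
- by rewrite -(ltr_nat R).
- exact: XN.
pose rr : R := N%:R^-1 + (2 * x)%:R * dist_int (q%:R * alpha) / q%:R.
have d0 := dist_int_ge0 (q%:R * alpha).
have rr0 : 0 <= rr by rewrite addr_ge0 ?invr_ge0 ?divr_ge0 ?mulr_ge0.
pose U := \big[setU/set0]_(j < q) (hit rr (j%:R / q%:R) `&` D).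
have mU (j : nat) : measurable (hit rr (j%:R / q%:R) `&` D).
  by apply: measurableI; [exact: measurable_hit|exact: measurable_itv].
exists U; split.
- by apply: bigsetU_measurable => j _; exact: mU.
- apply: (le_trans (@Boole_inequality _ _ _ (@lebesgue_measure R)
    (fun j => hit rr (j%:R / q%:R) `&` D) q (fun i _ => mU i))).
  apply: (@le_trans _ _ (\sum_(j < q) (6 * rr)%:E)%E).
    by apply: lee_sum => j _; exact: mu_hit_le.
  rewrite sumEFin lee_fin big_const_ord iter_addr_0 -(mulr_natl (6 * rr)).
  have -> : q%:R * (6 * rr) = 6 * q%:R / N%:R + 12 * x%:R * dist_int (q%:R * alpha).
    by rewrite /rr natrM; field; rewrite !lt0r_neq0.
  have h1 : 6 * q%:R / N%:R <= e / 2.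
    rewrite ler_pdivrMr//.
    rewrite ltr_pdivrMr ?(mulr_gt0 c10 e0)// in ht.
    have h1 : 12 * q%:R <= e * (c1 * t%:R * q%:R).
      by have := ler_pM2r q0' 12 (t%:R * (c1 * e)); rewrite (ltW ht); lra.
    have := ler_wpM2l (ltW e0) hN; lra.
  have h2 : 12 * x%:R * dist_int (q%:R * alpha) <= e / 2.
    have hm : q%:R * dist_int (q%:R * alpha) * m%:R <= 2 * eps.
      apply: le_trans (ler_wpM2l _ m2) _; first by rewrite mulr_ge0.
      lra.
    rewrite hx.
    have := ler_wpM2l (ltW t0) hm.
    have -> : t%:R * (2 * eps) = e / 24 by rewrite /eps; field; rewrite lt0r_neq0.
    lra.
  lra.
- move=> n nx g [hg gD].
  have [j jq hj] := approx_rational alpha n N%:R^-1 q0.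
  apply/(bigsetU_ordP q xpredT (fun j : nat => hit rr (j%:R / q%:R) `&` D)); exists j; first by rewrite jq.
  split=> //; have := hj _ hg; rewrite /hit/= => h; apply: le_trans h _.
  by rewrite /rr lerD2l ler_pM2r ?invr_gt0// ler_wpM2r// ler_nat ltnW.
Qed.

(** Glue sparse blocks with covers of measure 2^-(i+2) into one step function
    psi, equal to 1 / #(A in [x_i, 2 x_i)) up to 2 x_i. Every block adds 1 to the
    sum of psi over A, while the whole of T_set is contained in a set of measure
    at most 1/2. *)
Lemma bigcap_K_set_sub_BAD_of (alpha : R) : infinite_set A ->
  (\bigcap_(psi in M_class A) @K_set R A psi) alpha -> BAD_of P alpha.
Proof.
move=> Ainf Xa.
(* The intersection is over a nonempty family: the constant 1 is in M_class. *)
have a01 : alpha \in `[0, 1[.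
  have M1 : M_class A (fun _ => 1 : R).
    split=> //; apply/eqyP => K K0.
    have [N hN] : exists N, K <= (cnt A 0 N)%:R.
      have h : forall k, exists N, (k <= cnt A 0 N)%N.
        elim=> [|k [N kN]]; first by exists 0%N.
        have [n Nn An] := (infinite_natP A).1 Ainf N.
        exists n.+1; rewrite (@cnt_cat A 0 N n.+1)//; last exact: leqW.
        rewrite -addn1 leq_add// /cnt big_mkcond big_nat_recr//= mem_set//.
        by rewrite addn1.
      have [N hN] := h (Num.truncn K).+1.
      by exists N; apply: le_trans (ltW (truncnS_gt _)) _; rewrite ler_nat.
    have := @esum_ge_nat R A (fun _ => 1) N (fun _ _ => ler01).
    apply: le_trans; rewrite lee_fin; apply: le_trans hN _.
    by rewrite /cnt natr_sum.
  by have [] := Xa _ M1.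
split=> //; apply: contrapT => nB.
have hq (c : R) N : 0 < c -> exists2 q, (N <= q)%N &
    q%:R * dist_int (q%:R * alpha) * f_prod P q < c.
  move=> c0; apply: contrapT => no; apply: nB; apply: (gt0_limn_einf (N := N) c0).
  by move=> n Nn; rewrite leNgt; apply/negP => h; apply: no; exists n.
have hb (p : nat * nat) : exists x : nat,
    [/\ (p.2 <= x)%N, (0 < cnt A x (2 * x))%N, (p.2 <= cnt A x (2 * x))%N &
    exists U : set R, [/\ measurable U, (mu U <= (2 ^- (p.1 + 2))%:E)%E &
      forall n, (n < 2 * x)%N -> hit (cnt A x (2 * x))%:R^-1 (n%:R * alpha) `&` D `<=` U]].
  by apply: sparse_block => //; rewrite invr_gt0 exprn_gt0.
have [g hg] := choice hb.
(* Each new block starts beyond the previous one and has more elements than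
   the previous one has integers, which makes psi monotone. *)
pose fix xs (i : nat) : nat := if i is j.+1 then g (j.+1, (2 * xs j)%N) else g (0, 1)%N.
pose N i := cnt A (xs i) (2 * xs i).
have xsP i : [/\ (0 < xs i)%N, (0 < N i)%N & exists U : set R, [/\ measurable U,
     (mu U <= (2 ^- (i + 2))%:E)%E &
      forall n, (n < 2 * xs i)%N -> hit (N i)%:R^-1 (n%:R * alpha) `&` D `<=` U]].
  elim: i => [|i [xi _ _]]; first by have [h1 h2 h3 h4] := hg (0, 1)%N; split.
  have [h1 h2 h3 h4] := hg (i.+1, 2 * xs i)%N; split=> //.
  by apply: leq_trans h1; rewrite muln_gt0.
have xsS i : (2 * xs i <= xs i.+1)%N by have [] := hg (i.+1, 2 * xs i)%N.
have NS i : (2 * xs i <= N i.+1)%N by have [] := hg (i.+1, 2 * xs i)%N.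
have Nle i : (N i <= N i.+1)%N.
  apply: leq_trans (NS i); apply: leq_trans (cnt_le _ _ _) _; lia.
have Nmono i j : (i <= j)%N -> (N i <= N j)%N.
  by move=> ij; apply: (homo_leq (f := N) (r := leq)) => // ? ? ?; exact: leq_trans.
have xge i : (i < xs i)%N.
  elim: i => [|i IH]; first by have [] := xsP 0%N.
  by apply: leq_trans (xsS i); lia.
have ex n : exists i, (n < 2 * xs i)%N by exists n; have := xge n; lia.
pose idx n := ex_minn (ex n).
have idxP n : (n < 2 * xs (idx n))%N by rewrite /idx; case: ex_minnP.
have idx_min n i : (n < 2 * xs i)%N -> (idx n <= i)%N.
  by rewrite /idx; case: ex_minnP => m _ h /h.
pose psi n : R := (N (idx n))%:R^-1.
have psi_inv i j : (i <= j)%N -> (N j)%:R^-1 <= (N i)%:R^-1 :> R.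
  move=> ij; have [_ h1 _] := xsP i; have [_ h2 _] := xsP j.
  by rewrite lef_pV2 ?posrE ?ltr0n// ler_nat Nmono.
have Mpsi : M_class A psi.
  split.
  - by move=> n _; rewrite /psi invr_ge0.
  - move=> m n _ mn; apply: psi_inv; apply: idx_min.
    exact: leq_ltn_trans mn (idxP n).
  - apply/eqyP => K K0.
    have h k : k.+1%:R <= \sum_(0 <= n < 2 * xs k | n \in A) psi n.
      have blk i : 1 <= \sum_(xs i <= n < 2 * xs i | n \in A) psi n.
        have [_ h2 _] := xsP i.
        apply: (@le_trans _ _ (\sum_(xs i <= n < 2 * xs i | n \in A) (N i)%:R^-1)).
          rewrite -big_filter big_const_seq count_predT iter_addr_0 -(cnt_size A) -/(N i).
          by rewrite -(mulr_natr (N i)%:R^-1 (N i)) mulVf// pnatr_eq0 -lt0n.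
        rewrite big_nat_cond [X in _ <= X]big_nat_cond; apply: ler_sum => n /andP[/andP[_ h] _].
        exact: psi_inv (idx_min _ _ h).
      elim: k => [|k IH].
        apply: le_trans (blk 0%N) _; rewrite [X in _ <= X](@big_cat_nat _ _ _ (xs 0))//=; last lia.
        by rewrite lerDr; apply: sumr_ge0 => n _; rewrite /psi invr_ge0.
      rewrite [X in _ <= X](@big_cat_nat _ _ _ (xs k.+1))//=; last lia.
      rewrite -[k.+2]addn1 natrD; apply: lerD; last exact: (blk k.+1).
      apply: le_trans IH _; rewrite [X in _ <= X](@big_cat_nat _ _ _ (2 * xs k))//= lerDl.
      by apply: sumr_ge0 => n _; rewrite /psi invr_ge0.
    have := @esum_ge_nat R A psi (2 * xs (Num.truncn K)).
    move=> /(_ (fun k _ => _)) h2; apply: le_trans (h2 _); last by move=> k; rewrite /psi invr_ge0.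
    by rewrite lee_fin; apply: le_trans (h _); apply/ltW/truncnS_gt.
have [_ T1] := Xa _ Mpsi.
have hU i : exists U : set R, [/\ measurable U,
     (mu U <= (2 ^- (i + 2))%:E)%E &
      forall n, (n < 2 * xs i)%N -> hit (N i)%:R^-1 (n%:R * alpha) `&` D `<=` U].
  by have [] := xsP i.
have [U {}hU] := choice hU.
have mU i : measurable (U i) by have [] := hU i.
have sub : T_set A psi alpha `<=` \bigcup_i U i.
  move=> x [x01 /infinite_natP/(_ 0%N)[n _ [An hn]]].
  exists (idx n) => //; have [_ _ h] := hU (idx n); exact: (h n).
have mT := @measurable_T_set R A psi alpha.
have mbig : measurable (\bigcup_i U i) by exact: bigcup_measurable.
have le1 := mu_le mT mbig sub.
have le2 := @generalized_Boole_inequality _ _ _ (@lebesgue_measure R) U mU mbig.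
have le3 : (\sum_(0 <= i <oo) mu (U i) <= (2^-1)%:E)%E.
  have half0 : 0 <= 2^-1 :> R by [].
  apply: le_trans (epsilon_trick0 xpredT half0); apply: lee_nneseries => // i _.
  have [_ h _] := hU i; apply: le_trans h _; rewrite lee_fin natrX addn2 exprS invfM.
  by [].
have := le_trans le1 (le_trans le2 le3); rewrite T1 lee_fin; lra.
Qed.
End Subset.

(** * An upper bound sieve for pairs m, m + h *)


Section Bonferroni.
Context {R : realType}.
Implicit Types (x : nat -> R) (s : seq nat).

(** The inclusion-exclusion sum for prod (1 - x p), truncated to the terms with
    fewer than b factors. *)
Fixpoint tsum x s (b : nat) : R :=
  if s is p :: s' then tsum x s' b - x p * tsum x s' b.-1 else (0 < b)%:R.

(** The number of residue classes that occur when [tsum] is expanded over a list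
    of n primes, each of which removes at most two classes. *)
Fixpoint tnum (n b : nat) : nat :=
  if n is n'.+1 then tnum n' b + 2 * tnum n' b.-1 else (0 < b).

Lemma tsum0 x s : tsum x s 0 = 0.
Proof. by elim: s => //= p s ->; rewrite mulr0 subrr. Qed.

Lemma tsum_bonferroni x s b : (forall p, p \in s -> 0 <= x p <= 1) ->
  if odd b then \prod_(p <- s) (1 - x p) <= tsum x s b
  else tsum x s b <= \prod_(p <- s) (1 - x p).
Proof.
elim: s b => [|p s IH] b h; first by rewrite big_nil; case: b => //= b; case: ifP.
have hs q : q \in s -> 0 <= x q <= 1 by move=> qs; apply: h; rewrite inE qs orbT.
have hp : 0 <= x p <= 1 by apply: h; rewrite inE eqxx.
rewrite big_cons.
have p0 : 0 <= \prod_(q <- s) (1 - x q).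
  by rewrite big_seq; apply: prodr_ge0 => q /hs; lra.
have [->|b0] := posnP b; first by rewrite tsum0 mulr_ge0//; lra.
have h1 := IH b hs; have h2 := IH b.-1 hs.
have ob : odd b.-1 = ~~ odd b by rewrite -{2}(prednK b0)/= negbK.
rewrite ob in h2; move: h1 h2 => /=; move: (\prod_(_ <- _) _) p0 => Q Q0.
by case: (odd b) => /= h1 h2; have := h2; nra.
Qed.

(** The truncation error is at most the sum of the products of b of the x p, each
    of which occurs in prod (1 + 2 x p) with the factor 2^b. *)
Lemma tsum_err x s b : (forall p, p \in s -> 0 <= x p <= 1) ->
  `|tsum x s b - \prod_(p <- s) (1 - x p)| <= 2^-1 ^+ b * \prod_(p <- s) (1 + 2 * x p).
Proof.
elim: s b => [|p s IH] b h.
  rewrite !big_nil /= mulr1; case: b => [|b] /=; first by rewrite sub0r normrN normr1 expr0.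
  by rewrite subrr normr0 exprn_ge0.
have hs q : q \in s -> 0 <= x q <= 1 by move=> qs; apply: h; rewrite inE qs orbT.
have hp : 0 <= x p <= 1 by apply: h; rewrite inE eqxx.
rewrite !big_cons.
have p0 : 0 <= \prod_(q <- s) (1 + 2 * x q).
  by rewrite big_seq; apply: prodr_ge0 => q /hs; lra.
have [->|b0] := posnP b.
  rewrite tsum0 sub0r normrN expr0 mul1r.
  have Q0 : 0 <= \prod_(q <- s) (1 - x q).
    by rewrite big_seq; apply: prodr_ge0 => q /hs; lra.
  have QZ : \prod_(q <- s) (1 - x q) <= \prod_(q <- s) (1 + 2 * x q).
    by rewrite big_seq [X in _ <= X]big_seq; apply: ler_prod => q /hs; lra.
  rewrite ger0_norm; last by rewrite mulr_ge0//; lra.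
  by apply: ler_pM => //; lra.
have h1 := IH b hs; have := IH b.-1 hs.
have e : 2^-1 ^+ b.-1 = 2 * 2^-1 ^+ b :> R.
  by rewrite -{2}(prednK b0) exprS mulrA divff// mul1r.
rewrite e /=; move: h1; move: (tsum x s b) (tsum x s b.-1) (\prod_(_ <- _) (1 - _)) => t t' Q.
move: (\prod_(_ <- _) _) p0 (2^-1 ^+ b) => Z Z0 y h1 h2.
have -> : t - x p * t' - (1 - x p) * Q = (t - Q) - x p * (t' - Q) by ring.
apply: le_trans (ler_normB _ _) _.
rewrite normrM (ger0_norm (_ : 0 <= x p)); last by case/andP: hp.
have -> : y * ((1 + 2 * x p) * Z) = y * Z + x p * (2 * y * Z) by ring.
by apply: lerD => //; apply: ler_wpM2l => //; case/andP: hp.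
Qed.

Lemma tnum_le n b : (tnum n b <= (1 + 2 * n) ^ b)%N.
Proof.
elim: n b => [|n IH] b /=; first by rewrite muln0 addn0 exp1n leq_b1.
case: b => [|b].
  have t0 m : tnum m 0 = 0%N by elim: m => //= m ->.
  by rewrite /= t0 muln0.
apply: leq_trans (leq_add (IH _) (leq_mul (leqnn 2) (IH _))) _.
rewrite /= expnS -mulnDl.
have -> : (1 + 2 * n.+1 = 1 + 2 * n + 2)%N by lia.
rewrite [X in (_ <= X)%N]expnS leq_mul2l; apply/orP; right.
by case: b => [|b]; rewrite ?expn0// leq_exp2r//; lia.
Qed.
End Bonferroni.

Section Count.
Context {R : realType}.

Lemma count_residue (d c n : nat) : (0 < d)%N ->
  (\sum_(0 <= m < n | m == c %[mod d]) 1 = (n + (d.-1 - c %% d)) %/ d)%N.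
Proof.
move=> d0; elim: n => [|n IH].
  by rewrite big_geq// divn_small// add0n (leq_ltn_trans (leq_subr _ _))// prednK.
rewrite big_mkcond big_nat_recr//= -big_mkcond/= IH addSn divnS// addnC; congr addn.
set r := (c %% d)%N; have rd : (r < d)%N by rewrite ltn_mod.
have -> : ((n + (d.-1 - r)).+1 = n + d - r)%N by lia.
have -> : (d %| n + d - r)%N = (n == c %[mod d]).
  rewrite -eqn_mod_dvd; last by rewrite (leq_trans (ltnW rd))// leq_addl.
  by rewrite modnDr eq_sym /r modn_mod eq_sym.
by case: eqP.
Qed.

Lemma count_residue_err (d c a X : nat) : (0 < d)%N ->
  `|\sum_(a <= m < a + X | m == c %[mod d]) 1 - X%:R / d%:R| <= 1 :> R.
Proof.
move=> d0; have d0' : (0 : R) < d%:R by rewrite ltr0n.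
have e : (\sum_(a <= m < a + X | m == c %[mod d]) 1 + (a + (d.-1 - c %% d)) %/ d =
     (a + X + (d.-1 - c %% d)) %/ d)%N.
  by rewrite -!count_residue// addnC -(@big_cat_nat _ _ _ a)// leq_addr.
rewrite -(natr_sum R _ _ (fun _ => 1%N)); move: (\sum_(_ <= _ < _ | _) _)%N e => S.
set u := (d.-1 - _)%N => e.
have h1 := divn_eq (a + u) d; have h2 := divn_eq (a + X + u) d.
have h3 := ltn_mod (a + u) d; have h4 := ltn_mod (a + X + u) d.
rewrite d0 in h3 h4.
have {h1 h2 e} : (X + (a + u) %% d = S * d + (a + X + u) %% d)%N by lia.
move: h3 h4; move: ((a + u) %% d)%N ((a + X + u) %% d)%N => r r' hr hr' e.
have {}e : X%:R = S%:R * d%:R + r'%:R - r%:R :> R.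
  by rewrite -natrM -natrD -e natrD addrK.
have hr2 : (r%:R : R) < d%:R by rewrite ltr_nat.
have hr2' : (r'%:R : R) < d%:R by rewrite ltr_nat.
have r0 : (0 : R) <= r%:R by [].
have r0' : (0 : R) <= r'%:R by [].
have -> : S%:R - X%:R / d%:R = (r%:R - r'%:R) / d%:R :> R.
  by rewrite e; field; rewrite lt0r_neq0.
rewrite normrM normfV (gtr0_norm d0') ler_pdivrMr// mul1r ler_norml; lra.
Qed.

Variable h : nat.

Definition hitp (m p : nat) : R := ((p %| m) || (p %| m + h))%N%:R.

(** The proportion of the residues modulo p that are sieved out: one class if p
    divides h, two otherwise. *)
Definition dens (p : nat) : R := if (p %| h)%N then p%:R^-1 else 2 * p%:R^-1.

Section Step.
Variables (a X : nat) (G : nat -> R) (V Wr : R).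

(** Sieving by one more list s of primes multiplies the main term by the
    truncated sum and the error by the number of residue classes used. The
    weight G carries the blocks already treated; it is only known to be
    equidistributed modulo the integers d satisfying Q, namely those coprime to
    the primes of the other blocks. *)
Lemma sieve_step (s : seq nat) :
  uniq s -> all prime s -> 0 <= Wr ->
  forall Q : nat -> Prop, (forall d d', Q d -> (d' %| d)%N -> Q d') ->
  (forall c d, (0 < d)%N -> Q d ->
    `|\sum_(a <= m < a + X | m == c %[mod d]) G m - X%:R / d%:R * V| <= Wr) ->
  forall b c d, (0 < d)%N -> (forall p, p \in s -> coprime d p) ->
   Q (d * \prod_(p <- s) p)%N ->
  `|\sum_(a <= m < a + X | m == c %[mod d]) (tsum (hitp m) s b * G m)
     - X%:R / d%:R * (tsum dens s b * V)| <= (tnum (size s) b)%:R * Wr.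
Proof.
move=> us ps W0 Q QQ hG; elim: s us ps => [|p s IH] us ps b c d d0 cd Qd.
  rewrite /=; case: b => [|b] /=.
    by rewrite big1 ?mul0r ?mulr0 ?subr0 ?normr0// => m _; rewrite mul0r.
  under eq_bigr do rewrite mul1r.
  by rewrite !mul1r; apply: hG => //; rewrite big_nil muln1 in Qd.
move: us ps => /= /andP[pns us] /andP[pp ps].
have {}IH := IH us ps.
have cds q : q \in s -> coprime d q by move=> qs; apply: cd; rewrite inE qs orbT.
have cdp : coprime d p by apply: cd; rewrite inE eqxx.
rewrite big_cons mulnA in Qd.
have Qd1 : Q (d * \prod_(q <- s) q)%N.
  by apply: QQ Qd _; rewrite dvdn_mul// dvdn_mulr.
have p0 : (0 < p)%N by exact: prime_gt0.
pose F m := tsum (hitp m) s b.-1 * G m.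
have main r : `|\sum_(a <= m < a + X | (m == c %[mod d]) && (m == r %[mod p])) F m
     - X%:R / (d%:R * p%:R) * (tsum dens s b.-1 * V)| <= (tnum (size s) b.-1)%:R * Wr.
  rewrite -natrM.
  have -> : \sum_(a <= m < a + X | (m == c %[mod d]) && (m == r %[mod p])) F m =
     \sum_(a <= m < a + X | m == chinese d p c r %[mod d * p]) F m.
    apply: eq_bigl => m; rewrite chinese_remainder//.
    by rewrite chinese_modl// chinese_modr.
  apply: IH => //; first by rewrite muln_gt0 d0.
  move=> q qs; rewrite coprimeMl cds//= prime_coprime// dvdn_prime2//; last by move/allP: ps; apply.
  by apply: contraNneq pns => ->.
have -> : \sum_(a <= m < a + X | m == c %[mod d]) ((tsum (hitp m) s b - hitp m p * tsum (hitp m) s b.-1) * G m)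
  = \sum_(a <= m < a + X | m == c %[mod d]) (tsum (hitp m) s b * G m)
   - \sum_(a <= m < a + X | m == c %[mod d]) hitp m p * F m.
  by rewrite -sumrB; apply: eq_bigr => m _; rewrite mulrBl mulrA.
pose r2 := (p - h %% p)%N.
have dv m : (p %| m + h)%N = (m == r2 %[mod p]).
  rewrite -(eqn_modDr h) /r2 -[X in _ = (_ == X)]modnDmr subnK; last by rewrite ltnW// ltn_mod.
  by rewrite modnn /dvdn.
have dv0 m : (p %| m)%N = (m == 0 %[mod p]) by rewrite mod0n /dvdn.
have sumE (z : nat -> bool) : \sum_(a <= m < a + X | m == c %[mod d]) (z m)%:R * F m =
    \sum_(a <= m < a + X | (m == c %[mod d]) && z m) F m.
  rewrite [RHS]big_mkcondr; apply: eq_bigr => m _; by case: (z m); rewrite ?mul1r ?mul0r.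
have IHb := IH b c d d0 cds Qd1.
have p0' : (p%:R : R) != 0 by rewrite pnatr_eq0 -lt0n.
have d0' : (d%:R : R) != 0 by rewrite pnatr_eq0 -lt0n.
have [ph|ph] := boolP (p %| h)%N.
  have -> : \sum_(a <= m < a + X | m == c %[mod d]) hitp m p * F m =
     \sum_(a <= m < a + X | (m == c %[mod d]) && (m == 0 %[mod p])) F m.
    rewrite -sumE; apply: eq_bigr => m _; rewrite /hitp -dv0 dvdn_addl//.
    by rewrite orbb.
  have := main 0%N; rewrite /dens ph.
  set S1 := \sum_(_ <= _ < _ | _) _ in IHb *; set S2 := \sum_(_ <= _ < _ | _) _ => h2.
  set T1 := tsum _ _ _ in IHb *; set T2 := tsum _ _ _ in h2 *.
  have -> : S1 - S2 - X%:R / d%:R * ((T1 - p%:R^-1 * T2) * V) =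
     (S1 - X%:R / d%:R * (T1 * V)) - (S2 - X%:R / (d%:R * p%:R) * (T2 * V)).
    by field; rewrite p0' d0'.
  apply: le_trans (ler_normB _ _) _; rewrite natrD mulrDl lerD// natrM.
  by apply: le_trans h2 _; rewrite -mulrA ler_peMl ?mulr_ge0//; lra.
have -> : \sum_(a <= m < a + X | m == c %[mod d]) hitp m p * F m =
     \sum_(a <= m < a + X | (m == c %[mod d]) && (m == 0 %[mod p])) F m +
     \sum_(a <= m < a + X | (m == c %[mod d]) && (m == r2 %[mod p])) F m.
  rewrite -!sumE -big_split/=; apply: eq_bigr => m _; rewrite /hitp -dv0 -dv -mulrDl.
  congr (_ * _); have [pm|pm] := boolP (p %| m)%N; last by rewrite add0r.
  by rewrite dvdn_addr// (negbTE ph) addr0.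
have := main 0%N; have := main r2; rewrite /dens (negbTE ph).
set S1 := \sum_(_ <= _ < _ | _) _ in IHb *.
set S2 := \sum_(_ <= _ < _ | _) _ => h2; set S3 := \sum_(_ <= _ < _ | _) _ => h3.
set T1 := tsum _ _ _ in IHb *; set T2 := tsum _ _ _ in h2 h3 *.
have -> : S1 - (S3 + S2) - X%:R / d%:R * ((T1 - 2 * p%:R^-1 * T2) * V) =
     (S1 - X%:R / d%:R * (T1 * V)) - ((S2 - X%:R / (d%:R * p%:R) * (T2 * V))
      + (S3 - X%:R / (d%:R * p%:R) * (T2 * V))).
  by field; rewrite p0' d0'.
apply: le_trans (ler_normB _ _) _; rewrite natrD mulrDl lerD// natrM.
apply: le_trans (ler_normD _ _) _; move: h2 h3; move: (tnum _ _)%:R => t h2 h3.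
have -> : 2%:R * t * Wr = t * Wr + t * Wr by ring.
exact: lerD.
Qed.
End Step.

Fixpoint coprime_blocks (bl : seq (seq nat * nat)) : Prop :=
  if bl is (s, b) :: bl' then
    [/\ uniq s, all prime s, coprime_blocks bl' &
        forall sb, sb \in bl' -> forall p q, p \in s -> q \in sb.1 -> p != q]
  else True.

(** The Brun-Hooley device: truncate inclusion-exclusion separately on disjoint
    blocks of primes and multiply. *)
Lemma sieve_blocks (a X : nat) (bl : seq (seq nat * nat)) : coprime_blocks bl ->
  forall c d, (0 < d)%N -> (forall sb, sb \in bl -> forall p, p \in sb.1 -> coprime d p) ->
  `|\sum_(a <= m < a + X | m == c %[mod d]) \prod_(sb <- bl) tsum (hitp m) sb.1 sb.2
     - X%:R / d%:R * \prod_(sb <- bl) tsum dens sb.1 sb.2|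
    <= \prod_(sb <- bl) (tnum (size sb.1) sb.2)%:R.
Proof.
elim: bl => [|[s b] bl IH] /=.
  move=> _ c d d0 _; rewrite !big_nil mulr1.
  by under eq_bigr do rewrite big_nil; exact: count_residue_err.
move=> [us ps cbl sd] c d d0 cd.
rewrite !big_cons; under eq_bigr do rewrite big_cons /=.
rewrite /=.
apply: (@sieve_step a X _ _ _ s us ps _
  (fun d => forall sb, sb \in bl -> forall p, p \in sb.1 -> coprime d p)) => //.
- exact: prodr_ge0.
- by move=> d1 d2 h1 d21 sb sbl p psb; apply: coprime_dvdl d21 (h1 _ sbl _ psb).
- by move=> c' d' d'0 h'; apply: IH.
- by move=> p p_s; apply: (cd (s, b)); rewrite ?inE ?eqxx.
- move=> sb sbl p psb; rewrite coprimeMl; apply/andP; split.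
    by apply: (cd sb) => //; rewrite inE sbl orbT.
  have pbl : forall sb, sb \in bl -> all prime sb.1.
    elim: (bl) cbl {IH sd cd sbl} => // -[s' b'] bl' IH' /= [_ ps' /IH' hb _] sb'.
    by rewrite inE => /orP[/eqP->//|/hb].
  have pp : prime p by move/allP: (pbl _ sbl); apply.
  rewrite big_seq; apply: (big_ind (fun x => coprime x p)).
  + by rewrite coprime1n.
  + by move=> x y cx cy; rewrite coprimeMl cx.
  + move=> q qs; rewrite prime_coprime; last by move/allP: ps; apply.
    rewrite dvdn_prime2//; last by move/allP: ps; apply.
    exact: (sd sb sbl q p).
Qed.

(** Odd truncations are majorants by [tsum_bonferroni], and all of them are
    nonnegative, so that their product is a majorant of the sifted set. *)
Lemma sieve_upper (S : set nat) (a X : nat) (bl : seq (seq nat * nat)) : coprime_blocks bl ->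
  (forall sb, sb \in bl -> odd sb.2) ->
  (forall m, S m -> forall sb, sb \in bl -> forall p, p \in sb.1 -> hitp m p = 0) ->
  (cnt S a (a + X))%:R <= X%:R * \prod_(sb <- bl) tsum dens sb.1 sb.2
    + \prod_(sb <- bl) (tnum (size sb.1) sb.2)%:R.
Proof.
move=> cbl ob hS.
have hb := @sieve_blocks a X bl cbl 0%N 1%N (ltn0Sn _).
have {}hb := hb (fun _ _ _ _ => coprime1n _).
rewrite divr1 in hb.
apply: (@le_trans _ _ (\sum_(a <= m < a + X | m == 0 %[mod 1]) \prod_(sb <- bl) tsum (hitp m) sb.1 sb.2)).
  rewrite /cnt natr_sum big_mkcond [X in _ <= X]big_mkcond/=; apply: ler_sum => m _.
  rewrite !modn1 eqxx.
  have t0 sb : sb \in bl -> \prod_(p <- sb.1) (1 - hitp m p) <= tsum (hitp m) sb.1 sb.2.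
    move=> sbl; have := @tsum_bonferroni R (hitp m) sb.1 sb.2.
    rewrite ob//; apply=> p _; rewrite /hitp; case: (_ || _) => /=; lra.
  have p0 sb : 0 <= \prod_(p <- sb.1) (1 - hitp m p).
    by apply: prodr_ge0 => p _; rewrite /hitp; case: (_ || _) => /=; lra.
  case: ifP => [|_]; last first.
    by rewrite big_seq; apply: prodr_ge0 => sb /t0; apply: le_trans.
  rewrite inE => Sm; have e1 : 1%:R = \prod_(sb <- bl) 1 :> R by rewrite big1.
  rewrite [X in X <= _]e1.
  rewrite big_seq [X in _ <= X]big_seq; apply: ler_prod => sb sbl; rewrite ler01/=.
  apply: le_trans (t0 _ sbl); rewrite big_seq big1// => p ps.
  by rewrite (hS _ Sm _ sbl)// subr0.
by move: hb; rewrite ler_norml; lra.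
Qed.
End Count.

Section Main.
Context {R : realType}.
Variable P : set nat.
Hypothesis PP : P `<=` [set p | prime p].
Variable h : nat.

Notation dens := (@dens R h).

(** The blocks grow doubly exponentially, so that each has a bounded sum of
    1 / p ([sum_dens_blk]). *)
Definition blk (i : nat) : seq nat :=
  [seq p <- index_iota (2 ^ (2 ^ i)) (2 ^ (2 ^ i.+1)) | p \in P].

(** The truncation level 2 (I - i) + 1 increases towards small primes: the
    relative errors 2^-b then sum to O(1), and the product of the numbers of
    residue classes stays below 2^(24 2^I), as the large blocks have few terms. *)
Definition blks (I : nat) : seq (seq nat * nat) :=
  [seq (blk i, (2 * (I - i)).+1) | i <- index_iota 1 I].

Lemma mem_blk i p : p \in blk i ->
  [/\ p \in P, prime p, (2 ^ (2 ^ i) <= p)%N & (p < 2 ^ (2 ^ i.+1))%N].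
Proof.
by rewrite mem_filter mem_index_iota => /andP[h1 /andP[h2 h3]]; split=> //;
  move: h1; rewrite inE => /PP.
Qed.

Lemma blk_ge4 i p : (0 < i)%N -> p \in blk i -> (4 <= p)%N.
Proof.
move=> i0 /mem_blk[_ _ h1 _]; apply: leq_trans h1.
by rewrite (_ : 4%N = 2 ^ (2 ^ 1))%N// leq_exp2l// leq_exp2l.
Qed.

Lemma dens_ge0 p : 0 <= dens p.
Proof. by rewrite /dens; case: ifP => _; rewrite ?mulr_ge0 ?invr_ge0. Qed.

Lemma dens_le p : dens p <= 2 * p%:R^-1.
Proof.
by rewrite /dens; case: ifP => // _; rewrite ler_peMl ?invr_ge0//; lra.
Qed.

Lemma dens_half p : (4 <= p)%N -> dens p <= 2^-1.
Proof.
move=> p4; apply: le_trans (dens_le p) _.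
have : (p%:R : R)^-1 <= 4^-1.
  by rewrite lef_pV2 ?posrE// ?ler_nat// ltr0n; lia.
lra.
Qed.

Lemma sum_dens_blk i : \sum_(p <- blk i) dens p <= 4.
Proof.
apply: (@le_trans _ _ (\sum_(2 ^ (2 ^ i) <= p < 2 ^ (2 ^ i.+1) | prime p) 2 * p%:R^-1)).
  rewrite big_filter big_mkcond [X in _ <= X]big_mkcond; apply: ler_sum => p _.
  case: ifP => h1; case: ifP => h2; rewrite ?dens_le ?mulr_ge0 ?invr_ge0//.
  by move: h1; rewrite inE => /PP/=; rewrite h2.
rewrite (@big_dyadic R 0 +%R (fun p => 2 * p%:R^-1)) ?leq_exp2l//.
apply: (@le_trans _ _ (\sum_(2 ^ i <= j < 2 ^ i.+1) (4 / (2 ^ i)%:R))).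
  rewrite big_nat [X in _ <= X]big_nat; apply: ler_sum => j /andP[ij _].
  rewrite -big_distrr/=; have := @dsum_le R j; rewrite /dsum => h1.
  have i0 : (0 < 2 ^ i)%N by rewrite expn_gt0.
  have : 2 / j%:R <= 2 / (2 ^ i)%:R :> R.
    by rewrite ler_wpM2l// lef_pV2 ?posrE ?ltr0n ?ler_nat// (leq_trans i0).
  lra.
rewrite sumr_const_nat expnS mul2n -addnn addnK -(mulr_natr (4 / _)) divfK//.
Qed.

(** On a block the product of the 1 - dens p is bounded below, so the additive
    error of [tsum_err] becomes a multiplicative one. *)
Lemma tsum_blk i b : (0 < i)%N ->
  tsum dens (blk i) b <= \prod_(p <- blk i) (1 - dens p) * expR (expR 16 * 2^-1 ^+ b).
Proof.
move=> i0.
have d01 p : p \in blk i -> 0 <= dens p <= 2^-1.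
  by move=> /(blk_ge4 i0) p4; rewrite dens_ge0 dens_half.
have h1 : `|tsum dens (blk i) b - \prod_(p <- blk i) (1 - dens p)|
    <= 2^-1 ^+ b * \prod_(p <- blk i) (1 + 2 * dens p).
  by apply: tsum_err => p /d01; lra.
have h2 : \prod_(p <- blk i) (1 + 2 * dens p) <= expR 16 * \prod_(p <- blk i) (1 - dens p).
  apply: (@le_trans _ _ (\prod_(p <- blk i) (expR (4 * dens p) * (1 - dens p)))).
    rewrite big_seq [X in _ <= X]big_seq; apply: ler_prod => p /d01 hp.
    apply/andP; split; first by lra.
    have h3 := one_sub_expR hp.
    have -> : 4 * dens p = 2 * dens p + 2 * dens p by ring.
    rewrite expRD -mulrA.
    apply: (@le_trans _ _ (expR (2 * dens p))); first exact: expR_ge1Dx.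
    rewrite -[X in X <= _]mulr1 ler_pM2l ?expR_gt0//.
    apply: le_trans (ler_wpM2l (expR_ge0 _) h3).
    by rewrite -expRD subrr expR0.
  rewrite big_split/=; apply: ler_wpM2r.
    by rewrite big_seq; apply: prodr_ge0 => p /d01; lra.
  rewrite -expR_sum ler_expR -big_distrr/=.
  by have := sum_dens_blk i; lra.
have p0 : 0 <= \prod_(p <- blk i) (1 - dens p).
  by rewrite big_seq; apply: prodr_ge0 => p /d01; lra.
have h3 := expR_ge1Dx (expR (16 : R) * 2^-1 ^+ b).
have b0 : 0 <= 2^-1 ^+ b :> R by rewrite exprn_ge0.
apply: le_trans (ler_wpM2l p0 h3).
have := ler_wpM2l b0 h2; move: h1; rewrite ler_norml; lra.
Qed.

Lemma tnum_blk i b : (tnum (size (blk i)) b <= 2 ^ (2 ^ i.+2 * b))%N.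
Proof.
apply: leq_trans (tnum_le _ _) _; rewrite expnM.
have hs : (size (blk i) <= 2 ^ (2 ^ i.+1))%N.
  by rewrite size_filter (leq_trans (count_size _ _))// size_iota leq_subr.
have h2 : (1 + 2 * size (blk i) <= 2 ^ (2 ^ i.+2))%N.
  apply: (@leq_trans (2 ^ (2 ^ i.+1) * 2 ^ (2 ^ i.+1))); last by rewrite -expnD addnn -mul2n -expnS.
  have h4 : (4 <= 2 ^ (2 ^ i.+1))%N.
    by rewrite (_ : 4%N = 2 ^ (2 ^ 1))%N// leq_exp2l// leq_exp2l.
  apply: (@leq_trans (4 * 2 ^ (2 ^ i.+1))); last by rewrite leq_mul2r h4 orbT.
  lia.
by case: b => [|b]; rewrite ?expn0// leq_exp2r.
Qed.

Lemma sum_pow_blks I : (\sum_(1 <= i < I) 2 ^ i.+2 * (2 * (I - i)).+1 <= 24 * 2 ^ I)%N.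
Proof.
have h1 n : (\sum_(0 <= i < n) 2 ^ i * (n - i) + (2 + n) = 2 * 2 ^ n)%N.
  elim: n => [|n IH]; first by rewrite big_geq.
  rewrite big_nat_recr//= subSnn muln1.
  have -> : (\sum_(0 <= i < n) 2 ^ i * (n.+1 - i) = \sum_(0 <= i < n) 2 ^ i * (n - i) + \sum_(0 <= i < n) 2 ^ i)%N.
    rewrite -big_split/= big_nat [RHS]big_nat; apply: eq_bigr => i /andP[_ ni].
    by rewrite subSn ?(ltnW ni)// mulnS addnC.
  have e2 : (\sum_(0 <= i < n) 2 ^ i + 1 = 2 ^ n)%N.
    elim: (n) => [|k IHk]; first by rewrite big_geq.
    by rewrite big_nat_recr//= addnAC IHk addnn -mul2n -expnS.
  rewrite expnS; lia.
have [->|I0] := posnP I; first by rewrite big_geq.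
apply: (@leq_trans (12 * \sum_(0 <= i < I) 2 ^ i * (I - i))).
  rewrite big_distrr/= [X in (_ <= X)%N](@big_cat_nat _ _ _ 1)//=; apply: leq_trans (leq_addl _ _).
  rewrite big_nat [X in (_ <= X)%N]big_nat; apply: leq_sum => i /andP[_ iI].
  have iI' : (0 < I - i)%N by rewrite subn_gt0.
  rewrite !expnS; move: (2 ^ i)%N (I - i)%N iI' => u v v0.
  by rewrite !mulnA -[(12 * u * v)%N]mulnA [(12 * _)%N](_ : _ = 2 * 2 * u * (3 * v))%N; [rewrite leq_mul2l; apply/orP; right; lia|ring].
have := h1 I; lia.
Qed.

Lemma coprime_blks_aux (I : nat) (r : seq nat) : uniq r ->
  coprime_blocks [seq (blk i, (2 * (I - i)).+1) | i <- r].
Proof.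
elim: r => //= i r IH /andP[ir ur]; split.
- by rewrite filter_uniq// iota_uniq.
- by apply/allP => p /mem_blk[].
- exact: IH.
- move=> sb /mapP[j jr ->] p q /= /mem_blk[_ _ h1 h2] /mem_blk[_ _ h3 h4].
  apply/eqP => e; move: h3 h4; rewrite -e => h3 h4.
  have := leq_ltn_trans h1 h4; have := leq_ltn_trans h3 h2.
  rewrite !ltn_exp2l// !ltnS => h5 h6.
  have e2 : i = j by apply/eqP; rewrite eqn_leq h5 h6.
  by move: ir; rewrite e2 jr.
Qed.

Lemma big_blks (F : nat -> R) I : (0 < I)%N ->
  \prod_(1 <= i < I) \prod_(p <- blk i) F p =
  \prod_(4 <= p < 2 ^ (2 ^ I) | p \in P) F p.
Proof.
elim: I => // -[|I] IH _; first by rewrite !big_geq.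
rewrite big_nat_recr//= IH// [RHS](@big_cat_nat _ _ _ (2 ^ (2 ^ I.+1)))//=.
- by rewrite [X in _ * X]big_filter.
- by rewrite (_ : 4%N = 2 ^ (2 ^ 1))%N// leq_exp2l// leq_exp2l.
- by rewrite leq_exp2l// leq_exp2l.
Qed.

(** The singular factor of h: it compensates for the primes dividing h, which
    remove only one residue class. *)
Definition sing (n : nat) : R :=
  \prod_(0 <= p < n | (p \in P) && (p %| h)%N) (1 + p%:R^-1).

Lemma prod_dens_le n : (4 <= n)%N ->
  \prod_(4 <= p < n | p \in P) (1 - dens p) <= 18 * (eul P n ^+ 2 * sing n).
Proof.
move=> n4.
pose P' : set nat := [set p | P p /\ (p %| h)%N].
have PP' : P' `<=` [set p | prime p] by move=> p [/PP].
have P'E p : (p \in P') = (p \in P) && (p %| h)%N.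
  by apply/idP/andP; rewrite !inE.
have n1 : n.-1.+1 = n by rewrite prednK//; lia.
have singE : sing n = f_prod P' n.-1.
  by rewrite /f_prod n1 /sing; apply: eq_bigl => p; rewrite P'E.
have hs : 2^-1 <= sing n * eul P' n by rewrite singE -{2}n1; exact: f_eul.
have hpos p : p \in P -> 0 < 1 - p%:R^-1 :> R.
  by move=> /(invP (R := R) PP); lra.
(* A prime p dividing h leaves the factor 1 - 1/p = (1 - 1/p)^2 / (1 - 1/p), any
   other one 1 - 2/p <= (1 - 1/p)^2. *)
have h1 : \prod_(4 <= p < n | p \in P) (1 - dens p) <=
   \prod_(4 <= p < n | p \in P) (1 - p%:R^-1) ^+ 2 / \prod_(4 <= p < n | p \in P') (1 - p%:R^-1).
  rewrite ler_pdivlMr; last by apply: prodr_gt0 => p; rewrite P'E => /andP[/hpos].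
  rewrite [X in _ * X](_ : _ = \prod_(4 <= p < n | p \in P) (if (p %| h)%N then 1 - p%:R^-1 else 1)); last first.
    by rewrite -big_mkcondr; apply: eq_bigl => p; rewrite P'E.
  rewrite -big_split/= big_nat_cond [X in _ <= X]big_nat_cond.
  apply: ler_prod => p /andP[/andP[p4 _] pP].
  have hp := hpos _ pP; have hd := dens_half p4; have hd0 := dens_ge0 p.
  rewrite /dens in hd hd0 *; case: ifP hd hd0 => _ hd hd0.
    apply/andP; split; first by rewrite mulr_ge0//; lra.
    by rewrite expr2.
  rewrite mulr1; move: hp hd; move: (p%:R^-1) => x hp hd; rewrite expr2; apply/andP; split; nra.
(* The factors at 2 and 3 are worth at least 1/3. *)
have small (S : set nat) : S `<=` [set p | prime p] ->
    \prod_(4 <= p < n | p \in S) (1 - p%:R^-1) <= 3 * eul S n :> R.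
  move=> SP.
  rewrite /eul [X in 3 * X](@big_cat_nat _ _ _ 4)//=.
  rewrite mulrA ler_peMl//.
    by apply: prodr_ge0 => p /(invP (R := R) SP); lra.
  rewrite !prod_recr_cond big_geq//= !mul1r.
  case: ifP => [/(P_ge2 SP)//|_]; case: ifP => [/(P_ge2 SP)//|_]; rewrite !mul1r.
  by case: ifP => _; case: ifP => _; lra.
have big (S : set nat) : S `<=` [set p | prime p] ->
    eul S n <= \prod_(4 <= p < n | p \in S) (1 - p%:R^-1) :> R.
  move=> SP; rewrite /eul (@big_cat_nat _ _ _ 4)//= ler_piMl//.
    by apply: prodr_ge0 => p /(invP (R := R) SP); lra.
  by apply: prodr_ile1 => p /(invP (R := R) SP) hp; apply/andP; split; lra.
apply: le_trans h1 _.
have e0 := @eul_gt0 R P' PP' n.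
rewrite prodrXl ler_pdivrMr; last by apply: lt_le_trans (big _ PP').
have hP := small _ PP; have hP' := big _ PP'.
set Q := \prod_(_ <= _ < _ | _) _ in hP *; set Q' := \prod_(_ <= _ < _ | _) _ in hP' *.
have Q0 : 0 <= Q by apply: prodr_ge0 => p /hpos/ltW.
have s0 : 0 <= sing n by apply: prodr_ge0 => p _; rewrite addr_ge0.
have q2 : Q ^+ 2 <= 9 * eul P n ^+ 2.
  have -> : 9 * eul P n ^+ 2 = (3 * eul P n) ^+ 2 :> R by ring.
  by rewrite lerXn2r// nnegrE// mulr_ge0// ltW// eul_gt0.
apply: le_trans q2 _.
have -> : 18 * (eul P n ^+ 2 * sing n) * Q' = 9 * eul P n ^+ 2 * (2 * (sing n * Q')) by ring.
rewrite ler_peMr//; first by rewrite mulr_ge0// sqr_ge0.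
have := ler_wpM2l s0 hP'; lra.
Qed.

Theorem sieve_pairs (S : set nat) (a X I : nat) : (0 < I)%N ->
  (forall m, S m -> forall p, P p -> (p < 2 ^ (2 ^ I))%N ->
      ~~ (p %| m)%N && ~~ (p %| m + h)%N) ->
  (cnt S a (a + X))%:R <=
   18 * expR (expR 16) * X%:R * (eul P (2 ^ (2 ^ I)) ^+ 2 * sing (2 ^ (2 ^ I)))
    + (2 ^ (24 * 2 ^ I))%:R.
Proof.
move=> I0 hS.
have := @sieve_upper R h S a X (blks I).
move=> /(_ (coprime_blks_aux I (iota_uniq _ _))).
have ob sb : sb \in blks I -> odd sb.2.
  by move=> /mapP[i _ ->] /=; rewrite mul2n odd_double.
move=> /(_ ob).
have hh m : S m -> forall sb, sb \in blks I -> forall p, p \in sb.1 -> @hitp R h m p = 0.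
  move=> Sm sb /mapP[i]; rewrite mem_index_iota => /andP[i0 iI] -> p /= /mem_blk[pP _ _ p2].
  have := hS m Sm p; rewrite inE in pP => /(_ pP).
  have pI : (p < 2 ^ (2 ^ I))%N by apply: leq_trans p2 _; rewrite leq_exp2l// leq_exp2l.
  by move=> /(_ pI)/andP[h1 h2]; rewrite /hitp (negbTE h1) (negbTE h2).
move=> /(_ hh) main; apply: le_trans main _.
rewrite /blks !big_map; apply: lerD; last first.
  rewrite -natr_prod ler_nat.
  apply: (@leq_trans (\prod_(1 <= i < I) 2 ^ (2 ^ i.+2 * (2 * (I - i)).+1))%N).
    by apply: leq_prod => i _; exact: tnum_blk.
  by rewrite -expn_sum leq_exp2l// sum_pow_blks.
rewrite [18 * _ * X%:R]mulrC -!mulrA; apply: ler_wpM2l => //.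
have t0 i : i \in index_iota 1 I -> 0 <= tsum dens (blk i) (2 * (I - i)).+1 <=
   \prod_(p <- blk i) (1 - dens p) * expR (expR 16 * 2^-1 ^+ (2 * (I - i)).+1).
  rewrite mem_index_iota => /andP[i0 iI].
  rewrite tsum_blk// andbT.
  have := @tsum_bonferroni R dens (blk i) (2 * (I - i)).+1.
  rewrite /= mul2n odd_double /=.
  have d01 p : p \in blk i -> 0 <= dens p <= 1.
    by move=> /(blk_ge4 i0) /dens_half; have := dens_ge0 p; lra.
  move=> /(_ d01); apply: le_trans.
  by rewrite big_seq; apply: prodr_ge0 => p /d01; lra.
apply: (@le_trans _ _ (\prod_(1 <= i < I) (\prod_(p <- blk i) (1 - dens p) * expR (expR 16 * 2^-1 ^+ (2 * (I - i)).+1)))).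
  by rewrite big_seq [X in _ <= X]big_seq; apply: ler_prod.
rewrite big_split/= (@big_blks (fun p => 1 - dens p))// -expR_sum -big_distrr/=.
have n4 : (4 <= 2 ^ (2 ^ I))%N.
  by rewrite (_ : 4%N = 2 ^ (2 ^ 1))%N// leq_exp2l// leq_exp2l.
have h1 := prod_dens_le n4.
have h2 : \sum_(1 <= i < I) 2^-1 ^+ (2 * (I - i)).+1 <= 1 :> R.
  have -> : \sum_(1 <= i < I) 2^-1 ^+ (2 * (I - i)).+1 = \sum_(1 <= i < I) 2^-1 ^+ (2 * i).+1 :> R.
    rewrite big_nat_rev/= big_nat [RHS]big_nat; apply: eq_bigr => i /andP[i1 iI].
    by rewrite add1n subSS subKn// ltnW.
  have : \sum_(1 <= i < I) 2^-1 ^+ (2 * i).+1 <= 1 - 2^-1 ^+ I :> R.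
    elim: I I0 {ob hh t0 n4 h1 hS} => // -[|I] IH _; first by rewrite big_geq// expr1; lra.
    rewrite big_nat_recr//=; have := IH isT.
    have : 2^-1 ^+ (2 * I.+1).+1 <= 2^-1 ^+ I.+2 :> R.
      by rewrite ler_wiXn2l//; [lra|lia].
    rewrite (exprS _ I.+1); lra.
  have : 0 <= 2^-1 ^+ I :> R by rewrite exprn_ge0.
  lra.
have h3 : expR (expR 16 * \sum_(1 <= i < I) 2^-1 ^+ (2 * (I - i)).+1) <= expR (expR 16) :> R.
  by rewrite ler_expR ler_piMr// expR_ge0.
have p0 : 0 <= \prod_(4 <= p < 2 ^ (2 ^ I) | p \in P) (1 - dens p).
  rewrite big_nat_cond; apply: prodr_ge0 => p /andP[/andP[p4 _] _].
  by have := dens_half p4; lra.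
apply: le_trans (ler_pM p0 (expR_ge0 _) h1 h3) _.
by rewrite expr2 -!mulrA [X in _ <= X]mulrCA !mulrA mulrC -!mulrA lexx.
Qed.
End Main.

(** * Bohr sets of a badly approximable number *)


Section Bohr.
Context {R : realType}.
Variables (alpha c0 : R).
Hypothesis c00 : 0 < c0.
Hypothesis bad : forall n, (0 < n)%N -> c0 <= n%:R * dist_int (n%:R * alpha).

Lemma gap_count (G : R) (a : nat) (s : seq nat) : path ltn a s ->
  (forall x y, x \in a :: s -> y \in a :: s -> (x < y)%N -> G <= y%:R - x%:R) ->
  (size s)%:R * G <= (last a s)%:R - a%:R.
Proof.
elim: s a => [|b s IH] a /=; first by rewrite mul0r subrr.
move=> /andP[ab pb] h; have {}IH := IH b pb _.
have h1 : (size s)%:R * G <= (last b s)%:R - b%:R.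
  by apply: IH => x y xs ys; apply: h; rewrite inE ?xs ?ys orbT.
have h2 : G <= b%:R - a%:R by apply: h => //; rewrite !inE eqxx ?orbT.
rewrite -addn1 natrD mulrDl mul1r; lra.
Qed.

Lemma path_ltn_last (a : nat) (s : seq nat) : path ltn a s ->
  forall x, x \in a :: s -> (a <= x <= last a s)%N.
Proof.
elim: s a => [|b s IH] a /=; first by move=> _ x; rewrite inE => /eqP ->; rewrite leqnn.
move=> /andP[ab pb] x; rewrite inE => /orP[/eqP->|xs].
  rewrite leqnn/=; have /andP[_ h] := IH b pb b (mem_head _ _).
  exact: leq_trans (ltnW ab) h.
have /andP[h1 h2] := IH b pb x xs; rewrite h2 andbT.
exact: leq_trans (ltnW ab) h1.
Qed.

(** Lift each h to the lattice point (h, p_h), p_h the nearest integer to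
    h alpha. The determinants of triples of such points are multiples of d, and
    they are smaller than d in absolute value when 4 W rho < d; hence the points
    are collinear, and the remainders y_h = h alpha - p_h are affine in h with
    slope sg. Bad approximability bounds the gaps below by
    sqrt (c0 / |sg|), while |sg| times the distance spanned is at most 2 rho. *)
Lemma window_count (d : nat) (W rho : R) (l : seq nat) : (0 < d)%N -> 0 <= rho ->
  4 * W * rho < d%:R -> sorted ltn l ->
  (forall h, h \in l -> (d %| h)%N /\ dist_int (h%:R * alpha) <= rho) ->
  (forall h h', h \in l -> h' \in l -> h'%:R - h%:R <= W) ->
  (size l)%:R <= 1 + Num.sqrt (2 * W * rho / c0).
Proof.
move=> d0 r0 Wd; case: l => [|a s] /=; first by move=> *; rewrite addr_ge0// sqrtr_ge0.
move=> pl hl hW.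
rewrite -addn1 natrD addrC lerD2l.
have [p hp] := choice (fun h : nat => dist_int_attained (h%:R * alpha)).
pose y h := h%:R * alpha - (p h)%:~R.
have yr h : h \in a :: s -> `|y h| <= rho by move=> /hl[_]; rewrite hp.
pose b := last a s.
have bl : b \in a :: s by rewrite mem_last.
have al : a \in a :: s by rewrite mem_head.
have ab h : h \in a :: s -> (a <= h <= b)%N by exact: path_ltn_last.
have [sn|sn] := eqVneq s [::]; first by rewrite sn /= sqrtr_ge0.
have lt_ab : (a < b)%N.
  rewrite /b; case: (s) sn pl => // a' s' _ /= /andP[h1 h2].
  have /andP[_ h3] := path_ltn_last h2 (mem_head _ _).
  exact: leq_trans h1 h3.
have col h : h \in a :: s -> (h%:R - a%:R) * (y b - y a) = (b%:R - a%:R) * (y h - y a).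
  move=> hh; have /andP[ah hb] := ab _ hh.
  have [dh _] := hl _ hh; have [da _] := hl _ al; have [db _] := hl _ bl.
  pose D : int := (h%:Z - a%:Z) * (p b - p a) - (b%:Z - a%:Z) * (p h - p a).
  have eD : D%:~R = (b%:R - a%:R) * (y h - y a) - (h%:R - a%:R) * (y b - y a) :> R.
    by rewrite /D rmorphB/= !rmorphM/= !rmorphB/= -!pmulrn /y; ring.
  have dD : (d%:Z %| D)%Z.
    apply: rpredB; apply: dvdz_mulr; apply: rpredB; rewrite dvdzE//.
  have DW : `|D%:~R| <= 4 * W * rho :> R.
    rewrite eD; apply: le_trans (ler_normB _ _) _; rewrite !normrM.
    have hy u v : u \in a :: s -> v \in a :: s -> `|y u - y v| <= 2 * rho.
      by move=> us vs; apply: le_trans (ler_normB _ _) _; have := yr _ us; have := yr _ vs; lra.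
    have hx u : u \in a :: s -> `|u%:R - a%:R| <= W.
      move=> us; rewrite ger0_norm; first exact: hW.
      by rewrite subr_ge0 ler_nat; case/andP: (ab _ us).
    have := ler_pM (normr_ge0 _) (normr_ge0 _) (hx _ bl) (hy _ _ hh al).
    have := ler_pM (normr_ge0 _) (normr_ge0 _) (hx _ hh) (hy _ _ bl al).
    lra.
  have D0 : D = 0.
    apply/eqP; apply: contraTT (le_lt_trans DW Wd) => Dn; rewrite -leNgt.
    rewrite -intr_norm -[d%:R]/(d%:Z%:~R) ler_int.
    move: dD; rewrite dvdzE => /dvdn_leq; rewrite absz_gt0 => /(_ Dn) h1.
    by rewrite -abszE lez_nat.
  by apply/eqP; rewrite eq_sym -subr_eq0 -eD D0.
have L0 : (0 : R) < b%:R - a%:R by rewrite subr_gt0 ltr_nat.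
pose sg := (y b - y a) / (b%:R - a%:R).
have ysg u v : u \in a :: s -> v \in a :: s -> y u - y v = sg * (u%:R - v%:R).
  move=> us vs.
  have h1 : y u - y a = sg * (u%:R - a%:R).
    rewrite /sg mulrAC (mulrC (y b - y a)) (col _ us) mulrC mulKf ?lt0r_neq0//.
  have h2 : y v - y a = sg * (v%:R - a%:R).
    rewrite /sg mulrAC (mulrC (y b - y a)) (col _ vs) mulrC mulKf ?lt0r_neq0//.
  have -> : y u - y v = (y u - y a) - (y v - y a) by ring.
  by rewrite h1 h2; ring.
have gap u v : u \in a :: s -> v \in a :: s -> (u < v)%N ->
    c0 <= `|sg| * (v%:R - u%:R) ^+ 2.
  move=> us vs uv; have uv0 : (0 < v - u)%N by rewrite subn_gt0.
  apply: le_trans (bad uv0) _.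
  rewrite natrB ?(ltnW uv)//.
  have -> : `|sg| * (v%:R - u%:R) ^+ 2 = (v%:R - u%:R) * `|sg * (v%:R - u%:R)| :> R.
    have uvr : (0 : R) <= v%:R - u%:R by rewrite subr_ge0 ler_nat ltnW.
    by rewrite (normrM sg) (ger0_norm uvr); ring.
  rewrite ler_wpM2l ?subr_ge0 ?ler_nat ?(ltnW uv)//.
  rewrite -ysg//; apply: le_trans (dist_int_le _ (p v - p u)) _.
  by rewrite rmorphB/= /y le_eqVlt; apply/orP; left; apply/eqP; congr Num.norm; ring.
have sg0 : 0 < `|sg|.
  rewrite normr_gt0; apply/eqP => s0; have := gap _ _ al bl lt_ab.
  by rewrite s0 normr0 mul0r leNgt c00.
pose G := Num.sqrt (c0 / `|sg|).
have G2 : G ^+ 2 = c0 / `|sg| by rewrite sqr_sqrtr// divr_ge0// ltW.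
have hG : (size s)%:R * G <= b%:R - a%:R.
  apply: gap_count => // u v us vs uv.
  have uvr : (0 : R) <= v%:R - u%:R by rewrite subr_ge0 ler_nat ltnW.
  rewrite -(@ler_pXn2r _ 2) ?nnegrE ?sqrtr_ge0//.
  by rewrite G2 ler_pdivrMr// mulrC gap.
have n0 : (0 : R) <= (size s)%:R by [].
rewrite -[X in X <= _](ger0_norm n0) -sqrtr_sqr.
have W0 : 0 <= W by apply: le_trans (hW _ _ al bl); exact: ltW.
have Wr0 : 0 <= 2 * W * rho / c0 by rewrite divr_ge0 ?(ltW c00)// mulr_ge0// mulr_ge0.
rewrite ler_sqrt// ler_pdivlMr//.
have h1 : ((size s)%:R * G) ^+ 2 * `|sg| <= (b%:R - a%:R) ^+ 2 * `|sg|.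
  rewrite ler_wpM2r ?(ltW sg0)// lerXn2r ?nnegrE//.
  - by rewrite mulr_ge0// sqrtr_ge0.
  - exact: ltW.
have h2 : (b%:R - a%:R) ^+ 2 * `|sg| <= 2 * W * rho.
  have h3 : `|sg| * (b%:R - a%:R) <= 2 * rho.
    rewrite -(ger0_norm (ltW L0)) -normrM -ysg//.
    by apply: le_trans (ler_normB _ _) _; have := yr _ al; have := yr _ bl; lra.
  have h4 := hW _ _ al bl.
  have := ler_pM (mulr_ge0 (ltW sg0) (ltW L0)) (ltW L0) h3 h4.
  by rewrite expr2; lra.
have e : ((size s)%:R * G) ^+ 2 * `|sg| = (size s)%:R ^+ 2 * c0.
  by rewrite exprMn G2 -[LHS]mulrA divfK ?lt0r_neq0.
by rewrite -e; exact: le_trans h1 h2.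
Qed.

Definition bohr (d H : nat) (rho : R) : seq nat :=
  [seq h <- index_iota 1 H.+1 | (d %| h)%N && (dist_int (h%:R * alpha) <= rho)].

Lemma mem_bohr d H rho h : h \in bohr d H rho ->
  [/\ (0 < h)%N, (h <= H)%N, (d %| h)%N & dist_int (h%:R * alpha) <= rho].
Proof. by rewrite mem_filter mem_index_iota => /andP[/andP[-> ->] /andP[-> ]]. Qed.

Definition bohr_cst := 16 * (1 + (Num.sqrt c0)^-1).

(** Cut [1, H] into windows of length W = d / (8 rho) and apply [window_count]
    to each; if H itself is shorter than W a single window suffices and gives
    the square root term. *)
Lemma bohr_count (d H : nat) (rho : R) : (0 < d)%N -> 0 < rho ->
  (size (bohr d H rho))%:R <= bohr_cst * (rho * H%:R / Num.sqrt d%:R + Num.sqrt (rho * H%:R)).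
Proof.
move=> d0 r0.
have sc0 : 0 < Num.sqrt c0 by rewrite sqrtr_gt0.
have d0' : (0 : R) < d%:R by rewrite ltr0n.
have sd0 : 0 < Num.sqrt (d%:R : R) by rewrite sqrtr_gt0.
have rH0 : 0 <= rho * H%:R by rewrite mulr_ge0// ltW.
have cst0 : 0 <= bohr_cst by rewrite mulr_ge0// addr_ge0// invr_ge0 ltW.
have srt : sorted ltn (bohr d H rho).
  by apply: sorted_filter; [exact: ltn_trans|exact: iota_ltn_sorted].
have [e0|ne] := posnP (size (bohr d H rho)).
  by rewrite e0 mulr_ge0// addr_ge0 ?sqrtr_ge0// divr_ge0// ltW.
have c0rH : c0 <= rho * H%:R.
  move: ne; rewrite -has_predT => /hasP[h /mem_bohr[h0 hH _ hd] _].
  apply: le_trans (bad h0) _; rewrite mulrC; apply: ler_pM => //; first exact: dist_int_ge0.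
  by rewrite ler_nat.
have [big|small] := leP (8 * (rho * H%:R)) d%:R.
  have := @window_count d H%:R rho (bohr d H rho) d0 (ltW r0).
  have h1 : 4 * H%:R * rho < d%:R by lra.
  move=> /(_ h1 srt).
  have h2 h : h \in bohr d H rho -> (d %| h)%N /\ dist_int (h%:R * alpha) <= rho.
    by move=> /mem_bohr[].
  have h3 h h' : h \in bohr d H rho -> h' \in bohr d H rho -> h'%:R - h%:R <= H%:R :> R.
    move=> _ /mem_bohr[_ h'H _ _]; rewrite lerBlDr.
    have : (h'%:R : R) <= H%:R by rewrite ler_nat.
    have : (0 : R) <= h%:R by []. lra.
  move=> /(_ h2 h3) h4; apply: le_trans h4 _.
  apply: (@le_trans _ _ (bohr_cst * Num.sqrt (rho * H%:R))); last first.
    by rewrite ler_wpM2l// lerDr divr_ge0// ltW.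
  have -> : 2 * H%:R * rho / c0 = 2 * (rho * H%:R / c0) by ring.
  rewrite sqrtrM// sqrtrM// sqrtrV ?(ltW c00)//.
  set S := Num.sqrt (rho * H%:R); set s := (Num.sqrt c0)^-1.
  have s0 : 0 < s by rewrite invr_gt0.
  have S0 : 0 <= S by rewrite sqrtr_ge0.
  have one : 1 <= S * s.
    by rewrite /s ler_pdivlMr// mul1r /S ler_sqrt.
  have s2 : Num.sqrt 2 <= 2 :> R.
    by rewrite -[X in _ <= X](@ger0_norm _ 2)// -sqrtr_sqr ler_sqrt// expr2; lra.
  have := ler_wpM2r (mulr_ge0 S0 (ltW s0)) s2.
  rewrite /bohr_cst -/s; have := mulr_ge0 S0 (ltW s0); lra.
pose W := d%:R / (8 * rho).
have W0 : 0 < W by rewrite divr_gt0// mulr_gt0.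
have WH : W < H%:R by rewrite ltr_pdivrMr ?mulr_gt0//; lra.
pose bin h := Num.truncn (h%:R / W).
pose J := (Num.truncn (H%:R / W)).+1.
pose M := 1 + Num.sqrt (2 * W * rho / c0).
have binH h : h \in bohr d H rho -> (bin h < J)%N.
  move=> /mem_bohr[_ hH _ _]; rewrite ltnS; apply: le_truncn.
  by rewrite ler_pM2r ?invr_gt0// ler_nat.
have szs : (size (bohr d H rho))%:R = \sum_(j < J) (size [seq h <- bohr d H rho | bin h == j])%:R :> R.
  rewrite -natr_sum; congr (_%:R).
  under eq_bigr do rewrite size_filter -sum1_count big_mkcond.
  rewrite exchange_big/= -sum1_size big_seq [RHS]big_seq; apply: eq_bigr => h hb.
  rewrite (bigD1 (Ordinal (binH _ hb)))//= eqxx big1// => i ne'.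
  case: eqP => // e; move/negP: ne'; case; apply/eqP; apply: val_inj; exact/esym.
rewrite szs.
have hbin (j : 'I_J) : (size [seq h <- bohr d H rho | bin h == j])%:R <= M.
  have e4 : 4 * W * rho < d%:R.
    have -> : 4 * W * rho = d%:R / 2 by rewrite /W; field; rewrite lt0r_neq0.
    lra.
  apply: (@window_count d W rho _ d0 (ltW r0) e4).
  - by apply: sorted_filter => //; exact: ltn_trans.
  - by move=> h; rewrite mem_filter => /andP[_ /mem_bohr[]].
  - move=> h h'; rewrite !mem_filter => /andP[/eqP b1 _] /andP[/eqP b2 _].
    have q0 (k : nat) : 0 <= k%:R / W by rewrite divr_ge0// ltW.
    have /andP[t1 t2] := truncn_itv (q0 h); have /andP[t3 t4] := truncn_itv (q0 h').
    rewrite -/(bin h) b1 in t1 t2; rewrite -/(bin h') b2 in t3 t4.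
    rewrite ler_pdivlMr// in t1; rewrite ltr_pdivrMr// in t4.
    by rewrite -[j.+1]addn1 natrD in t4; lra.
apply: (@le_trans _ _ (\sum_(j < J) M)); first by apply: ler_sum.
rewrite sumr_const card_ord -(mulr_natl M).
have hJ : J%:R <= 2 * (H%:R / W).
  have /andP[t1 _] := truncn_itv (divr_ge0 (ler0n R H) (ltW W0)).
  have : 1 <= H%:R / W by rewrite ler_pdivlMr// mul1r ltW.
  by rewrite /J -addn1 natrD; lra.
apply: (@le_trans _ _ (bohr_cst * (rho * H%:R / Num.sqrt d%:R))); last first.
  by rewrite ler_wpM2l// lerDl sqrtr_ge0.
have hM : M <= Num.sqrt d%:R * (1 + (Num.sqrt c0)^-1).
  have -> : M = 1 + Num.sqrt (d%:R * (4^-1 * c0^-1)).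
    by congr (_ + Num.sqrt _); rewrite /W; field; rewrite !lt0r_neq0.
  rewrite sqrtrM ?(ltW d0')// mulrDr mulr1 lerD//.
    by rewrite -{1}(@sqrtr1 R) ler_sqrt// ler1n.
  have ci0 : 0 <= c0^-1 by rewrite invr_ge0 ltW.
  rewrite ler_wpM2l ?sqrtr_ge0// -sqrtrV ?(ltW c00)// ler_sqrt//.
  by rewrite ler_piMl//; lra.
have J0 : (0 : R) <= J%:R by [].
have M0 : 0 <= M by rewrite addr_ge0// sqrtr_ge0.
apply: le_trans (ler_pM J0 M0 hJ hM) _.
rewrite le_eqVlt; apply/orP; left; apply/eqP.
rewrite /W /bohr_cst.
have -> : 2 * (H%:R / (d%:R / (8 * rho))) * (Num.sqrt d%:R * (1 + (Num.sqrt c0)^-1)) =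
  16 * (1 + (Num.sqrt c0)^-1) * (rho * H%:R * (Num.sqrt d%:R / d%:R)).
  by field; rewrite !lt0r_neq0.
congr (_ * (_ * _)).
by rewrite -{2}(@sqr_sqrtr _ d%:R) ?(ltW d0')// expr2 invfM mulrA divff ?mul1r// lt0r_neq0.
Qed.

(** Expand the product over p as a sum over squarefree divisors and count each
    by [bohr_count]; the saving sqrt p makes the main term convergent. The
    expansion is organised as an induction on the list of primes, with d the
    divisor extracted so far. *)
Lemma bohr_weighted (H : nat) (rho : R) (s : seq nat) : 0 < rho -> uniq s -> all prime s ->
  forall d, (0 < d)%N -> (forall p, p \in s -> coprime d p) ->
  \sum_(h <- bohr d H rho) \prod_(p <- s | (p %| h)%N) (1 + p%:R^-1) <=
  bohr_cst * (rho * H%:R / Num.sqrt d%:R * \prod_(p <- s) (1 + p%:R^-1 / Num.sqrt p%:R)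
     + Num.sqrt (rho * H%:R) * \prod_(p <- s) (1 + p%:R^-1)).
Proof.
move=> r0; elim: s => [|p s IH].
  move=> _ _ d d0 _; rewrite !big_nil !mulr1.
  under eq_bigr do rewrite big_nil.
  rewrite big_const_seq count_predT iter_addr_0; exact: bohr_count.
move=> /= /andP[ps us] /andP[pp al] d d0 cd.
have {}IH := IH us al.
have cds q : q \in s -> coprime d q by move=> qs; apply: cd; rewrite inE qs orbT.
have cdp : coprime d p by apply: cd; rewrite inE eqxx.
pose F h : R := \prod_(q <- s | (q %| h)%N) (1 + q%:R^-1).
have -> : \sum_(h <- bohr d H rho) \prod_(q <- p :: s | (q %| h)%N) (1 + q%:R^-1) =
   \sum_(h <- bohr d H rho) F h + p%:R^-1 * \sum_(h <- bohr (d * p) H rho) F h.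
  rewrite /bohr !big_filter big_distrr/=.
  rewrite [X in _ = _ + X](_ : _ = \sum_(h <- index_iota 1 H.+1 | (d %| h)%N && (dist_int (h%:R * alpha) <= rho))
      (if (p %| h)%N then p%:R^-1 * F h else 0)).
    rewrite -big_split/=; apply: eq_bigr => h _; rewrite big_cons -/(F h).
    by case: ifP => _; rewrite ?addr0// mulrDl mul1r.
  rewrite -big_mkcondr; apply: eq_bigl => h; rewrite Gauss_dvd//.
  by rewrite -!andbA; congr andb; rewrite andbC.
have h1 := IH d d0 cds.
have dp0 : (0 < d * p)%N by rewrite muln_gt0 d0 prime_gt0.
have cdps q : q \in s -> coprime (d * p) q.
  move=> qs; rewrite coprimeMl cds//=.
  rewrite prime_coprime// dvdn_prime2//; last by move/allP: al; apply.
  by apply: contraNneq ps => ->.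
have h2 := IH (d * p)%N dp0 cdps.
have p0 : (0 : R) < p%:R by rewrite ltr0n prime_gt0.
have pi0 : 0 <= p%:R^-1 :> R by rewrite invr_ge0.
have h3 := ler_wpM2l pi0 h2.
apply: le_trans (lerD h1 h3) _.
rewrite !big_cons natrM sqrtrM// invfM.
set A := \prod_(_ <- _) _; set B := \prod_(_ <- _) _.
rewrite le_eqVlt; apply/orP; left; apply/eqP; ring.
Qed.

(** Comparison with the integral of x^(-3/2), in telescoping form. *)
Lemma prod_pow32 (s : seq nat) : uniq s -> all prime s ->
  \prod_(p <- s) (1 + p%:R^-1 / Num.sqrt p%:R) <= expR 2 :> R.
Proof.
move=> us ps.
have [N hN] : exists N, all (fun p => p < N.+2)%N s.
  elim: (s) => [|p t [N IH]]; first by exists 0%N.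
  exists (maxn N p); rewrite /= -addn2; apply/andP; split; first by lia.
  by apply: sub_all IH => q; lia.
apply: (@le_trans _ _ (\prod_(2 <= p < N.+2) (1 + p%:R^-1 / Num.sqrt p%:R))).
  have pos (p : nat) : 1 <= 1 + p%:R^-1 / Num.sqrt p%:R :> R.
    by rewrite lerDl divr_ge0 ?sqrtr_ge0// invr_ge0.
  have sub : forall p, p \in s -> p \in index_iota 2 N.+2.
    by move=> p p_s; rewrite mem_index_iota prime_gt1 ?(allP ps)//= (allP hN).
  have -> : \prod_(p <- s) (1 + p%:R^-1 / Num.sqrt p%:R) =
     \prod_(p <- index_iota 2 N.+2 | p \in s) (1 + p%:R^-1 / Num.sqrt p%:R) :> R.
    rewrite -[RHS]big_filter; apply: perm_big; apply: uniq_perm => //.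
      by rewrite filter_uniq// iota_uniq.
    move=> p; rewrite mem_filter; apply/idP/andP; last by case.
    by move=> p_s; split=> //; exact: sub.
  rewrite big_mkcond; apply: ler_prod => p _; case: ifP => _.
    by rewrite lexx andbT (le_trans _ (pos p)).
  by rewrite ler01 pos.
apply: (@le_trans _ _ (expR (\sum_(2 <= p < N.+2) p%:R^-1 / Num.sqrt p%:R))).
  rewrite expR_sum; apply: ler_prod => p _; rewrite expR_ge1Dx andbT.
  by rewrite addr_ge0// divr_ge0 ?sqrtr_ge0// invr_ge0.
rewrite ler_expR.
suff : \sum_(2 <= p < N.+2) p%:R^-1 / Num.sqrt p%:R <= 2 - 2 / Num.sqrt (N.+1)%:R :> R.
  have : 0 <= 2 / Num.sqrt (N.+1%:R : R) by rewrite divr_ge0// sqrtr_ge0.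
  lra.
elim: (N) => [|n IH]; first by rewrite big_geq// sqrtr1 divr1 subrr.
rewrite big_nat_recr//=; apply: le_trans (lerD IH (lexx _)) _.
set a := Num.sqrt (n.+1%:R : R); set b := Num.sqrt (n.+2%:R : R).
have a0 : 0 < a by rewrite sqrtr_gt0.
have b0 : 0 < b by rewrite sqrtr_gt0.
have a2 : a ^+ 2 = n.+1%:R by rewrite sqr_sqrtr.
have b2 : b ^+ 2 = n.+2%:R by rewrite sqr_sqrtr.
have ab : b ^+ 2 - a ^+ 2 = 1 by rewrite a2 b2 -[n.+2]addn1 natrD; ring.
rewrite -b2.
have lab : a <= b by rewrite ler_sqrt// ler_nat.
have h : 0 <= (2 * b ^+ 3 - a - 2 * a * b ^+ 2 ) * (a + b).
  have e : (2 * b ^+ 3 - a - 2 * a * b ^+ 2) * (a + b) = 2 * b ^+ 2 * (b ^+ 2 - a ^+ 2) - a ^+ 2 - a * b by ring.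
  by rewrite e ab expr2; nra.
have {}h : 0 <= 2 * b ^+ 3 - a - 2 * a * b ^+ 2 by rewrite -(pmulr_lge0 _ (addr_gt0 a0 b0)).
rewrite -subr_ge0.
have -> : 2 - 2 / b - (2 - 2 / a + b ^- 2 / b) = (2 * b ^+ 3 - a - 2 * a * b ^+ 2) / (a * b ^+ 3).
  by field; rewrite !lt0r_neq0.
by rewrite divr_ge0// mulr_ge0 ?exprn_ge0// ltW.
Qed.

(** An integer h < 2^m has at most m prime factors, so those exceeding m
    contribute at most (1 + 1/m)^m. Only the primes below m matter, and their
    full product is as small as log m. *)
Lemma sing_le (P : set nat) (PP : P `<=` [set p | prime p]) (h n m : nat) :
  (0 < h)%N -> (0 < m)%N -> (h < 2 ^ m)%N ->
  sing P h n <= expR 1 * \prod_(p <- [seq p <- index_iota 0 m | prime p] | (p %| h)%N) (1 + p%:R^-1) :> R.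
Proof.
move=> h0 m0 hm.
pose F p : R := 1 + p%:R^-1.
have F1 p : 1 <= F p by rewrite lerDl invr_ge0.
pose N := maxn n m.
have h1 : sing P h n <= \prod_(0 <= p < N | prime p && (p %| h)%N) F p.
  rewrite /sing [X in _ <= X](@big_cat_nat _ _ _ n)//= ?leq_maxl//.
  rewrite -[X in X <= _]mulr1; apply: ler_pM => //.
  - by apply: prodr_ge0 => p _; exact: le_trans (F1 p).
  - rewrite big_mkcond [X in _ <= X]big_mkcond/=; apply: ler_prod => p _.
    case: ifP => [/andP[]|_]; first rewrite inE => /PP /= -> ->.
      by rewrite lexx andbT (le_trans _ (F1 p)).
    by rewrite ler01/=; case: ifP => _.
  - apply: (big_ind (fun x : R => 1 <= x)) => // x y hx hy.
    by rewrite mulr_ege1.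
apply: le_trans h1 _; rewrite (@big_cat_nat _ _ _ m)//= ?leq_maxr// mulrC.
rewrite [X in _ <= _ * X]big_filter_cond; apply: ler_wpM2r.
  by apply: prodr_ge0 => p _; exact: le_trans (F1 p).
rewrite -big_filter; set t := [seq p <- _ | _].
have tP p : p \in t -> [/\ prime p, (p %| h)%N & (m <= p)%N].
  by rewrite mem_filter mem_index_iota => /andP[/andP[-> ->] /andP[->]].
have szt : (size t <= m)%N.
  have h2 : (\prod_(p <- t) p %| h)%N.
    apply: prod_primes_dvd; first by rewrite filter_uniq// iota_uniq.
    - by apply/allP => p /tP[].
    - by apply/allP => p /tP[].
  have h3 : (2 ^ size t <= \prod_(p <- t) p)%N.
    have : all prime t by apply/allP => p /tP[].
    elim: (t) => [|p t' IH] /=; first by rewrite big_nil expn0.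
    by rewrite big_cons expnS => /andP[/prime_gt1 p1 /IH]; exact: leq_mul.
  have := leq_ltn_trans (leq_trans h3 (dvdn_leq h0 h2)) hm.
  by rewrite ltn_exp2l// => /ltnW.
have mr : (0 : R) < m%:R by rewrite ltr0n.
apply: (@le_trans _ _ (\prod_(p <- t) expR (m%:R^-1))).
  rewrite big_seq [X in _ <= X]big_seq; apply: ler_prod => p /tP[_ _ mp].
  apply/andP; split; first exact: le_trans (F1 p).
  apply: le_trans (expR_ge1Dx _); rewrite lerD2l lef_pV2 ?posrE ?ler_nat//.
  by rewrite ltr0n (leq_trans m0).
rewrite -expR_sum ler_expR big_const_seq count_predT iter_addr_0 -(mulr_natr m%:R^-1).
by rewrite mulrC ler_pdivrMr// mul1r ler_nat.
Qed.

(** On average over a Bohr set the singular factor is bounded; the loss [mert m]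
    affects the smaller square root term only. *)
Theorem bohr_sing (P : set nat) (H m n : nat) (rho : R) : P `<=` [set p | prime p] ->
  0 < rho -> (0 < m)%N -> (H < 2 ^ m)%N ->
  \sum_(h <- bohr 1 H rho) sing P h n <=
   expR 1 * bohr_cst * (expR 2 * (rho * H%:R) + Num.sqrt (rho * H%:R) * mert m).
Proof.
move=> PP r0 m0 Hm.
pose s := [seq p <- index_iota 0 m | prime p].
apply: (@le_trans _ _ (\sum_(h <- bohr 1 H rho)
    expR 1 * \prod_(p <- s | (p %| h)%N) (1 + p%:R^-1))).
  rewrite big_seq [X in _ <= X]big_seq; apply: ler_sum => h /mem_bohr[h0 hH _ _].
  by apply: sing_le => //; exact: leq_ltn_trans Hm.
rewrite -big_distrr/= -mulrA; apply: ler_wpM2l; first exact: expR_ge0.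
have us : uniq s by rewrite filter_uniq// iota_uniq.
have ps : all prime s by apply/allP => p; rewrite mem_filter => /andP[].
apply: le_trans (bohr_weighted H r0 us ps (d := 1%N) _ _) _ => //.
  by move=> p _; rewrite coprime1n.
have rH : 0 <= rho * H%:R by rewrite mulr_ge0// ltW.
apply: ler_wpM2l.
  by rewrite mulr_ge0// addr_ge0// invr_ge0 sqrtr_ge0.
rewrite sqrtr1 divr1 [expR 2 * _]mulrC; apply: lerD.
  by apply: ler_wpM2l => //; exact: prod_pow32.
by rewrite /mert /s big_filter.
Qed.
End Bohr.

(** * Badly approximable numbers belong to the intersection *)


Ltac pos := repeat first [assumption | (apply: ltW; assumption)
  | apply: expR_gt0 | apply: expR_ge0 | apply: sqrtr_ge0 | exact: ler0n | apply: normr_ge0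
  | apply: mulr_gt0 | apply: mulr_ge0 | apply: addr_gt0 | apply: addr_ge0
  | apply: exprn_gt0 | apply: exprn_ge0 | rewrite invr_gt0 | rewrite invr_ge0 | rewrite ltr0n | done].

Section Growth.
Context {R : realType}.

Lemma poly_exp_bound (v : R) (d : nat) : 0 < v < 1 ->
  exists2 C : R, 0 < C & forall l : nat, l%:R ^+ d * v ^+ l <= C.
Proof.
move=> /andP[v0 v1].
pose w := - ln v; have w0 : 0 < w by rewrite oppr_gt0 ln_lt0// v0 v1.
pose e := d.+1.
have e0 : (0 : R) < e%:R by rewrite ltr0n.
exists ((e%:R / w) ^+ d); first by rewrite exprn_gt0// divr_gt0.
move=> l.
have vl : v ^+ l = expR (- (w * l%:R)).
  have ev : v = expR (- w) by rewrite opprK lnK// posrE.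
  by rewrite [in LHS]ev -expRM_natl mulrN mulrC.
rewrite vl expRN ler_pdivrMr ?expR_gt0//.
have h1 : (w * l%:R / e%:R) ^+ d <= expR (w * l%:R).
  have h2 : w * l%:R / e%:R <= expR (w * l%:R / e%:R).
    by apply: le_trans (expR_ge1Dx _); rewrite lerDr.
  have h3 : 1 <= expR (w * l%:R / e%:R) by rewrite -expR0 ler_expR divr_ge0 ?mulr_ge0// ltW.
  have h4 : expR (w * l%:R / e%:R) ^+ e = expR (w * l%:R).
    by rewrite -expRM_natl mulrC divfK// lt0r_neq0.
  apply: (@le_trans _ _ (expR (w * l%:R / e%:R) ^+ d)).
    by rewrite lerXn2r// ?nnegrE ?expR_ge0// divr_ge0 ?mulr_ge0// ltW.
  by rewrite -h4 ler_weXn2l.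
have -> : l%:R ^+ d = (e%:R / w) ^+ d * (w * l%:R / e%:R) ^+ d :> R.
  by rewrite -exprMn; congr (_ ^+ _); field; rewrite !lt0r_neq0.
by rewrite ler_wpM2l// exprn_ge0// divr_ge0// ltW.
Qed.

Lemma poly_exp_small (v : R) (d : nat) (x : R) : 0 < v < 1 -> 0 < x ->
  exists l0, forall l : nat, (l0 <= l)%N -> l%:R ^+ d * v ^+ l <= x.
Proof.
move=> v01 x0; have [C C0 hC] := poly_exp_bound d.+1 v01.
exists (Num.truncn (C / x)).+1 => l hl.
have l0 : (0 : R) < l%:R by rewrite ltr0n; exact: leq_ltn_trans hl.
have h1 : C / x <= l%:R by apply: le_trans (ltW (truncnS_gt _)) _; rewrite ler_nat.
rewrite ler_pdivrMr// in h1.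
have := hC l; rewrite exprS -mulrA => h2.
by rewrite -(ler_pM2l l0); exact: le_trans h2 h1.
Qed.

(** The left side is of order log k, smaller than any power of k. *)
Lemma mert_power (eta : R) (K : nat) : 0 < eta -> exists2 C : R, 0 < C &
  forall k, (0 < k)%N -> mert (K * k + 2) <= C * k%:R `^ eta.
Proof.
move=> eta0.
have l2 : 0 < ln (2 : R) by rewrite ln_gt0// ltr1n.
pose c := Num.min 1 (eta * ln 2).
have c0 : 0 < c by rewrite lt_min ltr01 mulr_gt0.
pose B : R := (K + 2)%:R `^ eta.
have B0 : 0 < B by rewrite powR_gt0// ltr0n addn_gt0 orbT.
exists (expR 7 / c * B); first by rewrite mulr_gt0// divr_gt0// expR_gt0.
move=> k k0.
pose j := trunc_log 2 (K * k + 2).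
have jP : (2 ^ j <= K * k + 2)%N by apply: trunc_logP => //; rewrite addn2.
have jP2 : (K * k + 2 <= 2 ^ j.+1)%N by apply/ltnW/trunc_log_ltn.
apply: le_trans (mert_homo jP2) _.
apply: le_trans (mert_le (ltn0Sn _)) _.
rewrite -[X in _ <= X]mulrA -[X in _ <= X]mulrA ler_pM2l ?expR_gt0//.
rewrite ler_pdivlMl//.
apply: (@le_trans _ _ (((K + 2) * k)%:R `^ eta)); last by rewrite natrM powRM.
apply: (@le_trans _ _ ((2 ^ j)%:R `^ eta)); last first.
  rewrite ge0_ler_powR ?nnegrE//; first exact: ltW.
  rewrite ler_nat (leq_trans jP)// mulnDl leq_add2l; lia.
rewrite natrX -powR_mulrn// -powRrM /powR pnatr_eq0/=.
apply: le_trans (expR_ge1Dx _).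
rewrite -[j.+1]addn1 natrD mulrDr mulr1.
have h1 : c <= 1 by rewrite /c ge_min lexx.
have h2 : c <= eta * ln 2 by rewrite /c ge_min lexx orbT.
have j0 : (0 : R) <= j%:R by [].
have := ler_wpM2r j0 h2; lra.
Qed.

Lemma esum_le_bound (A : set nat) (F : nat -> R) (M : R) : (forall k, A k -> 0 <= F k) ->
  (forall n, \sum_(0 <= k < n | k \in A) F k <= M) ->
  (\esum_(k in A) (F k)%:E <= M%:E)%E.
Proof.
move=> F0 hM.
have -> : (\esum_(k in A) (F k)%:E = \esum_(k in [set k | k \in A]) (F k)%:E)%E.
  by congr esum; apply/seteqP; split => x /=; rewrite inE.
rewrite -nneseries_esum; last by move=> n; rewrite inE lee_fin; exact: F0.
apply: lime_le; first by apply: is_cvg_nneseries => n _; rewrite inE lee_fin; exact: F0.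
by apply: nearW => n; rewrite sumEFin lee_fin.
Qed.

Lemma sum_inv_sq (a b : nat) : (0 < a)%N -> \sum_(a <= k < b) (k%:R ^+ 2)^-1 <= 2 :> R.
Proof.
move=> a0; apply: (@le_trans _ _ (\sum_(1 <= k < b) (k%:R ^+ 2)^-1)).
  have [ab|ba] := leqP a b; last by rewrite big_geq 1?ltnW//; apply: sumr_ge0 => *; rewrite invr_ge0 sqr_ge0.
  rewrite [X in _ <= X](@big_cat_nat _ _ _ a)//= lerDr.
  by apply: sumr_ge0 => *; rewrite invr_ge0 sqr_ge0.
have [|b1] := leqP b 1; first by move=> b1; rewrite big_geq.
suff : \sum_(1 <= k < b) (k%:R ^+ 2)^-1 <= 2 - (b.-1%:R)^-1 :> R.
  have : 0 <= (b.-1%:R : R)^-1 by rewrite invr_ge0.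
  lra.
case: b b1 => // -[//|b] _ /=.
elim: b => [|b IH]; first by rewrite big_nat1 expr1n invr1; lra.
rewrite big_nat_recr//=; apply: le_trans (lerD IH (lexx _)) _.
have b0 : (0 : R) < b.+1%:R by rewrite ltr0n.
have -> : (b.+2%:R : R) = b.+1%:R + 1 by rewrite -[b.+2]addn1 natrD.
move: (b.+1%:R) b0 => x x0.
rewrite -subr_ge0.
have -> : 2 - (x + 1)^-1 - (2 - x^-1 + ((x + 1) ^+ 2)^-1) = (x * (x + 1) ^+ 2)^-1.
  by field; apply/andP; split; lra.
by rewrite invr_ge0 mulr_ge0 ?sqr_ge0// ltW.
Qed.
End Growth.

Section Fibre.
Context {R : realType}.
Notation mu := (@lebesgue_measure R).
Notation D := (`[0%R, 1%R[%classic : set R).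
Variables (A P : set nat).
Hypothesis PP : P `<=` [set p | prime p].
Hypothesis A_pos : A `<=` [set n | (0 < n)%N].

Definition Alist k := [seq n <- index_iota (2 ^ k) (2 ^ k.+1) | n \in A].
Definition Ncard k : nat := cnt A (2 ^ k) (2 ^ k.+1).
Definition Edens k : R := eul P (2 ^ k).
Definition sdens k : R := 2 ^+ k * Edens k.

Lemma size_Alist k : size (Alist k) = Ncard k.
Proof. by rewrite /Ncard cnt_size. Qed.

Lemma mem_Alist k n : n \in Alist k -> [/\ A n, (2 ^ k <= n)%N & (n < 2 ^ k.+1)%N].
Proof. by rewrite mem_filter mem_index_iota => /andP[]; rewrite inE => ? /andP[-> ->]. Qed.

Lemma uniq_Alist k : uniq (Alist k).
Proof. by rewrite filter_uniq// iota_uniq. Qed.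

Lemma Edens_gt0 k : 0 < Edens k.
Proof. exact: eul_gt0. Qed.

Lemma Edens_le1 k : Edens k <= 1.
Proof. exact: eul_le1. Qed.

Lemma Edens_nincr k l : (k <= l)%N -> Edens l <= Edens k.
Proof. by move=> kl; apply: eul_nincr => //; rewrite leq_exp2l. Qed.

Lemma sdens_gt0 k : 0 < sdens k.
Proof. by rewrite mulr_gt0 ?exprn_gt0// Edens_gt0. Qed.

Lemma sdensS k : (4 <= k)%N -> sdens k <= sdens k.+1.
Proof.
move=> k4; rewrite /sdens exprS -mulrA mulrCA ler_pM2l ?exprn_gt0//.
suff h : Edens k / 2 <= Edens k.+1 by lra.
rewrite /Edens [X in _ <= X]/eul (@big_cat_nat _ _ _ (2 ^ k))//= ?leq_exp2l// -/(eul P _).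
rewrite ler_pM2l ?eul_gt0//.
have step (s : seq nat) : all (fun p => 2 <= p)%N s ->
   (1 - \sum_(p <- s) p%:R^-1 <= \prod_(p <- s) (1 - p%:R^-1) :> R) /\
   (0 <= (\prod_(p <- s) (1 - p%:R^-1) : R) <= 1).
  elim: s => [|p s IH] /=; first by rewrite !big_nil subr0 lexx ler01.
  move=> /andP[p2 /IH[h1 h2]]; rewrite !big_cons.
  have hp : 0 <= (p%:R : R)^-1 <= 2^-1.
    rewrite invr_ge0 ler0n/= lef_pV2 ?posrE// ?ler_nat// ltr0n; lia.
  move: hp h1 h2; move: (p%:R^-1) (\sum_(_ <- _) _) (\prod_(_ <- _) _) => x S Q hp h1 h2.
  by split; [|apply/andP; split]; nra.
rewrite -big_filter; set s := [seq p <- _ | _].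
have hs : all (fun p => 2 <= p)%N s.
  by apply/allP => p; rewrite mem_filter => /andP[/(P_ge2 PP)].
have [h1 _] := step s hs; apply: le_trans h1.
have h2 : \sum_(p <- s) p%:R^-1 <= dsum k :> R.
  rewrite /dsum /s big_filter big_filter big_mkcond [X in _ <= X]big_mkcond; apply: ler_sum => p _.
  case: ifP => h1; case: ifP => h2; rewrite ?invr_ge0//.
  by move: h1; rewrite inE => /PP/=; rewrite h2.
have h3 := @dsum_le R k.
have h4 : 2 / k%:R <= 2^-1 :> R.
  by rewrite ler_pdivrMr ?ltr0n; [rewrite ler_pdivlMl// -natrM ler_nat|lia].
lra.
Qed.

Lemma sdens_mono k l : (4 <= k)%N -> (k <= l)%N -> sdens k <= sdens l.
Proof.
move=> k4; elim: l => [|l IH]; first by rewrite leqn0 => /eqP ->.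
rewrite leq_eqVlt => /orP[/eqP->//|kl]; apply: le_trans (IH kl) (sdensS _).
exact: leq_trans k4 kl.
Qed.

Lemma sdens_ge k : (0 < k)%N -> (2 * expR 7)^-1 / k%:R * 2 ^+ k <= sdens k.
Proof. by move=> k0; rewrite mulrC ler_pM2l ?exprn_gt0//; exact: eul_ge. Qed.

Lemma Edens_ratio k l K : (0 < k)%N -> (k <= l)%N -> (l <= K * k)%N ->
  Edens k <= expR (4 * K%:R) * Edens l.
Proof.
move=> k0 kl lK; have h := @eul_dyadic R P PP k l k0 kl.
rewrite -ler_pdivrMl ?expR_gt0// -expRN mulrC; apply: le_trans h.
rewrite ler_pM2l ?eul_gt0// ler_expR lerN2 ler_wpM2l// ler_pdivrMr ?ltr0n//.
by rewrite -natrM ler_nat.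
Qed.

(** From here on alpha is a fixed badly approximable number. The hypotheses
    Hlow, Hupp and Hdel express the density condition on dyadic blocks, Hsieve
    the absence of small prime factors, and Hdisc the discrepancy estimate, the
    power saving being u^k with u < 1. *)
Variables (alpha c0 : R).
Hypothesis c00 : 0 < c0.
Hypothesis bad : forall n, (0 < n)%N -> c0 <= n%:R * dist_int (n%:R * alpha).
Variables (C1 C3 u delta : R) (k1 M : nat).
Hypothesis C10 : 0 < C1.
Hypothesis C30 : 0 < C3.
Hypothesis u01 : 0 < u < 1.
Hypothesis delta0 : 0 < delta.
Hypothesis Hlow : forall k, (k1 <= k)%N -> sdens k <= C1 * (Ncard k)%:R.
Hypothesis Hupp : forall k, (k1 <= k)%N -> (Ncard k)%:R <= C1 * sdens k.
Hypothesis Hdel : forall k, (k1 <= k)%N -> Edens k * k%:R `^ delta <= C1.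
Hypothesis M48 : (48 <= M)%N.
Hypothesis Hsieve : forall I k n p, (k1 <= k)%N -> (M * 2 ^ I <= k)%N -> A n -> (2 ^ k <= n)%N ->
  P p -> (p < 2 ^ (2 ^ I))%N -> ~~ (p %| n)%N.
Hypothesis Hdisc : forall k a b, (k1 <= k)%N -> 0 <= a -> a < b -> b <= 1 ->
  `|\sum_(n <- Alist k) (frac_part (n%:R * alpha) \in `[a, b])%:R - (Ncard k)%:R * (b - a)|
    <= C3 * (2 ^+ k * u ^+ k).

(** Being close to x modulo 1 is a condition on fractional parts that involves
    at most three intervals, because of the wrap-around at 0 and 1. *)
Lemma near_count k x rho : (k1 <= k)%N -> 0 < rho ->
  \sum_(n <- Alist k) (dist_int (n%:R * alpha - x) <= rho)%R%:R <=
   4 * rho * (Ncard k)%:R + 3 * C3 * (2 ^+ k * u ^+ k).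
Proof.
move=> kk r0; pose b := frac_part x.
have /andP[b0 b1] := frac_part_itv x; rewrite -/b in b0 b1.
pose I1 := `[Num.max 0 (b - rho), Num.min 1 (b + rho)] : interval R.
pose I2 := `[0, Num.min 1 rho] : interval R.
pose I3 := `[Num.max 0 (1 - rho), 1] : interval R.
have pt n : (dist_int (n%:R * alpha - x) <= rho)%R%:R <=
   (frac_part (n%:R * alpha) \in I1)%:R + (frac_part (n%:R * alpha) \in I2)%:R
    + (frac_part (n%:R * alpha) \in I3)%:R :> R.
  case: (boolP (dist_int (n%:R * alpha - x) <= rho)) => [|_]; last by rewrite !addr_ge0.
  have -> : n%:R * alpha - x = frac_part (n%:R * alpha) - b
     + (Num.floor (n%:R * alpha) - Num.floor x)%:~R.
    by rewrite /b /frac_part rmorphB/=; ring.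
  rewrite dist_int_addz => /dist_intP[m].
  have /andP[f0 f1] := frac_part_itv (n%:R * alpha).
  move: (frac_part _) f0 f1 => f f0 f1.
  rewrite ler_norml => /andP[h1 h2].
  have [m0|m0|m0] := ltgtP m 0.
  - have m1 : m%:~R <= -1 :> R by rewrite -[-1]/((-1)%:~R) ler_int; clear -m0; lia.
    have -> : (f \in I2) = true.
      rewrite in_itv/= le_min; apply/and3P; split; lra.
    by rewrite [X in _ <= X]addrAC lerDr addr_ge0.
  - have m1 : 1 <= m%:~R :> R by rewrite -[1]/(1%:~R) ler_int; clear -m0; lia.
    have -> : (f \in I3) = true.
      rewrite in_itv/= ge_max; apply/andP; split; [apply/andP; split|]; lra.
    by rewrite lerDr addr_ge0.
  - rewrite m0 in h1 h2; have -> : (f \in I1) = true.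
      rewrite in_itv/= ge_max le_min.
      rewrite (_ : 0%:~R = 0 :> R)// in h1 h2.
      apply/andP; split; apply/andP; split; lra.
    by rewrite -addrA lerDl addr_ge0.
apply: (le_trans (ler_sum _ (fun n _ => pt n))).
rewrite !big_split/=.
have N0 : (0 : R) <= (Ncard k)%:R by [].
have d1 : \sum_(n <- Alist k) (frac_part (n%:R * alpha) \in I1)%:R <= 2 * rho * (Ncard k)%:R + C3 * (2 ^+ k * u ^+ k).
  have := @Hdisc k (Num.max 0 (b - rho)) (Num.min 1 (b + rho)) kk.
  rewrite le_max lexx/= lt_min !gt_max ltr01/= ge_min lexx/=.
  have -> : (b - rho < 1) && ((0 < b + rho) && (b - rho < b + rho)) by apply/and3P; split; lra.
  move=> /(_ isT isT isT); rewrite ler_norml => /andP[_ h].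
  have h2 : Num.min 1 (b + rho) - Num.max 0 (b - rho) <= 2 * rho.
    have : Num.min 1 (b + rho) <= b + rho by rewrite ge_min lexx orbT.
    have : b - rho <= Num.max 0 (b - rho) by rewrite le_max lexx orbT.
    lra.
  have := ler_wpM2l N0 h2; lra.
have d2 : \sum_(n <- Alist k) (frac_part (n%:R * alpha) \in I2)%:R <= rho * (Ncard k)%:R + C3 * (2 ^+ k * u ^+ k).
  have := @Hdisc k 0 (Num.min 1 rho) kk.
  rewrite lexx lt_min ltr01 r0 ge_min lexx => /(_ isT isT isT); rewrite ler_norml => /andP[_ h].
  have h2 : Num.min 1 rho - 0 <= rho by rewrite subr0 ge_min lexx orbT.
  have := ler_wpM2l N0 h2; lra.
have d3 : \sum_(n <- Alist k) (frac_part (n%:R * alpha) \in I3)%:R <= rho * (Ncard k)%:R + C3 * (2 ^+ k * u ^+ k).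
  have := @Hdisc k (Num.max 0 (1 - rho)) 1 kk.
  rewrite le_max lexx gt_max ltr01/= lexx; have -> : 1 - rho < 1 by lra.
  move=> /(_ isT isT isT); rewrite ler_norml => /andP[_ h].
  have h2 : 1 - Num.max 0 (1 - rho) <= rho.
    have : 1 - rho <= Num.max 0 (1 - rho) by rewrite le_max lexx orbT.
    lra.
  have := ler_wpM2l N0 h2; lra.
lra.
Qed.

(** The targets of m and n with radii at most rho / 2 can only meet if n alpha
    and m alpha are within rho of each other modulo 1. *)
Definition pairs k l (rho : R) : R :=
  \sum_(m <- Alist k) \sum_(n <- Alist l) (dist_int (n%:R * alpha - m%:R * alpha) <= rho)%R%:R.

(** For each m, count the n by the discrepancy estimate. *)
Lemma pairs_far k l rho : (k1 <= l)%N -> 0 < rho ->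
  pairs k l rho <= (Ncard k)%:R * (4 * rho * (Ncard l)%:R + 3 * C3 * (2 ^+ l * u ^+ l)).
Proof.
move=> kl r0; rewrite -[(Ncard k)%:R]/((Ncard k)%:R : R) -size_Alist.
apply: (@le_trans _ _ (\sum_(m <- Alist k) (4 * rho * (Ncard l)%:R + 3 * C3 * (2 ^+ l * u ^+ l)))).
  by apply: ler_sum => m _; exact: near_count.
rewrite big_const_seq count_predT iter_addr_0 [X in _ <= X]mulr_natl; exact: lexx.
Qed.

Definition shiftset h : set nat := [set m | A m /\ A (m + h)%N].

(** A close pair of different elements is of the form m, m + h with h in a Bohr
    set; either of the two may be the larger one when k = l, whence the factor 2. *)
Lemma pairs_near k l rho : (k <= l)%N -> 0 <= rho ->
  pairs k l rho <= (k == l)%:R * (Ncard k)%:R +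
    2 * \sum_(h <- bohr alpha 1 (2 ^ l.+1) rho) (cnt (shiftset h) (2 ^ k) (2 ^ k.+1))%:R.
Proof.
move=> kl r0.
pose bs := bohr alpha 1 (2 ^ l.+1) rho.
have pt m n : m \in Alist k -> n \in Alist l ->
   (dist_int (n%:R * alpha - m%:R * alpha) <= rho)%R%:R <=
   (m == n)%:R + (\sum_(h <- bs) (n == m + h)%N%:R + \sum_(h <- bs) (m == n + h)%N%:R) :> R.
  move=> /mem_Alist[_ m1 m2] /mem_Alist[_ n1 n2].
  have s0 a b : 0 <= \sum_(h <- bs) (a == b + h)%N%:R :> R by exact: sumr_ge0.
  have s1 a b : (a < 2 ^ l.+1)%N -> (b < a)%N -> dist_int (a%:R * alpha - b%:R * alpha) <= rho ->
      1 <= \sum_(h <- bs) (a == b + h)%N%:R :> R.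
    move=> al ba hd.
    have hb : (a - b)%N \in bs.
      rewrite mem_filter mem_index_iota dvd1n/= natrB ?(ltnW ba)// mulrBl hd/= subn_gt0 ba/=.
      by rewrite ltnS (leq_trans (leq_subr _ _))// ltnW.
    rewrite (big_rem _ hb)/= subnKC ?(ltnW ba)// eqxx lerDl.
    exact: sumr_ge0.
  case: (boolP (dist_int _ <= rho)) => [hd|_]; last by rewrite !addr_ge0.
  have [mn|nm|->] := ltngtP m n.
  - by rewrite add0r; apply: le_trans (s1 _ _ n2 mn hd) _; rewrite lerDl.
  - rewrite add0r; apply: le_trans (s1 m n _ nm _) _; last by rewrite lerDr.
      by apply: leq_trans m2 _; rewrite leq_exp2l.
    by rewrite -opprB dist_intN.
  - by rewrite lerDl addr_ge0.
have -> : pairs k l rho = \sum_(m <- Alist k) \sum_(n <- Alist l | true) (dist_int (n%:R * alpha - m%:R * alpha) <= rho)%R%:R by [].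
apply: (@le_trans _ _ (\sum_(m <- Alist k) \sum_(n <- Alist l)
  ((m == n)%:R + (\sum_(h <- bs) (n == m + h)%N%:R + \sum_(h <- bs) (m == n + h)%N%:R)))).
  rewrite big_seq [X in _ <= X]big_seq; apply: ler_sum => m hm.
  rewrite big_seq [X in _ <= X]big_seq; apply: ler_sum => n hn; exact: pt.
have uniq_le (s : seq nat) (a : nat) : uniq s -> \sum_(n <- s) (n == a)%:R <= (a \in s)%:R :> R.
  move=> us; have [as_|as_] := boolP (a \in s).
    rewrite (big_rem _ as_)/= eqxx big_seq big1 ?addr0// => n.
    by rewrite mem_rem_uniq// inE => /andP[/negbTE -> _].
  by rewrite big_seq big1// => n ns; case: eqP => // e; rewrite -e ns in as_.
under eq_bigr do rewrite big_split/=.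
rewrite big_split/=; apply: lerD.
  have [<-|ne] := eqVneq k l.
    rewrite mul1r -size_Alist.
    apply: (@le_trans _ _ (\sum_(m <- Alist k) 1)); last by rewrite big_const_seq count_predT iter_addr_0.
    apply: ler_sum => m _; apply: le_trans (_ : \sum_(n <- Alist k) (n == m)%:R <= 1).
      by under eq_bigr do rewrite eq_sym.
    by apply: le_trans (uniq_le _ _ (uniq_Alist k)) _; case: (_ \in _).
  rewrite mul0r big_seq big1// => m /mem_Alist[_ _ m2].
  rewrite big_seq big1// => n /mem_Alist[_ n1 _].
  case: eqP => // e; move: n1; rewrite -e leqNgt (leq_trans m2)// leq_exp2l//.
  by rewrite ltn_neqAle ne.
under eq_bigr do rewrite big_split/=.
rewrite big_split/= mulrDl mul1r; apply: lerD.
- under eq_bigr do rewrite exchange_big/=.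
  rewrite exchange_big/=; apply: ler_sum => h _.
  rewrite /cnt natr_sum.
  have -> : \sum_(2 ^ k <= i < 2 ^ k.+1 | i \in shiftset h) 1%:R = \sum_(m <- Alist k) ((m + h)%N \in A)%:R :> R.
    rewrite /Alist big_filter big_mkcond [RHS]big_mkcond; apply: eq_bigr => m _.
    have -> : (m \in shiftset h) = (m \in A) && ((m + h)%N \in A) by apply/idP/andP; rewrite !inE.
    by case: (m \in A) => //=; case: (_ \in A).
  apply: ler_sum => m _; apply: le_trans (uniq_le _ (m + h)%N (uniq_Alist l)) _.
  rewrite mem_filter; by case: (_ \in A); case: (_ \in _).
- under eq_bigr do rewrite exchange_big/=.
  rewrite exchange_big/=; apply: ler_sum => h _; rewrite exchange_big/=.
  have [<-|ne] := eqVneq k l.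
    rewrite /cnt natr_sum.
    have -> : \sum_(2 ^ k <= i < 2 ^ k.+1 | i \in shiftset h) 1%:R = \sum_(m <- Alist k) ((m + h)%N \in A)%:R :> R.
      rewrite /Alist big_filter big_mkcond [RHS]big_mkcond; apply: eq_bigr => m _.
      have -> : (m \in shiftset h) = (m \in A) && ((m + h)%N \in A) by apply/idP/andP; rewrite !inE.
      by case: (m \in A) => //=; case: (_ \in A).
    apply: ler_sum => m _; apply: le_trans (uniq_le _ (m + h)%N (uniq_Alist k)) _.
    rewrite mem_filter; by case: (_ \in A); case: (_ \in _).
  rewrite big_seq big1// => n /mem_Alist[_ n1 _].
  rewrite big_seq big1// => m /mem_Alist[_ _ m2].
  case: eqP => // e; move: m2; rewrite e ltnNge (leq_trans _ (leq_addr h n))//.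
  by apply: leq_trans n1; rewrite leq_exp2l// ltn_neqAle ne.
Qed.

(** Primes below 2^(2^I) are at most 2^(k / M), small enough for Hsieve; M >= 48
    makes the error 2^(24 2^I) of the sieve at most 2^(k / 2). *)
Definition Isieve k := trunc_log 2 (k %/ M).

(** Sieve up to 2^(2^I), 2^I being comparable to k. The Euler product there is
    comparable to the one at 2^k by its slow variation, and the sieve error is
    absorbed because the latter is at least of order 1 / k. *)
Lemma shift_count : exists2 Cs : R, 0 < Cs & exists k2, forall k h, (k2 <= k)%N -> (0 < h)%N ->
  (cnt (shiftset h) (2 ^ k) (2 ^ k.+1))%:R <=
    Cs * (sdens k * Edens k * sing P h (2 ^ (2 ^ Isieve k))).
Proof.
have v01 : 0 < (Num.sqrt (2^-1) : R) < 1.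
  rewrite sqrtr_gt0 invr_gt0 ltr0n/= -[X in _ < X]sqrtr1 ltr_sqrt//; lra.
have [Cp Cp0 hCp] := poly_exp_bound 2 v01.
pose c7 : R := (2 * expR 7)^-1.
have c70 : 0 < c7 by rewrite invr_gt0 mulr_gt0// expR_gt0.
pose Cr : R := expR (4 * (2 * M)%:R).
exists (18 * expR (expR 16) * Cr ^+ 2 + Cp / c7 ^+ 2).
  by rewrite addr_gt0// ?divr_gt0 ?exprn_gt0// mulr_gt0// ?exprn_gt0 ?expR_gt0// mulr_gt0// expR_gt0.
exists (maxn k1 (2 * M)) => k h; rewrite geq_max => /andP[kk kM] h0.
have M0 : (0 < M)%N by apply: leq_trans M48.
set I := Isieve k.
have kM2 : (2 <= k %/ M)%N by rewrite leq_divRL// mulnC.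
have I0 : (0 < I)%N by rewrite /I /Isieve trunc_log_gt0.
have hI : (2 ^ I <= k %/ M)%N by apply: trunc_logP => //; apply: leq_trans kM2.
have hI2 : (k %/ M < 2 ^ I.+1)%N by apply: trunc_log_ltn.
have MI : (M * 2 ^ I <= k)%N by rewrite mulnC -leq_divRL.
have kI : (k <= (2 * M) * 2 ^ I)%N.
  rewrite -mulnA mulnCA [(2 * _)%N]mulnC -expnSr; rewrite mulnC.
  by rewrite ltn_divLR// in hI2; exact: ltnW.
have k0 : (0 < k)%N by apply: leq_trans kM; rewrite muln_gt0.
have hS m : shiftset h m /\ (2 ^ k <= m)%N -> forall p, P p -> (p < 2 ^ (2 ^ I))%N ->
      ~~ (p %| m)%N && ~~ (p %| m + h)%N.
  move=> [[Am Amh] km] p Pp pI; apply/andP; split.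
    exact: (@Hsieve I k m p).
  by apply: (@Hsieve I k (m + h) p) => //; apply: leq_trans km (leq_addr _ _).
have := @sieve_pairs R P PP h [set m | shiftset h m /\ (2 ^ k <= m)%N] (2 ^ k) (2 ^ k) I I0 hS.
rewrite addnn -mul2n -expnS.
have -> : cnt [set m | shiftset h m /\ (2 ^ k <= m)%N] (2 ^ k) (2 ^ k.+1) = cnt (shiftset h) (2 ^ k) (2 ^ k.+1).
  rewrite /cnt big_nat_cond [RHS]big_nat_cond; apply: eq_bigl => m.
  apply: andb_id2l => /andP[km _]; apply/idP/idP; rewrite !inE; first by case.
  by move=> Sm; split.
move=> h1; apply: le_trans h1 _.
set sg := sing _ _ _.
have sg1 : 1 <= sg.
  apply: (big_ind (fun x : R => 1 <= x)) => // [x y hx hy|p _]; first by rewrite mulr_ege1.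
  by rewrite lerDl invr_ge0.
have e1 : eul P (2 ^ (2 ^ I)) <= Cr * Edens k.
  apply: (@Edens_ratio (2 ^ I) k (2 * M)) => //; first by rewrite expn_gt0.
  by apply: leq_trans MI; rewrite leq_pmull.
have E0 := Edens_gt0 k.
have E20 := @eul_gt0 R P PP (2 ^ (2 ^ I)).
have sg0 : 0 <= sg by apply: le_trans sg1.
rewrite [X in _ <= X]mulrDl; apply: lerD.
  have e2 : eul P (2 ^ (2 ^ I)) ^+ 2 <= (Cr * Edens k) ^+ 2 :> R.
    by rewrite lerXn2r// nnegrE ?ltW// mulr_gt0// expR_gt0.
  have -> : 18 * expR (expR 16) * Cr ^+ 2 * (sdens k * Edens k * sg) =
     18 * expR (expR 16) * (2 ^ k)%:R * ((Cr * Edens k) ^+ 2 * sg).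
    by rewrite /sdens natrX; ring.
  rewrite ler_wpM2l ?ler_wpM2r// mulr_ge0// mulr_ge0// expR_ge0.
have -> : Cp / c7 ^+ 2 * (sdens k * Edens k * sg) = (Cp / c7 ^+ 2 * (2 ^+ k * Edens k ^+ 2)) * sg.
  by rewrite /sdens; ring.
rewrite -[X in X <= _]mulr1; apply: ler_pM => //.
have e3 := @eul_ge R P PP k k0; rewrite -/(Edens k) -/c7 in e3.
have kr : (0 : R) < k%:R by rewrite ltr0n.
apply: (@le_trans _ _ (Cp / c7 ^+ 2 * (2 ^+ k * (c7 / k%:R) ^+ 2))); last first.
  rewrite ler_wpM2l ?divr_ge0 ?exprn_ge0 ?(ltW Cp0) ?(ltW c70)// ler_wpM2l ?exprn_ge0//.
  by rewrite lerXn2r// nnegrE ?(ltW E0)// divr_ge0// ltW.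
have -> : Cp / c7 ^+ 2 * (2 ^+ k * (c7 / k%:R) ^+ 2) = Cp * 2 ^+ k / k%:R ^+ 2.
  by field; rewrite !lt0r_neq0.
rewrite ler_pdivlMr ?exprn_gt0//.
have h24 : (2 ^ (24 * 2 ^ I))%:R <= 2 ^+ k * Num.sqrt 2^-1 ^+ k :> R.
  have -> : 2 ^+ k * Num.sqrt 2^-1 ^+ k = Num.sqrt 2 ^+ k :> R.
    rewrite -exprMn; congr (_ ^+ _).
    by rewrite -{1}(@sqr_sqrtr _ 2)// expr2 -mulrA -sqrtrM// divff// sqrtr1 mulr1.
  have -> : (2 ^ (24 * 2 ^ I))%:R = Num.sqrt 2 ^+ (48 * 2 ^ I) :> R.
    by rewrite natrX -{1}(@sqr_sqrtr _ 2)// -exprM mulnA.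
  rewrite ler_weXn2l//; first by rewrite -[X in X <= _]sqrtr1 ler_sqrt//; lra.
  by apply: leq_trans MI; rewrite leq_mul2r M48 orbT.
apply: le_trans (ler_wpM2r _ h24) _; first by rewrite exprn_ge0.
have := hCp k; have : (0 : R) <= 2 ^+ k by rewrite exprn_ge0.
move: (2 ^+ k) (Num.sqrt _ ^+ k) (k%:R ^+ 2) => x y z x0 hz.
have := ler_wpM2l x0 hz; lra.
Qed.

(** The expected number of hits per point by the elements of a block, up to
    constants. *)
Definition adens (r : nat -> R) k : R := sdens k * r k.

(** The lower bound on [adens] keeps r k from being much smaller than 2^-k: the
    discrepancy estimate resolves such radii in blocks l >= K k. *)
Definition admissible (k2 : nat) (r : nat -> R) (sel : pred nat) : Prop :=
  [/\ forall k, sel k -> (k2 <= k)%N,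
      forall k, sel k -> 0 < r k,
      forall k, sel k -> adens r k <= 1,
      forall k, sel k -> 1 <= k%:R ^+ 2 * adens r k &
      forall k l, sel k -> (k <= l)%N -> r l <= r k].

(** For l >= K k the discrepancy 2^l u^l of block l is dominated by the main
    term r_k s_l, as r_k is at least of order 2^-k / k^2. *)
Lemma far_bound : exists K, (0 < K)%N /\ exists2 C : R, 0 < C & forall k2 r sel,
  admissible (maxn k1 (maxn 1 k2)) r sel -> forall k l, sel k -> sel l -> (K * k <= l)%N ->
  (k <= l)%N -> r l * pairs k l (2 * r k) <= C * (adens r k * adens r l).
Proof.
pose v := Num.sqrt u.
have v01 : 0 < v < 1.
  have /andP[u0 u1] := u01.
  by rewrite sqrtr_gt0 u0 /= -[X in _ < X]sqrtr1 ltr_sqrt.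
have /andP[v0 v1] := v01.
have v2 : v ^+ 2 = u by rewrite sqr_sqrtr//; have /andP[/ltW] := u01.
have half0 : (0 : R) < 2^-1 by rewrite invr_gt0.
have [K0 hK0] := poly_exp_small 0 v01 half0.
have [Cp Cp0 hCp] := poly_exp_bound 3 v01.
pose c7 : R := (2 * expR 7)^-1.
have c70 : 0 < c7 by rewrite invr_gt0 mulr_gt0// expR_gt0.
exists K0.+1; split=> //.
exists (C1 * (8 * C1 + 3 * C3 * (Cp / c7))).
  by pos.
move=> k2 r sel [h1 h2 h3 h4 h5] k l sk sl Kkl kl.
have := h1 _ sk; rewrite !geq_max => /and3P[kk k0 _].
have ll := leq_trans kk kl; have l0 := leq_trans k0 kl.
have rk0 := h2 _ sk; have rl0 := h2 _ sl.
have kr : (0 : R) < k%:R by rewrite ltr0n.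
have lr : (0 : R) < l%:R by rewrite ltr0n.
have tail : 2 ^+ l * u ^+ l <= Cp / c7 * (r k * sdens l).
  have e1 : 2 ^+ k * v ^+ l <= 1.
    have : v ^+ l <= 2^-1 ^+ k.
      apply: (@le_trans _ _ (v ^+ (K0.+1 * k))).
        by rewrite ler_wiXn2l// ltW.
      rewrite exprM lerXn2r// ?nnegrE ?exprn_ge0 ?(ltW v0)//.
      by have := hK0 K0.+1 (leqnSn _); rewrite expr0 mul1r.
    move=> h; apply: le_trans (ler_wpM2l _ h) _; first by rewrite exprn_ge0.
    by rewrite -exprMn divff// expr1n.
  have e2 : l%:R ^+ 3 * v ^+ l <= Cp by exact: hCp.
  have e3 : c7 / l%:R * 2 ^+ l <= sdens l by exact: sdens_ge.
  have e4 : 1 <= k%:R ^+ 2 * (2 ^+ k * r k).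
    apply: le_trans (h4 _ sk) _; rewrite ler_wpM2l ?exprn_ge0// ler_pM2r//.
    by rewrite /sdens ler_piMr ?exprn_ge0// Edens_le1.
  have e5 : k%:R ^+ 2 <= l%:R ^+ 2 :> R by rewrite lerXn2r// ?nnegrE// ler_nat.
  (* With v^2 = u, one factor v^l absorbs the powers of l, the other 2^k. *)
  have e6 : 1 <= l%:R ^+ 2 * (2 ^+ k * r k).
    by apply: le_trans e4 _; rewrite ler_wpM2r//; pos.
  rewrite -v2 -exprM mulnC exprM expr2.
  have vl0 : 0 <= v ^+ l by rewrite exprn_ge0// ltW.
  have T0 : (0 : R) <= 2 ^+ l by rewrite exprn_ge0.
  have Tk0 : (0 : R) < 2 ^+ k by rewrite exprn_gt0.
  move: e1 e2 e3 e6 vl0 T0 Tk0; move: (v ^+ l) (2 ^+ l) (2 ^+ k) (sdens l) => y T Tk S e1 e2 e3 e6 y0 T0 Tk0.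
  have f1 : y <= l%:R ^+ 2 * r k.
    have : y * 1 <= y * (l%:R ^+ 2 * (Tk * r k)) by rewrite ler_wpM2l.
    have : (Tk * y) * (l%:R ^+ 2 * r k) <= 1 * (l%:R ^+ 2 * r k).
      by rewrite ler_wpM2r// mulr_ge0 ?exprn_ge0// ltW.
    lra.
  have f2 : T * (l%:R ^+ 3 * y) <= T * Cp by rewrite ler_wpM2l.
  have f3 : T <= S * l%:R / c7.
    by rewrite ler_pdivlMr// -ler_pdivrMr//; move: e3; lra.
  have f4 : T * (y * y) * l%:R <= T * Cp * r k.
    have : T * y * (y * l%:R) <= T * y * (l%:R ^+ 3 * r k).
      rewrite ler_wpM2l ?mulr_ge0//.
      apply: le_trans (ler_wpM2r (ltW lr) f1) _.
      by rewrite le_eqVlt; apply/orP; left; apply/eqP; ring.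
    have := ler_wpM2r (ltW rk0) f2; lra.
  rewrite -(ler_pM2r lr); apply: le_trans f4 _.
  have := ler_wpM2r (mulr_ge0 (ltW Cp0) (ltW rk0)) f3; lra.
have s0k := sdens_gt0 k; have s0l := sdens_gt0 l.
have h2r : 0 < 2 * r k by rewrite mulr_gt0.
apply: le_trans (ler_wpM2l (ltW rl0) (pairs_far k ll h2r)) _.
have f1 : 4 * (2 * r k) * (Ncard l)%:R <= 8 * C1 * (r k * sdens l).
  have := ler_wpM2l (ltW rk0) (Hupp ll); lra.
have f2 : 3 * C3 * (2 ^+ l * u ^+ l) <= 3 * C3 * (Cp / c7) * (r k * sdens l).
  have := ler_wpM2l (mulr_ge0 (ler0n R 3) (ltW C30)) tail; lra.
have f3 := ler_pM (ler0n R (Ncard k)) (_ : 0 <= _) (Hupp kk) (lerD f1 f2).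
apply: le_trans (ler_wpM2l (ltW rl0) (f3 _)) _.
  have /andP[u0 _] := u01.
  rewrite addr_ge0// mulr_ge0//; first by rewrite mulr_ge0// ltW.
  - by rewrite mulr_ge0// ltW.
  - by rewrite mulr_ge0 ?exprn_ge0// ltW.
by rewrite /adens le_eqVlt; apply/orP; left; apply/eqP; ring.
Qed.

Definition Vk (K k : nat) : R := mert (K * k + 2).

(** For k <= l <= K k combine sieve and Bohr set. Put S^2 = 2 r_k 2^l, the
    expected size of the Bohr set up to constants. If S exceeds the logarithmic
    loss V the bound is the desired a_k a_l; otherwise the square root term
    dominates and S <= q S^2, which holds because the Bohr set is empty unless
    S^2 is bounded below, gives the last summand. *)
Lemma near_bound (K : nat) : (0 < K)%N -> exists k2, exists2 C : R, 0 < C & forall r sel,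
  admissible (maxn k1 (maxn 1 k2)) r sel -> forall k l, sel k -> sel l -> (l <= K * k)%N ->
  (k <= l)%N -> r l * pairs k l (2 * r k) <=
   C * ((k == l)%:R * adens r k + adens r k * adens r l +
     adens r k * (if 2 * r k * 2 ^+ l < Vk K k ^+ 2 then Edens k * Vk K k * (2 * r k * 2 ^+ l) else 0)).
Proof.
move=> K0; have [Cs Cs0 [k2 hk2]] := shift_count.
pose Ce : R := expR (4 * K%:R).
have Ce0 : 0 < Ce by exact: expR_gt0.
pose Cb := expR 1 * bohr_cst c0 * 2 * expR 2.
have sc0 : 0 < Num.sqrt c0 by rewrite sqrtr_gt0.
have bc0 : 0 < bohr_cst c0 by rewrite mulr_gt0// addr_gt0// invr_gt0.
have Cb0 : 0 < Cb by rewrite !mulr_gt0 ?expR_gt0.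
pose q := 2 / Num.sqrt c0.
have q0 : 0 < q by rewrite divr_gt0.
pose CC := 2 * (Cs * Cb).
have CC0 : 0 < CC by rewrite mulr_gt0// mulr_gt0.
exists (k2), (C1 + CC * (4 * Ce) + CC * q).
  by rewrite !addr_gt0// mulr_gt0// mulr_gt0.
move=> r sel [h1 h2 h3 h4 h5] k l sk sl lK kl.
have := h1 _ sk; rewrite !geq_max => /and3P[kk k0 kk2].
have rk0 := h2 _ sk; have rl0 := h2 _ sl.
have s0k := sdens_gt0 k; have s0l := sdens_gt0 l.
have E0k := Edens_gt0 k; have E0l := Edens_gt0 l.
have a0k : 0 < adens r k by rewrite mulr_gt0.
have a0l : 0 < adens r l by rewrite mulr_gt0.
have h2r : 0 < 2 * r k by rewrite mulr_gt0.
have rlk : r l <= r k by apply: h5.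
set V := Vk K k.
have V1 : 1 <= V by exact: mert_ge1.
set S2 := 2 * r k * 2 ^+ l.
have S20 : 0 < S2 by rewrite mulr_gt0// exprn_gt0.
apply: le_trans (ler_wpM2l (ltW rl0) (pairs_near kl (ltW h2r))) _.
set third := adens r k * (if _ then _ else _).
have third0 : 0 <= third.
  rewrite mulr_ge0 ?(ltW a0k)//; case: ifP => _ //.
  by rewrite mulr_ge0 ?(ltW S20)// mulr_ge0 ?(ltW E0k)// (le_trans ler01).
rewrite mulrDr.
have diag : r l * ((k == l)%:R * (Ncard k)%:R) <= C1 * ((k == l)%:R * adens r k).
  have [<-|_] := eqVneq k l; last by rewrite !mul0r !mulr0.
  rewrite !mul1r /adens; have := ler_wpM2l (ltW rk0) (Hupp kk); lra.
set Sum := \sum_(h <- _) _.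
have hSum : r l * (2 * Sum) <= CC * (4 * Ce * (adens r k * adens r l) + q * third).
  have [b0|bn] := posnP (size (bohr alpha 1 (2 ^ l.+1) (2 * r k))).
    have -> : Sum = 0 by rewrite /Sum (size0nil b0) big_nil.
    by rewrite !mulr0; pos.
  have c0S : c0 <= 2 * S2.
    move: bn; rewrite -has_predT => /hasP[h /mem_bohr[h0 hH _ hd] _].
    apply: le_trans (bad h0) _.
    apply: (@le_trans _ _ ((2 ^ l.+1)%:R * (2 * r k))).
      by apply: ler_pM => //; [exact: dist_int_ge0|rewrite ler_nat].
    by rewrite natrX exprS /S2; lra.
  set S := Num.sqrt S2.
  have SS : S ^+ 2 = S2 by rewrite sqr_sqrtr// ltW.
  have S0 : 0 < S by rewrite sqrtr_gt0.
  have Sq : S <= q * S2.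
    have e1 : Num.sqrt c0 <= 2 * S.
      rewrite -(@ler_pXn2r _ 2) ?nnegrE ?sqrtr_ge0 ?mulr_ge0 ?(ltW S0)//.
      rewrite sqr_sqrtr ?(ltW c00)// exprMn SS; lra.
    have -> : q * S2 = (2 * S) / Num.sqrt c0 * S by rewrite /q -SS; ring.
    by rewrite ler_peMl ?(ltW S0)// ler_pdivlMr// mul1r.
  have hsum : Sum <= Cs * Cb * (sdens k * Edens k * (S2 + S * V)).
    apply: (@le_trans _ _ (\sum_(h <- bohr alpha 1 (2 ^ l.+1) (2 * r k))
        Cs * (sdens k * Edens k) * sing P h (2 ^ (2 ^ Isieve k)))).
      rewrite /Sum big_seq [X in _ <= X]big_seq; apply: ler_sum => h /mem_bohr[h0 _ _ _].
      by apply: le_trans (hk2 _ _ kk2 h0) _; rewrite !mulrA.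
    rewrite -big_distrr/=.
    have bs := @bohr_sing R alpha c0 c00 bad P (2 ^ l.+1) l.+2 (2 ^ (2 ^ Isieve k)) (2 * r k) PP h2r (ltn0Sn _).
    have lt2 : (2 ^ l.+1 < 2 ^ l.+2)%N by rewrite ltn_exp2l.
    have {}bs := bs lt2.
    apply: (le_trans (ler_wpM2l _ bs)); first by rewrite mulr_ge0 ?mulr_ge0// ltW.
    have e2 : 2 * r k * (2 ^ l.+1)%:R = 2 * S2 by rewrite natrX exprS /S2; ring.
    rewrite e2.
    have e3 : Num.sqrt (2 * S2) <= 2 * S.
      rewrite -(@ler_pXn2r _ 2) ?nnegrE ?sqrtr_ge0 ?mulr_ge0 ?(ltW S0)//.
      have d2S : 0 <= 2 * S2 by pos.
      by rewrite sqr_sqrtr// exprMn SS; have := S20; lra.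
    have e4 : mert l.+2 <= V.
      by apply: mert_homo; rewrite addn2 !ltnS.
    have e5 : expR 2 * (2 * S2) + Num.sqrt (2 * S2) * mert l.+2 <= 2 * expR 2 * (S2 + S * V).
      have m0 : 0 <= mert l.+2 :> R by rewrite (le_trans ler01)// mert_ge1.
      have := ler_pM (sqrtr_ge0 _) m0 e3 e4.
      have x1 : 1 <= expR 2 :> R by rewrite -expR0 ler_expR.
      have SV : 0 <= S * V by rewrite mulr_ge0 ?(ltW S0)// (le_trans ler01).
      have := ler_wpM2r SV x1; lra.
    rewrite /Cb; have pre : 0 <= Cs * (sdens k * Edens k) * (expR 1 * bohr_cst c0).
      by rewrite mulr_ge0 ?mulr_ge0 ?expR_ge0 ?(ltW bc0) ?(ltW Cs0) ?(ltW s0k) ?(ltW E0k).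
    have := ler_wpM2l pre e5; lra.
  have Ekl : Edens k <= Ce * Edens l by exact: Edens_ratio.
  have m1 : r l * (sdens k * Edens k * S2) <= 2 * Ce * (adens r k * adens r l).
    have -> : r l * (sdens k * Edens k * S2) = (r l * (sdens k * S2)) * Edens k by ring.
    apply: le_trans (ler_wpM2l _ Ekl) _.
      by rewrite mulr_ge0 ?(ltW rl0)// mulr_ge0 ?(ltW s0k)// ltW.
    by rewrite /adens /S2 /sdens le_eqVlt; apply/orP; left; apply/eqP; ring.
  have m2 : r l * (sdens k * Edens k * (S * V)) <= 2 * Ce * (adens r k * adens r l) + q * third.
    have [VS|SV] := leP V S.
      apply: (@le_trans _ _ (r l * (sdens k * Edens k * S2))).
        rewrite ler_wpM2l ?(ltW rl0)// ler_wpM2l ?mulr_ge0 ?(ltW s0k) ?(ltW E0k)//.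
        by rewrite -SS expr2 ler_wpM2l// ltW.
      by apply: le_trans m1 _; rewrite lerDl mulr_ge0// ltW.
    have cond : S2 < V ^+ 2.
      by rewrite -SS ltrXn2r ?nnegrE// ?(ltW S0)// (le_trans ler01).
    apply: (@le_trans _ _ (q * third)); last first.
      by rewrite lerDr mulr_ge0 ?mulr_ge0// ltW.
    rewrite /third -/S2 cond.
    have -> : q * (adens r k * (Edens k * V * S2)) = r k * (sdens k * (Edens k * (q * S2 * V))).
      by rewrite /adens; ring.
    have -> : r l * (sdens k * Edens k * (S * V)) = r l * (sdens k * (Edens k * (S * V))) by ring.
    have V0 : 0 <= V by exact: le_trans V1.
    apply: ler_pM => //; first exact: ltW.
      by rewrite !mulr_ge0// ltW.
    by rewrite ler_wpM2l ?(ltW s0k)// ler_wpM2l ?(ltW E0k)// ler_wpM2r.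
  have := ler_wpM2l (ltW rl0) hsum.
  rewrite /CC; have CsCb : 0 <= 2 * (Cs * Cb) by rewrite mulr_ge0// mulr_ge0// ltW.
  have := ler_wpM2l CsCb (lerD m1 m2); lra.
have aa : 0 <= adens r k * adens r l by rewrite mulr_ge0// ltW.
have kl0 : 0 <= (k == l)%:R * adens r k by rewrite mulr_ge0// ltW.
have := mulr_ge0 (ltW CC0) (mulr_ge0 (ltW Ce0) kl0).
have := mulr_ge0 (ltW CC0) (mulr_ge0 (ltW Ce0) third0).
have := mulr_ge0 (ltW CC0) (mulr_ge0 (ltW q0) kl0).
have := mulr_ge0 (ltW CC0) (mulr_ge0 (ltW q0) aa).
have := mulr_ge0 (ltW C10) aa.
have := mulr_ge0 (ltW C10) third0.
have := lerD diag hSum; lra.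
Qed.

Lemma geometric_below (x y : R) (N : nat) : 0 < x -> 0 <= y ->
  \sum_(0 <= l < N) (if x * 2 ^+ l < y then x * 2 ^+ l else 0) <= 2 * y.
Proof.
move=> x0 y0.
have geo n : \sum_(0 <= l < n) (if x * 2 ^+ l < y then x * 2 ^+ l else 0) <= x * 2 ^+ n.
  elim: n => [|n IH]; first by rewrite big_geq// mulr_ge0// ltW.
  rewrite big_nat_recr//= exprS.
  have h : 0 <= x * 2 ^+ n by pos.
  by case: ifP => _; lra.
elim: N => [|N IH]; first by rewrite big_geq// mulr_ge0.
rewrite big_nat_recr//=; case: ifP => h; last by rewrite addr0.
by have := geo N; lra.
Qed.

(** This is where the factor (log x)^-delta of the density condition enters: it
    beats any power of the product V of order log k. *)
Lemma EV_bound K : (0 < K)%N -> exists2 C : R, 0 < C &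
  forall k, (k1 <= k)%N -> (0 < k)%N -> Edens k * Vk K k ^+ 3 <= C.
Proof.
move=> K0; have d3 : 0 < delta / 3 by pos.
have [C C0 hC] := mert_power K d3.
exists (C ^+ 3 * C1); first by pos.
move=> k kk k0; have := hC k k0; rewrite -/(Vk K k) => hV.
have V0 : 0 <= Vk K k by rewrite (le_trans ler01)// mert_ge1.
have p0 : 0 <= k%:R `^ (delta / 3) by exact: powR_ge0.
have h3 : Vk K k ^+ 3 <= C ^+ 3 * k%:R `^ delta.
  have -> : C ^+ 3 * k%:R `^ delta = (C * k%:R `^ (delta / 3)) ^+ 3.
    rewrite exprMn; congr (_ * _).
    by rewrite -powR_mulrn// -powRrM divfK.
  by rewrite lerXn2r// nnegrE mulr_ge0// ltW.
have E0 := Edens_gt0 k.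
apply: le_trans (ler_wpM2l (ltW E0) h3) _.
rewrite mulrCA ler_wpM2l//; first by pos.
exact: Hdel.
Qed.

Definition ssum (r : nat -> R) (sel : pred nat) N : R := \sum_(0 <= k < N | sel k) adens r k.

(** For given k the last term of [near_bound] is summed over l geometrically,
    up to S^2 = V^2; this leaves E_k V^3 a_k = O(a_k). *)
Lemma pairs_total : exists k2, exists2 C : R, 0 < C & forall r sel,
  admissible (maxn k1 (maxn 1 k2)) r sel -> forall N,
  \sum_(0 <= k < N | sel k) \sum_(0 <= l < N | sel l && (k <= l)%N) r l * pairs k l (2 * r k) <=
   C * (ssum r sel N + ssum r sel N ^+ 2).
Proof.
have [K [K0 [Cf Cf0 hfar]]] := far_bound.
have [k2 [Cn Cn0 hnear]] := near_bound K0.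
have [Ce Ce0 hE] := EV_bound K0.
exists k2, (Cf + Cn + Cn * (2 * Ce)); first by pos.
move=> r sel adm N; have [h1 h2 h3 h4 h5] := adm.
pose a := adens r.
have a0 k : sel k -> 0 <= a k.
  by move=> sk; rewrite /a /adens mulr_ge0// ltW ?h2// sdens_gt0.
pose g k l := if 2 * r k * 2 ^+ l < Vk K k ^+ 2 then 2 * r k * 2 ^+ l else 0.
have term k l : sel k -> sel l -> (k <= l)%N ->
    r l * pairs k l (2 * r k) <= (Cf + Cn) * (a k * a l) + Cn * ((k == l)%:R * a k)
      + Cn * (a k * (Edens k * Vk K k * g k l)).
  move=> sk sl kl; have rk := h2 _ sk.
  have V0 : 0 <= Vk K k by rewrite (le_trans ler01)// mert_ge1.
  have E0 := Edens_gt0 k.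
  have g0 : 0 <= g k l by rewrite /g; case: ifP => _ //; pos.
  have ak := a0 _ sk; have al := a0 _ sl.
  have t1 : 0 <= Cn * (a k * a l) by pos.
  have t2 : 0 <= Cn * ((k == l)%:R * a k) by pos.
  have t3 : 0 <= Cn * (a k * (Edens k * Vk K k * g k l)) by pos.
  have t4 : 0 <= Cf * (a k * a l) by pos.
  have [lK|lK] := leqP (K * k) l.
    by have := hfar k2 r sel adm k l sk sl lK kl; rewrite -/(a k) -/(a l); lra.
  have := hnear r sel adm k l sk sl (ltnW lK) kl; rewrite -/(a k) -/(a l).
  have -> : (if 2 * r k * 2 ^+ l < Vk K k ^+ 2 then Edens k * Vk K k * (2 * r k * 2 ^+ l) else 0)
     = Edens k * Vk K k * g k l by rewrite /g; case: ifP => _; rewrite ?mulr0.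
  lra.
set S := ssum r sel N.
have S0 : 0 <= S by apply: sumr_ge0 => k /a0.
have row k : sel k -> \sum_(0 <= l < N | sel l && (k <= l)%N) r l * pairs k l (2 * r k) <=
   a k * ((Cf + Cn) * S + Cn + Cn * (2 * Ce)).
  move=> sk; have ak := a0 _ sk; have rk := h2 _ sk.
  have := h1 _ sk; rewrite !geq_max => /and3P[kk k0 _].
  have V0 : 0 <= Vk K k by rewrite (le_trans ler01)// mert_ge1.
  have E0 := Edens_gt0 k.
  apply: (@le_trans _ _ (\sum_(0 <= l < N | sel l) ((Cf + Cn) * (a k * a l) + Cn * ((k == l)%:R * a k)
      + Cn * (a k * (Edens k * Vk K k * g k l))))).
    rewrite big_mkcondr; apply: ler_sum => l sl.
    have al := a0 _ sl.
    have g0 : 0 <= g k l by rewrite /g; case: ifP => _ //; pos.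
    by case: ifP => kl; [exact: term|pos].
  rewrite !big_split/= -!big_distrr/= -/S.
  have b2 : \sum_(0 <= l < N | sel l) (k == l)%:R * a k <= a k.
    rewrite -big_distrl/= ler_piMl// big_mkcond/=.
    apply: (@le_trans _ _ (\sum_(0 <= l < N) (l == k)%:R)).
      by apply: ler_sum => l _; rewrite eq_sym; case: ifP.
    have [kN|kN] := ltnP k N.
      rewrite (bigD1_seq k) ?mem_index_iota ?iota_uniq//= eqxx big1 ?addr0// => l /negbTE -> //.
    rewrite big_nat big1// => l /andP[_ lN]; case: eqP => // e.
    by rewrite e ltnNge kN in lN.
  have b3 : \sum_(0 <= l < N | sel l) g k l <= 2 * Vk K k ^+ 2.
    apply: le_trans (geometric_below N (_ : 0 < 2 * r k) (_ : 0 <= Vk K k ^+ 2)); [|by pos|by pos].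
    rewrite big_mkcond; apply: ler_sum => l _; rewrite /g; case: (sel l) => //.
    by case: ifP => _ //; pos.
  have b4 : Edens k * Vk K k * \sum_(0 <= l < N | sel l) g k l <= 2 * Ce.
    apply: (@le_trans _ _ (Edens k * Vk K k * (2 * Vk K k ^+ 2))).
      by apply: ler_wpM2l b3; pos.
    have := hE k kk k0; rewrite exprS; lra.
  have c1 := ler_wpM2l (ltW Cn0) b2.
  have c2 := ler_wpM2l (mulr_ge0 (ltW Cn0) ak) b4.
  rewrite -/S; have -> : \sum_(0 <= i < N | sel i) a i = S by [].
  lra.
apply: (@le_trans _ _ (\sum_(0 <= k < N | sel k) a k * ((Cf + Cn) * S + Cn + Cn * (2 * Ce)))).
  by apply: ler_sum => k sk; exact: row.
rewrite -big_distrl/=; have -> : \sum_(0 <= i < N | sel i) a i = S by [].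
have x1 : 0 <= Cn * (2 * Ce) * S ^+ 2 by pos.
have x2 : 0 <= Cn * S ^+ 2 by pos.
have x3 : 0 <= Cf * S by pos.
rewrite expr2 in x1 x2 *; lra.
Qed.

Definition target (r : nat -> R) (t : nat * nat) : set R := hit (r t.1) (t.2%:R * alpha).

Definition targets (sel : pred nat) (N : nat) : seq (nat * nat) :=
  [seq (k, n) | k <- [seq k <- index_iota 0 N | sel k], n <- Alist k].

Lemma big_targets (Z : nmodType) sel N (F : nat * nat -> Z) :
  \sum_(t <- targets sel N) F t = \sum_(0 <= k < N | sel k) \sum_(n <- Alist k) F (k, n).
Proof. by rewrite /targets big_allpairs_dep big_filter. Qed.

(** Disjoint unless the centres are close; then bound by the smaller target. *)
Lemma mu_hit2 (r1 r2 x y : R) : 0 <= r2 -> r2 <= r1 ->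
  (mu (hit r1 x `&` hit r2 y `&` D) <= (6 * r2 * (dist_int (y - x) <= 2 * r1)%R%:R)%:E)%E.
Proof.
move=> r0 r21.
have mD : measurable D by exact: measurable_itv.
have m1 := @measurable_hit R r1 x; have m2 := @measurable_hit R r2 y.
case: (boolP (dist_int (y - x) <= 2 * r1)) => [_|hd].
  rewrite mulr1; apply: le_trans (mu_hit_le y r0); apply: mu_le.
  - by apply: measurableI => //; exact: measurableI.
  - exact: measurableI.
  - by move=> g [[_ ?] ?].
rewrite mulr0 (_ : hit r1 x `&` hit r2 y `&` D = set0) ?measure0//.
apply/seteqP; split => // g [[]]; rewrite /hit/= => g1 g2 _.
move/negP : hd; apply.
have -> : y - x = (y + g) - (x + g) by ring.
by apply: le_trans (dist_intB _ _) _; lra.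
Qed.

Lemma second_moment : exists k2, exists2 C : R, 0 < C & forall r sel,
  admissible (maxn k1 (maxn 1 k2)) r sel -> forall N,
  (\sum_(t <- targets sel N) \sum_(t' <- targets sel N) mu (target r t `&` target r t' `&` D)
    <= (C * (ssum r sel N + ssum r sel N ^+ 2))%:E)%E.
Proof.
have [k2 [C C0 hC]] := pairs_total.
exists k2, (12 * C); first by pos.
move=> r sel adm N; have [h1 h2 h3 h4 h5] := adm.
pose G k l := 6 * (r l * pairs k l (2 * r k)).
apply: (@le_trans _ _ (\sum_(0 <= k < N | sel k) \sum_(0 <= l < N | sel l)
   (if (k <= l)%N then G k l else G l k))%:E).
  rewrite big_targets.
  under eq_bigr do under eq_bigr do rewrite big_targets.
  rewrite -sumEFin; apply: lee_sum => k sk.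
  rewrite exchange_big/= -sumEFin; apply: lee_sum => l sl.
  have rk := ltW (h2 _ sk); have rl := ltW (h2 _ sl).
  case: ifP => kl.
    rewrite /G /pairs !mulr_sumr -sumEFin; apply: lee_sum => m _.
    rewrite !mulr_sumr -sumEFin; apply: lee_sum => n _.
    apply: le_trans (mu_hit2 _ _ rl _) _; first by apply: h5.
    by rewrite lee_fin mulrA.
  have lk : (l <= k)%N by rewrite ltnW// ltnNge kl.
  rewrite exchange_big/= /G /pairs !mulr_sumr -sumEFin; apply: lee_sum => n _.
  rewrite !mulr_sumr -sumEFin; apply: lee_sum => m _.
  rewrite [X in (mu (X `&` _) <= _)%E]setIC.
  apply: le_trans (mu_hit2 _ _ rk _) _; first by apply: h5.
  by rewrite lee_fin mulrA.
rewrite lee_fin.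
have G0 k l : sel k -> sel l -> 0 <= G k l.
  move=> sk sl; rewrite /G mulr_ge0// mulr_ge0 ?(ltW (h2 _ sl))//.
  by apply: sumr_ge0 => m _; exact: sumr_ge0.
apply: (@le_trans _ _ (2 * \sum_(0 <= k < N | sel k) \sum_(0 <= l < N | sel l && (k <= l)%N) G k l)).
  apply: (@le_trans _ _ (\sum_(0 <= k < N | sel k) \sum_(0 <= l < N | sel l && (k <= l)%N) G k l
     + \sum_(0 <= k < N | sel k) \sum_(0 <= l < N | sel l && (l <= k)%N) G l k)).
    rewrite -big_split/=; apply: ler_sum => k sk.
    rewrite big_mkcondr [X in _ <= _ + X]big_mkcondr/= -big_split/=; apply: ler_sum => l sl.
    case: ifP => kl; first by rewrite lerDl; case: ifP => _ //; exact: G0.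
    by rewrite add0r ltnW// ltnNge kl.
  rewrite mulrDl mul1r lerD2l le_eqVlt; apply/orP; left; apply/eqP.
  under eq_bigr do rewrite big_mkcondr.
  under [RHS]eq_bigr do rewrite big_mkcondr.
  by rewrite exchange_big.
have := hC r sel adm N.
rewrite /G; under [X in _ -> 2 * X <= _]eq_bigr do rewrite -big_distrr/=.
rewrite -big_distrr/=; lra.
Qed.

(** A target is contained in the cell [u0, v0) when the fractional part of
    n alpha lies in [1 - v0 + r, 1 - u0 - r]; the discrepancy estimate counts
    these n. *)
Lemma first_moment : exists2 c : R, 0 < c & forall r sel,
  admissible (maxn k1 1) r sel ->
  (forall K, exists N0, forall N, (N0 <= N)%N -> K <= ssum r sel N) ->
  forall j i, (i < 2 ^ j)%N -> exists N0, forall N, (N0 <= N)%N ->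
   ((c / 2 ^+ j * ssum r sel N)%:E <= \sum_(t <- targets sel N) mu (target r t `&` cell j i `&` D))%E.
Proof.
exists (2 * C1)^-1; first by pos.
move=> r sel [h1 h2 h3 h4 h5] Sinf j i ij.
pose ell : R := (2 ^+ j)^-1.
have ell0 : 0 < ell by rewrite invr_gt0 exprn_gt0.
pose c7 : R := (2 * expR 7)^-1.
have c70 : 0 < c7 by rewrite invr_gt0 mulr_gt0// expR_gt0.
have half01 : 0 < (2^-1 : R) < 1 by apply/andP; split; lra.
have x10 : 0 < c7 * ell / 8 by pos.
have [ka hka] := poly_exp_small 1 half01 x10.
have x20 : 0 < c7 * ell / (4 * (C1 * C3)) by pos.
have [kb hkb] := poly_exp_small 1 u01 x20.
pose u0 := i%:R * ell; pose v0 := i.+1%:R * ell.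
have uv : v0 = u0 + ell by rewrite /v0 /u0 -[i.+1]addn1 natrD mulrDl mul1r.
have u00 : 0 <= u0 by rewrite mulr_ge0// ltW.
have v01 : v0 <= 1 by rewrite /v0 /ell ler_pdivrMr ?exprn_gt0// mul1r -natrX ler_nat.
pose k3 := maxn ka kb.
have block k : sel k -> (k3 <= k)%N ->
   ((ell / C1 * adens r k)%:E <= \sum_(n <- Alist k) mu (target r (k, n) `&` cell j i `&` D))%E.
  move=> sk; rewrite geq_max => /andP[kak kbk].
  have := h1 _ sk; rewrite geq_max => /andP[kk k0].
  have kr : (0 : R) < k%:R by rewrite ltr0n.
  have s0 := sdens_gt0 k; have rk := h2 _ sk.
  have sge := sdens_ge k0; rewrite -/c7 in sge.
  have T0 : (0 : R) < 2 ^+ k by rewrite exprn_gt0.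
  have r8 : r k <= ell / 8.
    have e1 := hka k kak; rewrite expr1 exprVn ler_pdivrMr// in e1.
    have e2 : 1 <= sdens k * (ell / 8).
      have := ler_wpM2r (_ : 0 <= ell / 8) sge; move=> /(_ (ltW _)) h.
      have l8 : 0 < ell / 8 by pos.
      apply: le_trans (h l8); rewrite mulrAC mulrAC -mulrA mulrAC ler_pdivlMr// mul1r.
      by move: e1; lra.
    have e3 := h3 _ sk; rewrite /adens in e3.
    by rewrite -(ler_pM2l s0); lra.
  have N0 : (0 : R) <= (Ncard k)%:R by [].
  have disc : C3 * (2 ^+ k * u ^+ k) <= (Ncard k)%:R * ell / 4.
    have e1 := hkb k kbk; rewrite expr1 in e1.
    have e2 := Hlow kk.
    have e3 : c7 * 2 ^+ k <= C1 * (Ncard k)%:R * k%:R.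
      rewrite -ler_pdivrMr//; apply: le_trans e2; move: sge; lra.
    rewrite ler_pdivlMr in e1; last by pos.
    rewrite -(ler_pM2l (_ : 0 < C1 * k%:R * 4)); last by pos.
    have e4 := ler_wpM2r (ltW ell0) e3; have e5 := ler_wpM2l (ltW T0) e1.
    have -> : C1 * k%:R * 4 * (C3 * (2 ^+ k * u ^+ k)) = 2 ^+ k * (k%:R * u ^+ k * (4 * (C1 * C3))) by ring.
    apply: le_trans e5 _; lra.
  have cnt_ge : (Ncard k)%:R * ell / 2 <= \sum_(n <- Alist k) (frac_part (n%:R * alpha) \in `[1 - v0 + r k, 1 - u0 - r k])%:R.
    have := @Hdisc k (1 - v0 + r k) (1 - u0 - r k) kk.
    have q1 : 0 <= 1 - v0 + r k by lra.
    have q2 : 1 - v0 + r k < 1 - u0 - r k by lra.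
    have q3 : 1 - u0 - r k <= 1 by lra.
    move=> /(_ q1 q2 q3); rewrite ler_norml => /andP[h _].
    have q4 : ell * (3 / 4) <= 1 - u0 - r k - (1 - v0 + r k) by lra.
    have := ler_wpM2l N0 q4; lra.
  apply: (@le_trans _ _ (\sum_(n <- Alist k) (2 * r k * (frac_part (n%:R * alpha) \in `[1 - v0 + r k, 1 - u0 - r k])%:R)%:E)%E).
    rewrite sumEFin lee_fin -big_distrr/=.
    have := ler_wpM2l (mulr_ge0 (ler0n R 2) (ltW rk)) cnt_ge.
    have e2 := ler_wpM2r (ltW (mulr_gt0 rk ell0)) (Hlow kk).
    have -> : ell / C1 * adens r k = sdens k * (r k * ell) / C1 by rewrite /adens; ring.
    apply: le_trans; rewrite ler_pdivrMr//; lra.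
  apply: lee_sum => n _; case: (boolP (_ \in _)) => [|_]; last by rewrite mulr0 measure_ge0.
  rewrite in_itv/= mulr1 => hn.
  have hn' : u0 + r k <= 1 - frac_part (n%:R * alpha) <= v0 - r k by apply/andP; split; lra.
  apply: (le_trans (mu_hit_ge rk hn')).
  have mc : measurable (cell j i : set R) by exact: measurable_cell.
  have mh := @measurable_hit R (r k) (n%:R * alpha).
  apply: mu_le.
  - by apply: measurableI => //; exact: measurable_itv.
  - by apply: measurableI; [exact: measurableI|exact: measurable_itv].
  - by move=> x [hx cx]; split; [split|exact: cell_sub cx].
have [N1 hN1] := Sinf (2 * ssum r sel k3).
exists (maxn k3 N1) => N; rewrite geq_max => /andP[k3N N1N].
rewrite big_targets (@big_cat_nat _ _ _ k3)//=.
apply: (@le_trans _ _ (\sum_(k3 <= k < N | sel k) (ell / C1 * adens r k)%:E)%E).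
  rewrite sumEFin lee_fin -big_distrr/=.
  have e1 : ssum r sel N = ssum r sel k3 + \sum_(k3 <= k < N | sel k) adens r k.
    by rewrite /ssum (@big_cat_nat _ _ _ k3).
  have e2 := hN1 N N1N.
  have -> : (2 * C1)^-1 / 2 ^+ j * ssum r sel N = ell / C1 * (ssum r sel N / 2).
    by rewrite -/ell; field; rewrite lt0r_neq0.
  rewrite ler_wpM2l//; first by pos.
  lra.
rewrite -[X in (X <= _)%E]add0e; apply: leeD.
  by apply: sume_ge0 => k _; apply: sume_ge0 => n _.
rewrite [X in (X <= _)%E]big_nat_cond [X in (_ <= X)%E]big_nat_cond.
by apply: lee_sum => k /andP[/andP[k3k _] sk]; exact: block.
Qed.

Section Psi.
Variable psi : nat -> R.
Hypothesis Mpsi : M_class A psi.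

(** Cutting off at 1 / sdens k keeps the second moment under control: without
    the cut-off one block could cover the circle many times. The value of psi
    at the right end of the block bounds psi from below on the block. *)
Definition radius k : R := Num.min (psi (2 ^ k.+1)) (sdens k)^-1.
(** The blocks left out have a summable total. *)
Definition chosen k2 k : bool := (maxn (maxn k1 4) k2 <= k)%N && (1 <= k%:R ^+ 2 * adens radius k).

Lemma psi_ge0 n : (0 < n)%N -> 0 <= psi n.
Proof. by have [h _ _] := Mpsi; exact: h. Qed.

Lemma psi_nincr m n : (0 < m)%N -> (m <= n)%N -> psi n <= psi m.
Proof. by have [_ h _] := Mpsi; exact: h. Qed.

Lemma adensE k : adens radius k = Num.min (sdens k * psi (2 ^ k.+1)) 1.
Proof.
have s0 := sdens_gt0 k.
by rewrite /adens /radius minr_pMr ?(ltW s0)// divff// lt0r_neq0.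
Qed.

Lemma adens_ge0 k : 0 <= adens radius k.
Proof.
rewrite adensE le_min ler01 andbT mulr_ge0// ?(ltW (sdens_gt0 k))//.
by rewrite psi_ge0// expn_gt0.
Qed.

Lemma chosen_admissible k2 : admissible (maxn (maxn k1 4) k2) radius (chosen k2).
Proof.
split.
- by move=> k /andP[].
- move=> k /andP[_ h]; have s0 := sdens_gt0 k.
  have : 0 < adens radius k.
    rewrite lt_neqAle adens_ge0 andbT; apply/eqP => e.
    by move: h; rewrite -e mulr0 ler10.
  by rewrite /adens pmulr_rgt0.
- by move=> k _; rewrite adensE ge_min lexx orbT.
- by move=> k /andP[].
- move=> k l /andP[+ _] kl; rewrite !geq_max => /andP[/andP[_ k4] _].
  rewrite /radius le_min !ge_min; apply/andP; split.
    by rewrite psi_nincr ?expn_gt0// leq_exp2l.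
  by rewrite lef_pV2 ?posrE ?sdens_gt0// sdens_mono// orbT.
Qed.

(** If the total were finite, almost all blocks would have s_k psi(2^(k+1)) < 1,
    the cut-off would be inactive, and by monotonicity of psi the sum of psi
    over A would be bounded block by block by the sum of the s_k psi(2^k). *)
Lemma chosen_diverges k2 K : exists N0, forall N, (N0 <= N)%N -> K <= ssum radius (chosen k2) N.
Proof.
pose kk := maxn (maxn k1 4) k2.
have mono m n : (m <= n)%N -> ssum radius (chosen k2) m <= ssum radius (chosen k2) n.
  move=> mn; rewrite /ssum [X in _ <= X](@big_cat_nat _ _ _ m)//= lerDl.
  by apply: sumr_ge0 => k _; exact: adens_ge0.
apply: contrapT => no.
have bd N : ssum radius (chosen k2) N <= K.
  rewrite leNgt; apply/negP => h; apply: no; exists N => n Nn.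
  by apply: le_trans (ltW h) (mono _ _ Nn).
have kk4 : (4 <= kk)%N by rewrite /kk !leq_max orbT.
have kkk1 : (k1 <= kk)%N by rewrite /kk !leq_max leqnn.
pose b := adens radius.
have bsum N : \sum_(kk <= k < N) b k <= K + 2.
  apply: (@le_trans _ _ (\sum_(kk <= k < N) ((if chosen k2 k then b k else 0) + (k%:R ^+ 2)^-1))).
    rewrite big_nat [X in _ <= X]big_nat; apply: ler_sum => k /andP[kkk _].
    have k0 : (0 < k)%N by apply: leq_trans kkk; apply: leq_trans kk4.
    have kr : (0 : R) < k%:R by rewrite ltr0n.
    rewrite /chosen kkk/=; case: ifP => [_|/negbT]; first by rewrite lerDl invr_ge0 sqr_ge0.
    rewrite -ltNge add0r => h; rewrite -[X in _ <= X]mul1r ler_pdivlMr ?exprn_gt0//.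
    by rewrite mulrC ltW.
  rewrite big_split/=; apply: lerD; last first.
    by apply: sum_inv_sq; apply: leq_trans kk4.
  rewrite -big_mkcond/=.
  have [kN|Nk] := leqP kk N; last first.
    rewrite big_geq; last exact: ltnW.
    by apply: le_trans (bd 0%N); rewrite /ssum big_geq.
  apply: le_trans (bd N); rewrite /ssum [X in _ <= X](@big_cat_nat _ _ _ kk)//= lerDr.
  by apply: sumr_ge0 => k _; exact: adens_ge0.
have [K1 hK1] : exists K1, forall k, (K1 <= k)%N -> (kk <= k)%N -> b k < 1.
  apply: contrapT => noK.
  have big m : exists2 k, (m <= k)%N /\ (kk <= k)%N & 1 <= b k.
    apply: contrapT => nob; apply: noK; exists m => k mk kkk.
    by rewrite ltNge; apply/negP => h; apply: nob; exists k.
  have inf j : exists2 N, (kk <= N)%N & j%:R <= \sum_(kk <= k < N) b k.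
    elim: j => [|j [N kN hN]]; first by exists kk; rewrite ?big_geq.
    have [k [Nk kkk] bk] := big N.
    exists k.+1; first exact: leqW.
    rewrite big_nat_recr//= -addn1 natrD lerD//.
    apply: le_trans hN _; rewrite [X in _ <= X](@big_cat_nat _ _ _ N)//= lerDl.
    by apply: sumr_ge0 => i _; exact: adens_ge0.
  have [N _ hN] := inf (Num.truncn (K + 2)).+1.
  have := le_trans hN (bsum N); rewrite leNgt; have := truncnS_gt (K + 2).
  by move=> ->.
pose m0 := (maxn K1 kk).+1.
pose B0 := \sum_(0 <= n < 2 ^ m0 | n \in A) psi n.
have [_ _ inf] := Mpsi.
have F0 k : A k -> 0 <= psi k by move=> /A_pos; exact: psi_ge0.
have : (\esum_(n in A) (psi n)%:E <= (B0 + 2 * C1 * (K + 2))%:E)%E.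
  apply: esum_le_bound => // n.
  have step d : \sum_(0 <= k < 2 ^ (m0 + d) | k \in A) psi k <= B0 + 2 * C1 * \sum_(m0 <= k < m0 + d) b k.-1.
    elim: d => [|d IH]; first by rewrite addn0 [X in _ <= _ + _ * X]big_geq// mulr0 addr0.
    rewrite addnS [X in X <= _](@big_cat_nat _ _ _ (2 ^ (m0 + d)))//= ?leq_exp2l//.
    rewrite [X in _ <= _ + _ * X]big_nat_recr ?leq_addr//= mulrDr addrA; apply: lerD IH _.
    set k := (m0 + d)%N.
    have m0k : (m0 <= k)%N by exact: leq_addr.
    have k0 : (0 < k)%N by exact: leq_trans m0k.
    have km : (maxn K1 kk <= k.-1)%N by rewrite -ltnS prednK.
    have [K1k kkk] : (K1 <= k.-1)%N /\ (kk <= k.-1)%N by move: km; rewrite geq_max => /andP[].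
    apply: (@le_trans _ _ (\sum_(2 ^ k <= n < 2 ^ k.+1 | n \in A) psi (2 ^ k))).
      rewrite big_nat_cond [X in _ <= X]big_nat_cond; apply: ler_sum => i /andP[/andP[ki _] _].
      by apply: psi_nincr; rewrite ?expn_gt0.
    rewrite -big_filter big_const_seq count_predT iter_addr_0 -/(Alist k) size_Alist -(mulr_natl (psi _)).
    have p0 : 0 <= psi (2 ^ k) by rewrite psi_ge0// expn_gt0.
    have kk1 : (k1 <= k)%N by apply: leq_trans kkk1 (leq_trans kkk (leq_pred _)).
    apply: le_trans (ler_wpM2r p0 (Hupp kk1)) _.
    have s2 : sdens k <= 2 * sdens k.-1.
      rewrite /sdens -{1}(prednK k0) exprS -!mulrA ler_pM2l// ler_pM2l ?exprn_gt0//.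
      by apply: Edens_nincr; exact: leq_pred.
    have bE : b k.-1 = sdens k.-1 * psi (2 ^ k).
      have := hK1 _ K1k kkk; rewrite /b adensE prednK// gt_min ltxx orbF => h.
      by rewrite min_l// ltW.
    rewrite bE; have := ler_wpM2l (ltW C10) (ler_wpM2r p0 s2); lra.
  have n2 : (n <= 2 ^ (m0 + n))%N.
    by apply: leq_trans (ltnW (ltn_expl n (ltnSn 1))) _; rewrite leq_exp2l// leq_addl.
  apply: (@le_trans _ _ (\sum_(0 <= k < 2 ^ (m0 + n) | k \in A) psi k)).
    rewrite [X in _ <= X](@big_cat_nat _ _ _ n)//= lerDl; apply: sumr_ge0 => i.
    by rewrite inE => /F0.
  apply: le_trans (step n) _; rewrite lerD2l ler_wpM2l//; first by pos.
  apply: le_trans (bsum (m0 + n).-1).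
  have -> : \sum_(m0 <= k < m0 + n) b k.-1 = \sum_(m0.-1 <= k < (m0 + n).-1) b k.
    by rewrite /m0 addSn /= big_add1.
  have mk : (kk <= m0.-1)%N by rewrite /m0/= leq_maxr.
  have mk2 : (m0.-1 <= (m0 + n).-1)%N by rewrite /m0 addSn/= leq_addr.
  rewrite [X in _ <= X](@big_cat_nat _ _ _ _ _ _ _ _ mk mk2) lerDr.
  by apply: sumr_ge0 => k _; exact: adens_ge0.
by rewrite inf.
Qed.

Lemma sum_dyadic (F : nat -> R) N :
  \sum_(0 <= k < N) \sum_(2 ^ k <= n < 2 ^ k.+1) F n = \sum_(1 <= n < 2 ^ N) F n.
Proof.
elim: N => [|N IH]; first by rewrite !big_geq.
by rewrite big_nat_recr//= IH -big_cat_nat ?expn_gt0// leq_exp2l.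
Qed.

(** The moment bounds and [l2_borel_cantelli] show that almost every point is
    hit unboundedly often; a point outside T_set is hit only by the finitely
    many n below some n0. *)
Theorem T_set_full : mu (T_set A psi alpha) = 1%E.
Proof.
have [k2 [C C0 second]] := second_moment.
have [c c00' first] := first_moment.
pose sel := chosen k2.
have adm : admissible (maxn k1 (maxn 1 k2)) radius sel.
  have [h1 h2 h3 h4 h5] := chosen_admissible k2; split=> // k /h1.
  rewrite !geq_max => /andP[/andP[-> k4] ->]; by rewrite (leq_trans _ k4).
have adm1 : admissible (maxn k1 1) radius sel.
  have [h1 h2 h3 h4 h5] := chosen_admissible k2; split=> // k /h1.
  rewrite !geq_max => /andP[/andP[-> k4] _]; by rewrite (leq_trans _ k4).
pose L N := targets sel N.
have mB t : measurable (target radius t) by exact: measurable_hit.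
have Sinf := chosen_diverges k2.
have zero M0 : mu (hits_le (target radius) L M0) = 0%E.
  have CC : 0 <= 2 * C by pos.
  apply: (l2_borel_cantelli mB c00' CC Sinf).
    by move=> j i ij; exact: first.
  have [N1 hN1] := Sinf 1; exists N1 => N NN.
  apply: le_trans (second _ _ adm N) _; rewrite lee_fin.
  have S1 := hN1 N NN; rewrite expr2.
  have : ssum radius sel N <= ssum radius sel N * ssum radius sel N by rewrite ler_peMl// (le_trans ler01).
  move=> h; have := ler_wpM2l (ltW C0) h; lra.
have mD : measurable D by exact: measurable_itv.
have muD : mu D = 1%E by rewrite lebesgue_measure_itv/= lte01 -EFinB subr0.
have mT := @measurable_T_set R A psi alpha.
pose Z := \bigcup_(i : nat) hits_le (target radius) L i%:R.
have mH (i : nat) : measurable (hits_le (target radius) L i%:R) by exact: measurable_hits_le.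
have mZ : measurable Z by exact: bigcup_measurable.
have muZ : mu Z = 0%E.
  apply/eqP; rewrite eq_le measure_ge0 andbT.
  apply: le_trans (@generalized_Boole_inequality _ _ _ (@lebesgue_measure R) _ mH mZ) _.
  by rewrite eseries0// => i _ _; exact: zero.
apply/eqP; rewrite eq_le; apply/andP; split.
  by rewrite -muD; apply: mu_le => // x [].
have DTZ : D `<=` T_set A psi alpha `|` Z.
  move=> x Dx; have [Zx|nZ] := pselect (Z x); [by right|left].
  rewrite T_setE; split=> // n0 _; apply: contrapT => no; apply: nZ.
  exists n0 => //; split=> // N _ /=.
  rewrite /nhits big_targets.
  have bnd k n : n \in Alist k -> \1_(target radius (k, n)) x <= (n < n0)%N%:R :> R.
    move=> /mem_Alist[An n1 n2]; rewrite indicE; case: (boolP (x \in _)) => //.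
    rewrite inE /target /hit/= => hx.
    have [//|n0n] := ltnP n n0.
    exfalso; apply: no; exists n => //=; rewrite /hit/=.
    apply: le_trans hx _; rewrite /radius ge_min; apply/orP; left.
    by apply: psi_nincr; [exact: A_pos|exact: ltnW].
  apply: (@le_trans _ _ (\sum_(0 <= k < N) \sum_(2 ^ k <= n < 2 ^ k.+1) (n < n0)%N%:R)).
    rewrite big_mkcond; apply: ler_sum => k _.
    have s0 : 0 <= \sum_(2 ^ k <= n < 2 ^ k.+1) (n < n0)%N%:R :> R by exact: sumr_ge0.
    case: ifP => _ //.
    apply: (@le_trans _ _ (\sum_(n <- Alist k) (n < n0)%N%:R)).
      by rewrite big_seq [X in _ <= X]big_seq; apply: ler_sum => n; exact: bnd.
    rewrite /Alist big_filter big_mkcond; apply: ler_sum => n _; by case: ifP.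
  rewrite sum_dyadic.
  apply: (@le_trans _ _ (\sum_(0 <= n < maxn n0 (2 ^ N)) (n < n0)%N%:R)).
    rewrite [X in _ <= X](@big_cat_nat _ _ _ (2 ^ N))//= ?leq_maxr//.
    rewrite [X in _ <= X + _](@big_cat_nat _ _ _ 1)//= ?expn_gt0//.
    by rewrite -addrA addrCA lerDl addr_ge0//; apply: sumr_ge0.
  rewrite (@big_cat_nat _ _ _ n0)//= ?leq_maxl// [X in _ + X]big_nat [X in _ + X]big1 ?addr0; last first.
    by move=> n /andP[h _]; rewrite ltnNge h.
  rewrite big_nat (eq_bigr (fun=> 1)); last by move=> n /andP[_ ->].
  by rewrite -big_nat sumr_const_nat subn0.
have h1 : (mu D <= mu (T_set A psi alpha `|` Z))%E.
  by apply: mu_le => //; exact: measurableU.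
have h2 := @measureU2 _ _ _ (@lebesgue_measure R) _ _ mT mZ.
move: (le_trans h1 h2); rewrite muD => h3; apply: le_trans h3 _.
by rewrite [X in (_ + X)%E](_ : _ = 0%E) ?adde0//; exact: muZ.
Qed.
End Psi.
End Fibre.

(** * BAD_P is a null set *)


Section Dirichlet.
Context {R : realType}.
Notation mu := (@lebesgue_measure R).
Notation D := (`[0%R, 1%R[%classic : set R).

(** Pigeonhole on the fractional parts of i x for i <= N, with the resulting
    fraction reduced. *)
Lemma dirichlet (x : R) (N : nat) : 0 <= x < 1 -> (0 < N)%N ->
  exists a q : nat, [/\ (0 < q)%N, (q <= N)%N, coprime a q, (a <= q)%N &
    `|x - a%:R / q%:R| <= (q%:R * N%:R)^-1].
Proof.
move=> /andP[x0 x1] N0.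
have Nr : (0 : R) < N%:R by rewrite ltr0n.
pose fr (i : nat) := frac_part (i%:R * x) : R.
have frP i : 0 <= fr i < 1 by exact: frac_part_itv.
have bd (i : nat) : (Num.truncn (N%:R * fr i) < N)%N.
  have /andP[f0 f1] := frP i.
  rewrite -(ltr_nat R); apply: le_lt_trans (_ : N%:R * fr i < N%:R); last by rewrite gtr_pMr.
  by have /andP[] := truncn_itv (mulr_ge0 (ltW Nr) f0).
pose f (i : 'I_N.+1) : 'I_N := Ordinal (bd i).
have : ~~ injectiveb f.
  apply/negP => /injectiveP/leq_card; by rewrite !card_ord ltnn.
move=> /injectivePn[i0 [j0 ij efij]].
have [i [j [ltij jN eij]]] : exists i j : nat, [/\ (i < j)%N, (j <= N)%N & Num.truncn (N%:R * fr i) = Num.truncn (N%:R * fr j)].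
  have e := congr1 val efij; rewrite /= in e.
  have [h|h|h] := ltngtP i0 j0.
  - by exists i0, j0; split=> //; rewrite -ltnS.
  - by exists j0, i0; split=> //; rewrite -ltnS.
  - by move/eqP : ij; case; exact: val_inj.
pose q := (j - i)%N; have q0 : (0 < q)%N by rewrite subn_gt0.
have qN : (q <= N)%N by apply: leq_trans jN; exact: leq_subr.
have qr : (0 : R) < q%:R by rewrite ltr0n.
pose az : int := Num.floor (j%:R * x) - Num.floor (i%:R * x).
have haz : `|q%:R * x - az%:~R| < N%:R^-1.
  have -> : q%:R * x - az%:~R = fr j - fr i.
    rewrite /az /fr /frac_part natrB ?(ltnW ltij)// rmorphB/=; ring.
  have /andP[fi0 fi1] := frP i; have /andP[fj0 fj1] := frP j.
  have /andP[a1 a2] := truncn_itv (mulr_ge0 (ltW Nr) fi0).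
  have /andP[b1 b2] := truncn_itv (mulr_ge0 (ltW Nr) fj0).
  rewrite eij in a1 a2; move: a1 a2 b1 b2; move: (Num.truncn _) => t.
  rewrite -[t.+1]addn1 natrD => a1 a2 b1 b2.
  rewrite -(ltr_pM2l Nr) divff ?lt0r_neq0// -{1}(gtr0_norm Nr) -normrM mulrBr ltr_norml.
  by apply/andP; split; lra.
have N1 : (N%:R : R)^-1 <= 1 by rewrite invf_le1// ler1n.
have az0 : 0 <= az.
  have : (-1)%:~R < az%:~R :> R.
    move: haz; rewrite ltr_norml => /andP[h1 h2].
    have := mulr_ge0 (ltW qr) x0; rewrite (_ : (-1)%:~R = -1)//; lra.
  by rewrite ltr_int; clear; lia.
have azq : (az <= q%:Z).
  have : az%:~R < (q%:Z + 1)%:~R :> R.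
    move: haz; rewrite ltr_norml => /andP[h1 h2].
    have -> : (q%:Z + 1)%:~R = q%:R + 1 :> R by rewrite rmorphD/= -pmulrn.
    have : q%:R * x <= q%:R by rewrite ler_piMr ?(ltW qr)// ltW.
    move: (az%:~R : R) h1 h2 => y h1 h2; lra.
  by rewrite ltr_int; clear; lia.
pose a := `|az|%N.
have ea : az = a%:Z by rewrite /a gez0_abs.
pose g := gcdn a q.
have g0 : (0 < g)%N by rewrite gcdn_gt0 q0 orbT.
have ga : (g %| a)%N by exact: dvdn_gcdl.
have gq : (g %| q)%N by exact: dvdn_gcdr.
have q'0 : (0 < q %/ g)%N by rewrite divn_gt0// dvdn_leq.
exists (a %/ g)%N, (q %/ g)%N; split.
- exact: q'0.
- exact: leq_trans (leq_div _ _) qN.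
- rewrite /coprime -(eqn_pmul2r g0) muln_gcdl !divnK// mul1n.
  by [].
- by rewrite leq_div2r// -lez_nat -ea.
have gr : (g%:R : R) != 0 by rewrite pnatr_eq0 -lt0n.
have eq : (q%:R : R) = (q %/ g)%:R * g%:R by rewrite -natrM divnK.
have ear : (a%:R : R) = (a %/ g)%:R * g%:R by rewrite -natrM divnK.
have q'r : (0 : R) < (q %/ g)%:R by rewrite ltr0n.
have -> : (a %/ g)%:R / (q %/ g)%:R = a%:R / q%:R :> R.
  by rewrite eq ear; field; rewrite gr lt0r_neq0.
have -> : x - a%:R / q%:R = (q%:R * x - az%:~R) / q%:R.
  by rewrite ea -pmulrn; field; rewrite lt0r_neq0.
rewrite normrM normfV (gtr0_norm qr) invfM mulrC.
apply: ler_pM; rewrite ?invr_ge0 ?(ltW qr)//.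
  by rewrite lef_pV2 ?posrE// ler_nat leq_div.
exact: ltW.
Qed.

Lemma spaced_count (T : eqType) (s : seq T) (f : T -> R) (lo hi : R) : uniq s -> lo <= hi ->
  (forall t, t \in s -> 0 <= f t) -> (forall t, t \in s -> lo <= f t <= hi) ->
  (forall t t', t \in s -> t' \in s -> t != t' -> 1 <= `|f t - f t'|) ->
  (size s)%:R <= hi - lo + 2.
Proof.
move=> us lohi f0 flh sp.
have [->|[t0 t0s]] : s = [::] \/ exists t, t \in s.
  by case: (s) => [|t s']; [left|right; exists t; rewrite mem_head].
  by rewrite /= -[0%:R]/(0 : R); lra.
have hi0 : 0 <= hi by apply: le_trans (f0 _ t0s) _; case/andP: (flh _ t0s).
pose m := Num.truncn lo; pose M := Num.truncn hi.
have mM : (m <= M)%N by exact: le_truncn.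
have h : (size (map (fun t => Num.truncn (f t)) s) <= size (iota m (M - m).+1))%N.
  apply: uniq_leq_size.
    rewrite map_inj_in_uniq// => t t' ts t's e; apply/eqP; apply: contraT => ne.
    have := sp _ _ ts t's ne.
    have /andP[a1 a2] := truncn_itv (f0 _ ts); have /andP[b1 b2] := truncn_itv (f0 _ t's).
    rewrite e in a1 a2; move: a1 a2 b1 b2; move: (Num.truncn _) => n.
    rewrite -[n.+1]addn1 natrD => a1 a2 b1 b2.
    rewrite leNgt => /negP; case; rewrite ltr_norml; apply/andP; split; lra.
  move=> _ /mapP[t ts ->]; rewrite mem_iota addnS subnKC// ltnS.
  by have /andP[h1 h2] := flh _ ts; rewrite !le_truncn.
rewrite size_map size_iota in h.
have : (size s)%:R <= ((M - m).+1)%:R :> R by rewrite ler_nat.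
rewrite -addn1 natrD natrB//.
have : M%:R <= hi by have /andP[] := truncn_itv hi0.
have := truncnS_gt lo; rewrite -/m -addn1 natrD; lra.
Qed.

Lemma mu_cover (T : eqType) (s : seq T) (B : T -> set R) (E : set R) : measurable E ->
  (forall t, measurable (B t)) -> (forall x, E x -> exists2 t, t \in s & B t x) ->
  (mu E <= \sum_(t <- s) mu (B t))%E.
Proof.
move=> mE mB; elim: s E mE => [|t s IH] E mE h.
  rewrite big_nil (_ : E = set0) ?measure0//.
  by apply/seteqP; split => // x /h[].
rewrite big_cons.
have mEt : measurable (E `\` B t) by exact: measurableD.
have h1 : (mu (E `\` B t) <= \sum_(t <- s) mu (B t))%E.
  apply: IH => // x [Ex nx]; have [t' + Bx] := h _ Ex.
  rewrite inE => /orP[/eqP e|]; last by exists t'.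
  by exfalso; apply: nx; rewrite -e.
apply: (@le_trans _ _ (mu (B t `|` (E `\` B t)))).
  apply: mu_le => //; first exact: measurableU.
  by move=> x Ex; have [?|?] := pselect (B t x); [left|right].
apply: le_trans (@measureU2 _ _ _ (@lebesgue_measure R) _ _ (mB t) mEt) _.
by apply: leeD.
Qed.

(** Levels grow by the factor 128 and each uses the denominators of the top
    factor 64, so that fractions of different levels are distinct. *)
Definition Q (k : nat) : nat := 2 ^ (7 * k + 7).
Definition Lv (k : nat) : seq (nat * nat) :=
  [seq (a, q) | q <- index_iota (2 ^ (7 * k + 1)) (Q k), a <- [seq a <- index_iota 0 q | coprime a q]].
Definition pt (t : nat * nat) : R := t.1%:R / t.2%:R.

Lemma mem_Lv k t : t \in Lv k ->
  [/\ (2 ^ (7 * k + 1) <= t.2)%N, (t.2 < Q k)%N, (t.1 < t.2)%N & coprime t.1 t.2].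
Proof.
move=> /allpairsPdep[q [a [+ + ->]]] /=; rewrite mem_index_iota mem_filter mem_index_iota.
by move=> /andP[-> ->] /andP[-> /andP[_ ->]].
Qed.

Lemma Lv_mem k a q : (2 ^ (7 * k + 1) <= q)%N -> (q < Q k)%N -> (a < q)%N -> coprime a q ->
  (a, q) \in Lv k.
Proof.
move=> h1 h2 h3 h4; apply/allpairsPdep; exists q, a; split=> //.
  by rewrite mem_index_iota h1.
by rewrite mem_filter h4 mem_index_iota.
Qed.

Lemma uniq_Lv k : uniq (Lv k).
Proof.
apply: allpairs_uniq_dep; first exact: iota_uniq.
- by move=> q _; rewrite filter_uniq// iota_uniq.
- by move=> [q a] [q' a'] _ _ /= [-> ->].
Qed.

Lemma Lv_gt0 k t : t \in Lv k -> (0 < t.2)%N.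
Proof. by move=> /mem_Lv[_ _ h _]; apply: leq_ltn_trans h. Qed.

Lemma size_Lv k : (size (Lv k))%:R <= (Q k)%:R ^+ 2 :> R.
Proof.
rewrite -natrX ler_nat /Lv size_allpairs_dep sumnE big_map.
apply: (@leq_trans (\sum_(2 ^ (7 * k + 1) <= q < Q k) Q k)).
  rewrite big_nat [X in (_ <= X)%N]big_nat; apply: leq_sum => q /andP[_ qQ].
  by rewrite size_filter (leq_trans (count_size _ _))// size_iota subn0 ltnW.
by rewrite sum_nat_const_nat expnS expn1 leq_mul2r leq_subr orbT.
Qed.

Lemma pt_itv k t : t \in Lv k -> 0 <= pt t < 1.
Proof.
move=> tL; have t0 := Lv_gt0 tL; have [_ _ h _] := mem_Lv tL.
by rewrite /pt divr_ge0//= ltr_pdivrMr ?ltr0n// mul1r ltr_nat.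
Qed.

(** The numerator of the difference is a nonzero integer, because reduced
    fractions of equal value coincide. *)
Lemma pt_dist k l t t' : t \in Lv k -> t' \in Lv l -> t != t' ->
  ((Q k)%:R * (Q l)%:R)^-1 <= `|pt t - pt t'|.
Proof.
move=> tL tL' ne; have t0 := Lv_gt0 tL; have t0' := Lv_gt0 tL'.
have [_ tQ _ ct] := mem_Lv tL; have [_ tQ' _ ct'] := mem_Lv tL'.
have q0 : (0 : R) < t.2%:R by rewrite ltr0n.
have q0' : (0 : R) < t'.2%:R by rewrite ltr0n.
have -> : pt t - pt t' = (t.1%:R * t'.2%:R - t'.1%:R * t.2%:R) / (t.2%:R * t'.2%:R).
  by rewrite /pt; field; rewrite !lt0r_neq0.
rewrite normrM normfV (gtr0_norm (mulr_gt0 q0 q0')).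
apply: (@le_trans _ _ ((t.2%:R * t'.2%:R)^-1)).
  rewrite lef_pV2 ?posrE ?mulr_gt0 ?ltr0n ?expn_gt0// -!natrM ler_nat.
  by rewrite leq_mul// ltnW.
rewrite -[X in X <= _]mul1r ler_wpM2r ?invr_ge0 ?mulr_ge0//.
have -> : t.1%:R * t'.2%:R - t'.1%:R * t.2%:R = ((t.1 * t'.2)%N%:Z - (t'.1 * t.2)%N%:Z)%:~R :> R.
  by rewrite rmorphB/= -!pmulrn !natrM.
rewrite -intr_norm (ler_int _ 1) -gtz0_ge1 normr_gt0 subr_eq0 eqz_nat.
apply: contra ne => /eqP e.
have d1 : (t.2 %| t'.2)%N by rewrite -(Gauss_dvdr _ (_ : coprime t.2 t.1)) 1?coprime_sym// e dvdn_mull.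
have d2 : (t'.2 %| t.2)%N by rewrite -(Gauss_dvdr _ (_ : coprime t'.2 t'.1)) 1?coprime_sym// -e dvdn_mull.
have e2 : t.2 = t'.2 by apply/eqP; rewrite eqn_dvd d1 d2.
move: e; rewrite e2 => /eqP; rewrite eqn_pmul2r// => /eqP e1.
by move: e1 e2; case: (t) => a b; case: (t') => a' b' /= -> ->.
Qed.
End Dirichlet.

Section Khinchin.
Context {R : realType}.
Notation mu := (@lebesgue_measure R).
Notation D := (`[0%R, 1%R[%classic : set R).
Notation pt := (@pt R).
Variables (c : R) (c0 : 0 < c) (c4 : c <= 4^-1).

(** As [f_prod P] is at most of order k at denominators of level k, a number
    x within rad k of a fraction of level k with denominator q makes
    q dist_int (q x) f_prod P q at most proportional to c. Due to the factor
    1 / (k + 1), the lengths of the neighbourhoods of level k add up to the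
    order of 1 / (k + 1), which has a divergent sum. *)
Definition rad (k : nat) : R := c / ((Q k)%:R ^+ 2 * k.+1%:R).
Definition near_pt (t : nat * (nat * nat)) : set R :=
  `[pt t.2 - rad t.1, pt t.2 + rad t.1]%classic.
Definition near_list (N : nat) := [seq (k, t) | k <- index_iota 0 N, t <- Lv k].
Definition harm (N : nat) : R := \sum_(0 <= k < N) k.+1%:R^-1.

Lemma Q_gt0 k : (0 : R) < (Q k)%:R.
Proof. by rewrite ltr0n expn_gt0. Qed.

Lemma rad_gt0 k : 0 < rad k.
Proof. by rewrite /rad divr_gt0// mulr_gt0 ?exprn_gt0 ?Q_gt0. Qed.

Lemma leQ k l : (k <= l)%N -> (Q k)%:R <= (Q l)%:R :> R.
Proof. by move=> kl; rewrite ler_nat leq_exp2l// leq_add2r leq_mul2l kl orbT. Qed.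

Lemma rad_nincr k l : (k <= l)%N -> rad l <= rad k.
Proof.
move=> kl; rewrite /rad ler_pM2l// lef_pV2 ?posrE ?mulr_gt0 ?exprn_gt0 ?Q_gt0//.
apply: ler_pM; rewrite ?sqr_ge0 ?ler0n ?ler_nat//.
by apply: lerXn2r; rewrite ?nnegrE ?(ltW (Q_gt0 _)) ?leQ.
Qed.

Lemma rad_small k : 2 * rad k < ((Q k)%:R ^+ 2)^-1.
Proof.
have q2 : (0 : R) < (Q k)%:R ^+ 2 by rewrite exprn_gt0 ?Q_gt0.
have -> : 2 * rad k = (2 * (c * k.+1%:R^-1)) * ((Q k)%:R ^+ 2)^-1 by rewrite /rad invfM; ring.
rewrite -[X in _ < X]mul1r ltr_pM2r ?invr_gt0//.
have : (k.+1%:R : R)^-1 <= 1 by rewrite invf_le1// ler1n.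
have := c4; have := c0; move: (k.+1%:R^-1) => y h1 h2 h3.
have : c * y <= c by rewrite ler_piMr// ltW.
lra.
Qed.

Lemma measurable_near_pt t : measurable (near_pt t).
Proof. exact: measurable_itv. Qed.

Lemma mu_near_pt t : mu (near_pt t) = (2 * rad t.1)%:E.
Proof.
rewrite lebesgue_measure_itv/= lte_fin.
have := rad_gt0 t.1 => h; rewrite ifT; last by lra.
by rewrite -EFinB; congr EFin; ring.
Qed.

Lemma big_near (Z : nmodType) N (F : nat * (nat * nat) -> Z) :
  \sum_(t <- near_list N) F t = \sum_(0 <= k < N) \sum_(t <- Lv k) F (k, t).
Proof. by rewrite big_allpairs_dep. Qed.

Lemma sum_const_le (T : eqType) (s : seq T) (F : T -> \bar R) (b C : R) : 0 <= b ->
  (forall t, t \in s -> F t <= b%:E)%E -> (size s)%:R <= C -> (\sum_(t <- s) F t <= (C * b)%:E)%E.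
Proof.
move=> b0 h hC; apply: (@le_trans _ _ ((size s)%:R * b)%:E); last by rewrite lee_fin ler_wpM2r.
rewrite mulr_natl; apply: (@le_trans _ _ (\sum_(t <- s) b%:E)).
  by rewrite big_seq [X in (_ <= X)%E]big_seq; exact: lee_sum.
by rewrite sumEFin lee_fin big_const_seq count_predT iter_addr_0.
Qed.

(** For k = l the intervals are disjoint. For k < l the number of fractions of
    level l within 2 rad k of a given one is at most 4 rad k Q_l^2 + 2 by their
    spacing, and the additive 2 is absorbed: if there is one at all then
    2 rad k >= 1 / (Q_k Q_l), whence rad k Q_l^2 >= 2. *)
Lemma near_overlap k l t : (k <= l)%N -> t \in Lv k ->
  (\sum_(t' <- Lv l) mu (near_pt (k, t) `&` near_pt (l, t') `&` D)
   <= ((if k == l then 2 * rad k else 0) + 5 * (rad k * (Q l)%:R ^+ 2) * (2 * rad l))%:E)%E.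
Proof.
move=> kl tL.
have Ql := Q_gt0 l; have Qk := Q_gt0 k.
have rk := rad_gt0 k; have rl := rad_gt0 l.
have mI t' : (mu (near_pt (k, t) `&` near_pt (l, t') `&` D) <= (2 * rad l)%:E)%E.
  rewrite -(mu_near_pt (l, t')); apply: mu_le; last by move=> x [[]].
  - apply: measurableI; last exact: measurable_itv.
    by apply: measurableI; exact: measurable_near_pt.
  - exact: measurable_near_pt.
have far t' : rad k + rad l < `|pt t - pt t'| -> (mu (near_pt (k, t) `&` near_pt (l, t') `&` D) = 0)%E.
  move=> h; rewrite (_ : _ `&` _ = set0) ?measure0//; apply/seteqP; split=> // x [[]] /=.
  rewrite /near_pt/= !in_itv/= => /andP[h1 h2] /andP[h3 h4] _; move: h; apply/negP.
  by rewrite -leNgt ler_norml; apply/andP; split; lra.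
have [e|ne] := eqVneq k l.
  subst l; rewrite (bigD1_seq t)//= ?uniq_Lv// big_seq_cond big1 ?adde0.
    apply: le_trans (mI t) _; rewrite lee_fin lerDl.
    by pos.
  move=> t' /andP[tL' ne]; apply: far.
  apply: lt_le_trans (@pt_dist R _ _ _ _ tL tL' _); last by rewrite eq_sym.
  by have := rad_small k; rewrite expr2; lra.
have {ne}kl' : (k < l)%N by rewrite ltn_neqAle ne.
rewrite add0r.
pose s := [seq t' <- Lv l | `|pt t - pt t'| <= rad k + rad l].
have -> : (\sum_(t' <- Lv l) mu (near_pt (k, t) `&` near_pt (l, t') `&` D)
  = \sum_(t' <- s) mu (near_pt (k, t) `&` near_pt (l, t') `&` D))%E.
  rewrite big_filter [RHS]big_mkcond; apply: eq_bigr => t' _; case: ifPn => //.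
  by rewrite -ltNge => /far.
apply: sum_const_le => //; first by rewrite mulr_ge0// ltW.
have rkl := rad_nincr kl.
have [->|[t0 t0s]] : s = [::] \/ exists t, t \in s.
  by case: (s) => [|x s']; [left|right; exists x; rewrite mem_head].
  by rewrite /= -[0%:R]/(0 : R); pos.
have Q0 : 0 < (Q l)%:R ^+ 2 :> R by rewrite exprn_gt0.
have big2 : 2 <= rad k * (Q l)%:R ^+ 2.
  move: t0s; rewrite mem_filter => /andP[h tl0].
  have tt0 : t != t0.
    apply/eqP => e; subst t0; have [_ a2 _ _] := mem_Lv tL; have [b1 _ _ _] := mem_Lv tl0.
    have := leq_ltn_trans b1 a2; rewrite ltn_exp2l//; clear -kl'; lia.
  have := @pt_dist R _ _ _ _ tL tl0 tt0 => h2.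
  have {h2}h3 : ((Q k)%:R * (Q l)%:R)^-1 <= 2 * rad k by apply: (le_trans h2); lra.
  have h4 : 64 * (Q k)%:R <= (Q l)%:R :> R.
    rewrite -natrM ler_nat /Q (_ : 64 = 2 ^ 6)%N// -expnD leq_exp2l//; clear -kl'; lia.
  rewrite -(ler_pM2r Q0) in h3.
  have e : ((Q k)%:R * (Q l)%:R)^-1 * (Q l)%:R ^+ 2 = (Q l)%:R / (Q k)%:R :> R.
    by field; rewrite !lt0r_neq0.
  rewrite e in h3.
  have : 64 <= (Q l)%:R / (Q k)%:R :> R by rewrite ler_pdivlMr.
  by move: h3; move: (_ / _) => y; move: (_ ^+ 2) => z; rewrite -mulrA; lra.
have := @spaced_count R _ s (fun t' => (Q l)%:R ^+ 2 * pt t') ((Q l)%:R ^+ 2 * (pt t - (rad k + rad l)))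
  ((Q l)%:R ^+ 2 * (pt t + (rad k + rad l))).
have sL t' : t' \in s -> t' \in Lv l by rewrite mem_filter => /andP[].
have u : uniq s by rewrite filter_uniq ?uniq_Lv.
move=> /(_ u); have -> : (Q l)%:R ^+ 2 * (pt t + (rad k + rad l)) - (Q l)%:R ^+ 2 * (pt t - (rad k + rad l)) = 2 * ((rad k + rad l) * (Q l)%:R ^+ 2) by ring.
move=> h.
have {h} : (size s)%:R <= 2 * ((rad k + rad l) * (Q l)%:R ^+ 2) + 2 :> R.
  apply: h.
  - by rewrite ler_pM2l//; lra.
  - by move=> t' /sL/(@pt_itv R _ _)/andP[h _]; rewrite mulr_ge0// ltW.
  - move=> t'; rewrite mem_filter => /andP[]; rewrite ler_norml => /andP[h1 h2] _.
    by rewrite !ler_pM2l//; apply/andP; split; lra.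
  - move=> t' t'' /sL h1 /sL h2 n12.
    rewrite -mulrBr normrM (gtr0_norm Q0) -ler_pdivrMl// mulr1.
    by have := @pt_dist R _ _ _ _ h1 h2 n12; rewrite -expr2.
have : (rad k + rad l) * (Q l)%:R ^+ 2 <= 2 * (rad k * (Q l)%:R ^+ 2).
  by rewrite mulrA ler_pM2r//; lra.
lra.
Qed.

Lemma near_pairs k l : (k <= l)%N ->
  (\sum_(t <- Lv k) \sum_(t' <- Lv l) mu (near_pt (k, t) `&` near_pt (l, t') `&` D)
   <= ((if k == l then 2 * c * k.+1%:R^-1 else 0) + 10 * c ^+ 2 * (k.+1%:R^-1 * l.+1%:R^-1))%:E)%E.
Proof.
move=> kl; have Qk := Q_gt0 k; have Ql := Q_gt0 l.
have rk := rad_gt0 k; have rl := rad_gt0 l.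
have := @sum_const_le _ (Lv k) _ _ _ _ (fun t => near_overlap kl) (@size_Lv R k).
move=> h; apply: le_trans (h _) _.
  rewrite addr_ge0//; last by pos.
  by case: ifP => // _; rewrite mulr_ge0// ltW.
rewrite lee_fin mulrDr; apply: lerD.
  case: ifP => _; last by rewrite mulr0.
  rewrite le_eqVlt; apply/orP; left; apply/eqP.
  have := ltr0Sn R k; rewrite /rad; move: (Q k)%:R Qk (k.+1%:R : R) => q q0 y y0.
  by field; rewrite !lt0r_neq0.
rewrite le_eqVlt; apply/orP; left; apply/eqP.
have := ltr0Sn R k; have := ltr0Sn R l; rewrite /rad.
move: (Q k)%:R Qk (Q l)%:R Ql (k.+1%:R : R) (l.+1%:R : R) => q q0 p p0 y z z0 y0.
by field; rewrite !lt0r_neq0.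
Qed.

Lemma near_second N : (\sum_(t <- near_list N) \sum_(u <- near_list N)
  mu (near_pt t `&` near_pt u `&` D) <= (2 * c * harm N + 10 * c ^+ 2 * harm N ^+ 2)%:E)%E.
Proof.
rewrite big_near; under eq_bigr do under eq_bigr do rewrite big_near.
apply: (@le_trans _ _ (\sum_(0 <= k < N) \sum_(0 <= l < N)
   ((if k == l then 2 * c * k.+1%:R^-1 else 0) + 10 * c ^+ 2 * (k.+1%:R^-1 * l.+1%:R^-1))%:E)%E).
  apply: lee_sum => k _; rewrite exchange_big/=; apply: lee_sum => l _.
  have [kl|lk] := leqP k l; first exact: near_pairs.
  rewrite exchange_big/=.
  under eq_bigr do under eq_bigr do rewrite [X in X `&` D]setIC.
  apply: le_trans (near_pairs (ltnW lk)) _.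
  by rewrite (gtn_eqF lk) (ltn_eqF lk) [l.+1%:R^-1 * _]mulrC.
under eq_bigr do rewrite sumEFin.
rewrite sumEFin lee_fin le_eqVlt; apply/orP; left; apply/eqP.
under eq_bigr do rewrite big_split/=.
rewrite big_split/=; congr (_ + _).
  rewrite /harm mulr_sumr big_nat [RHS]big_nat; apply: eq_bigr => k kN.
  rewrite (bigD1_seq k)//= ?iota_uniq ?mem_index_iota// eqxx big1 ?addr0// => l.
  by rewrite eq_sym => /negbTE ->.
have -> : 10 * c ^+ 2 * harm N ^+ 2 = 10 * c ^+ 2 * (harm N * harm N) by ring.
rewrite {1}/harm mulr_suml mulr_sumr; apply: eq_bigr => k _.
by rewrite !mulr_sumr; apply: eq_bigr.
Qed.

(** exp (harm N) is at least the telescoping product of the 1 + 1 / (k + 1). *)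
Lemma harm_unbounded K : exists N0, forall N, (N0 <= N)%N -> K <= harm N.
Proof.
have h N : N.+1%:R <= expR (harm N).
  rewrite /harm; elim: N => [|N IH]; first by rewrite big_geq// expR0.
  rewrite big_nat_recr//= expRD.
  have -> : N.+2%:R = N.+1%:R * (1 + N.+1%:R^-1) :> R.
    by rewrite mulrDr mulr1 divff ?pnatr_eq0// -[N.+2]addn1 natrD.
  by apply: ler_pM => //; exact: expR_ge1Dx.
exists (Num.truncn (expR K)) => N hN; rewrite -ler_expR; apply: le_trans (h N).
apply: le_trans (ltW (truncnS_gt _)) _.
by rewrite ler_nat ltnS.
Qed.

Lemma harm_pow2 m : \sum_(1 <= q < 2 ^ m) q%:R^-1 <= m%:R :> R.
Proof.
rewrite -sum_dyadic; apply: (@le_trans _ _ (\sum_(0 <= k < m) 1)); last first.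
  by rewrite sumr_const_nat subn0.
apply: ler_sum => k _; have p2 : (0 : R) < 2 ^+ k by rewrite exprn_gt0.
apply: (@le_trans _ _ (\sum_(2 ^ k <= q < 2 ^ k.+1) (2 ^+ k)^-1)).
  rewrite big_nat [X in _ <= X]big_nat; apply: ler_sum => q /andP[h _].
  have q0 : (0 < q)%N by rewrite (leq_trans _ h)// expn_gt0.
  by rewrite lef_pV2 ?posrE ?ltr0n// -natrX ler_nat.
rewrite sumr_const_nat expnS mul2n -addnn addnK -[_ *+ _]mulr_natl natrX divff//.
Qed.

Lemma mu_centred (x h : R) : 0 <= h -> mu `[x - h, x + h]%classic = (2 * h)%:E.
Proof.
move=> h0; rewrite lebesgue_measure_itv/= lte_fin.
case: ifP => [_|]; first by rewrite -EFinB; congr EFin; ring.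
by move=> /negbT; rewrite -leNgt => h1; congr EFin; lra.
Qed.

(** By Dirichlet's theorem every point of the middle half of the interval is
    within 2 / (q Q) of a fraction of denominator q < Q. The neighbourhoods of
    those with q < Q / 64 cover only a small part of the interval,
    up to a logarithmic term; the rest must be covered by neighbourhoods of
    length 256 / Q^2 of fractions of level k. *)
Lemma count_large (k : nat) (u v l : R) : 0 < l -> 0 <= u -> v <= 1 -> v - u = l ->
  12 * ((7 * k + 7)%:R / (Q k)%:R) <= l / 8 ->
  l * (Q k)%:R ^+ 2 / 1024 <= (size [seq t <- Lv k | u + l / 8 <= pt t < v - l / 8])%:R.
Proof.
move=> l0 u0 v1 uv kl; pose G := [seq t <- Lv k | u + l / 8 <= pt t < v - l / 8]; rewrite -/G.
have Q0 := Q_gt0 k.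
have Q128 : (128 : R) <= (Q k)%:R by rewrite ler_nat (_ : 128 = 2 ^ 7)%N// leq_exp2l// leq_addl.
pose Qr := (Q k)%:R : R; rewrite -/Qr in Q0 Q128 kl *.
have QV : Qr^-1 * 84 <= l / 8.
  apply: le_trans kl; rewrite mulrA [X in _ <= X]mulrC ler_pM2l ?invr_gt0//.
  by rewrite -natrM ler_nat; clear; lia.
have QV0 : 0 < Qr^-1 by rewrite invr_gt0.
have QQ1 : Qr * Qr^-1 = 1 by rewrite divff// lt0r_neq0.
have QVs : 128 * (Qr^-1 * Qr^-1) <= Qr^-1 by rewrite mulrA ger_pMl// ler_pdivrMr// mul1r.
pose F q := [seq a <- iota 0 q.+1 | q%:R * (u + l / 4) - 2 / Qr <= a%:R <= q%:R * (v - l / 4) + 2 / Qr].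
pose s2 := [seq (a, q) | q <- index_iota 1 (2 ^ (7 * k + 1)), a <- F q].
pose s := [seq (true, t) | t <- G] ++ [seq (false, t) | t <- s2].
pose h (t : bool * (nat * nat)) : R := if t.1 then 128 * (Qr^-1 * Qr^-1) else 2 * (t.2.2%:R^-1 * Qr^-1).
pose B (t : bool * (nat * nat)) := `[pt t.2 - h t, pt t.2 + h t]%classic.
pose I' := `[u + l / 4, v - l / 4[%classic.
have h0 t : 0 <= h t by rewrite /h; case: ifP => _; pos.
have cov : (mu I' <= \sum_(t <- s) mu (B t))%E.
  apply: mu_cover; [exact: measurable_itv|by move=> t; exact: measurable_itv|].
  move=> x; rewrite /I'/= in_itv/= => /andP[x1 x2].
  have x01 : 0 <= x < 1 by apply/andP; split; lra.
  have Qk1 : (0 < (Q k).-1)%N.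
    by rewrite -ltnS prednK ?expn_gt0// (ltn_exp2l 0)// addn_gt0 orbT.
  have [a [q [q0 qQ cop aq]]] := dirichlet x01 Qk1.
  have qr : (0 : R) < q%:R by rewrite ltr0n.
  have -> : ((Q k).-1%:R : R) = Qr - 1 by rewrite -subn1 natrB ?expn_gt0.
  move=> hx0.
  have {hx0}hx : `|x - a%:R / q%:R| <= 2 * (q%:R^-1 * Qr^-1).
    apply: (le_trans hx0); rewrite invfM mulrCA ler_pM2l ?invr_gt0//.
    by rewrite -[2]invrK -invfM lef_pV2 ?posrE; move: Q128; clear; lra.
  have [small|large] := ltnP q (2 ^ (7 * k + 1)).
    exists (false, (a, q)).
      rewrite mem_cat; apply/orP; right; apply/mapP; exists (a, q) => //.
      apply/allpairsPdep; exists q, a; split=> //; first by rewrite mem_index_iota q0.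
      rewrite /F mem_filter mem_iota leq0n add0n ltnS aq !andbT.
      move: hx; rewrite ler_norml => /andP[].
      move=> /(ler_wpM2l (ltW qr)) + /(ler_wpM2l (ltW qr)).
      have -> : q%:R * - (2 * (q%:R^-1 * Qr^-1)) = - (2 / Qr).
        by field; rewrite !lt0r_neq0.
      have -> : q%:R * (2 * (q%:R^-1 * Qr^-1)) = 2 / Qr.
        by field; rewrite !lt0r_neq0.
      have -> : q%:R * (x - a%:R / q%:R) = q%:R * x - a%:R by field; rewrite lt0r_neq0.
      have y1 : q%:R * (u + l / 4) <= q%:R * x by rewrite ler_pM2l.
      have y2 : q%:R * x <= q%:R * (v - l / 4) by rewrite ler_pM2l// ltW.
      move: y1 y2; move: (2 / Qr) (q%:R * x) (q%:R * (u + _)) (q%:R * (v - _)) => y1 y2 y3 y4 *.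
      by apply/andP; split; lra.
    rewrite /B/= in_itv/=; move: hx; rewrite /h/= ler_norml => /andP[h1 h2].
    by rewrite /pt/=; apply/andP; split; lra.
  have {}hx : `|x - a%:R / q%:R| <= 128 * (Qr^-1 * Qr^-1).
    apply: (le_trans hx); rewrite mulrA [X in _ <= X]mulrA ler_pM2r//.
    have : q%:R^-1 <= 64 * Qr^-1.
      rewrite -[64]invrK -invfM lef_pV2 ?posrE//; last by rewrite mulr_gt0.
      rewrite ler_pdivrMl// -natrM ler_nat.
      apply: leq_trans (_ : 64 * 2 ^ (7 * k + 1) <= _)%N; last by rewrite leq_mul2l large orbT.
      by rewrite (_ : 64 = 2 ^ 6)%N// -expnD leq_exp2l//; clear; lia.
    by lra.
  have q2 : (2 <= q)%N.
    by apply: leq_trans large; rewrite (leq_exp2l 1)//; clear; lia.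
  have aq' : (a < q)%N.
    rewrite ltn_neqAle aq andbT; apply: contraTneq cop => ->.
    by rewrite /coprime gcdnn gtn_eqF.
  exists (true, (a, q)).
    rewrite mem_cat; apply/orP; left; apply/mapP; exists (a, q) => //.
    rewrite mem_filter Lv_mem//; last by rewrite -[Q k]prednK ?expn_gt0.
    rewrite andbT /pt/=; move: hx; rewrite ler_norml => /andP[h1 h2].
    by apply/andP; split; lra.
  rewrite /B/= in_itv/=; move: hx; rewrite /h/= ler_norml => /andP[h1 h2].
  by rewrite /pt/=; apply/andP; split; lra.
move: cov; rewrite /I' lebesgue_measure_itv/= lte_fin ifT; last by lra.
rewrite -EFinB; under eq_bigr do rewrite mu_centred//.
rewrite sumEFin lee_fin /s big_cat !big_map/=.
have -> : \sum_(t <- G) 2 * h (true, t) = (size G)%:R * (256 * (Qr^-1 * Qr^-1)).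
  rewrite /h/= big_const_seq count_predT iter_addr_0 -[_ *+ _]mulr_natl; ring.
have e2 : \sum_(t <- s2) 2 * h (false, t) <= l / 32 + 12 * ((7 * k + 1)%:R / Qr).
  rewrite /s2 big_allpairs_dep/=.
  apply: (@le_trans _ _ (\sum_(1 <= q < 2 ^ (7 * k + 1)) (2 * l / Qr + 12 / Qr * q%:R^-1))).
    rewrite big_nat [X in _ <= X]big_nat; apply: ler_sum => q /andP[q0 _].
    have qr : (0 : R) < q%:R by rewrite ltr0n.
    rewrite /h/= big_const_seq count_predT iter_addr_0 -[_ *+ _]mulr_natl.
    have sz : (size (F q))%:R <= q%:R * l / 2 + 3.
      have uF : uniq (F q) by rewrite filter_uniq ?iota_uniq.
      have := @spaced_count R _ (F q) (fun a => a%:R) (q%:R * (u + l / 4) - 2 / Qr)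
         (q%:R * (v - l / 4) + 2 / Qr) uF.
      have y : 0 <= q%:R * l by pos.
      have -> : q%:R * (v - l / 4) + 2 / Qr - (q%:R * (u + l / 4) - 2 / Qr) = q%:R * l / 2 + 4 * Qr^-1.
        by rewrite -uv; field; rewrite lt0r_neq0.
      move=> h5; apply: le_trans (h5 _ _ _ _) _.
      - rewrite -subr_ge0.
        have -> : q%:R * (v - l / 4) + 2 / Qr - (q%:R * (u + l / 4) - 2 / Qr) = q%:R * l / 2 + 4 * Qr^-1.
          by rewrite -uv; field; rewrite lt0r_neq0.
        by rewrite addr_ge0// ?divr_ge0// mulr_ge0// ltW.
      - by [].
      - by move=> a; rewrite mem_filter => /andP[].
      - move=> a a' _ _ ne; rewrite -[a%:R]mulr1 -[a'%:R]mulr1.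
        have -> : a%:R * 1 - a'%:R * 1 = (a%:Z - a'%:Z)%:~R :> R by rewrite rmorphB/= -!pmulrn !mulr1.
        by rewrite -intr_norm (ler_int _ 1) -gtz0_ge1 normr_gt0 subr_eq0 eqz_nat.
      - have : Qr^-1 <= 128^-1 by rewrite lef_pV2 ?posrE//.
        by lra.
    have y : 0 <= 4 * (q%:R^-1 * Qr^-1) by pos.
    have := ler_wpM2r y sz.
    have -> : (q%:R * l / 2 + 3) * (4 * (q%:R^-1 * Qr^-1)) = 2 * l / Qr + 12 / Qr * q%:R^-1.
      by field; rewrite !lt0r_neq0.
    by rewrite [2 * (2 * _)]mulrA -natrM.
  rewrite big_split/= sumr_const_nat -mulr_sumr; apply: lerD.
    apply: (@le_trans _ _ (2 * l / Qr * (Qr / 64))); last first.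
      by rewrite le_eqVlt; apply/orP; left; apply/eqP; field; rewrite lt0r_neq0.
    rewrite -[_ *+ _]mulr_natr ler_pM2l; last by pos.
    rewrite ler_pdivlMr// -natrM ler_nat.
    apply: (@leq_trans (2 ^ (7 * k + 1) * 2 ^ 6)); first by rewrite leq_mul2r leq_subr orbT.
    by rewrite -expnD leq_exp2l//; clear; lia.
  have -> : 12 * ((7 * k + 1)%:R / Qr) = 12 / Qr * (7 * k + 1)%:R by rewrite mulrCA mulrC.
  by rewrite ler_pM2l; [exact: harm_pow2|pos].
have e3 : 12 * ((7 * k + 1)%:R / Qr) <= l / 8.
  apply: le_trans kl; rewrite ler_pM2l// ler_pM2r// ler_nat leq_add2l//.
move=> main.
have {main e2 e3}: l / 4 <= (size G)%:R * (256 * (Qr^-1 * Qr^-1)) by lra.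
have y : 0 < 256 * (Qr^-1 * Qr^-1) by rewrite mulr_gt0 ?ltr0n ?mulr_gt0.
rewrite -ler_pdivrMr// => hh; apply: le_trans hh.
rewrite le_eqVlt; apply/orP; left; apply/eqP; field; rewrite lt0r_neq0//.
Qed.

(** A positive proportion of the Q_k^2 fractions of level k lies well inside
    each cell, by [count_large]. *)
Lemma near_first j i : (i < 2 ^ j)%N -> exists N0, forall N, (N0 <= N)%N ->
  ((c / 1024 / 2 ^+ j * harm N)%:E <= \sum_(t <- near_list N) mu (near_pt t `&` cell j i `&` D))%E.
Proof.
move=> ij; pose l : R := (2 ^+ j)^-1.
have p2 : (0 : R) < 2 ^+ j by rewrite exprn_gt0.
have l0 : 0 < l by rewrite invr_gt0.
have [l1 hl1] := @poly_exp_small R 2^-1 1 (l / 96) (ltac:(apply/andP; split; lra)) (ltac:(lra)).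
have large k : (l1 <= k)%N -> 12 * ((7 * k + 7)%:R / (Q k)%:R) <= l / 8.
  move=> lk; have := hl1 (7 * k + 7)%N (ltac:(clear -lk; lia)).
  by rewrite expr1 exprVn natrX; move: (_ / _) => y; lra.
pose u : R := i%:R * l; pose v : R := i.+1%:R * l.
have u0 : 0 <= u by rewrite mulr_ge0// ltW.
have uv : v - u = l by rewrite /v /u -natr1; ring.
have v1 : v <= 1 by rewrite /v ler_pdivrMr// mul1r -natrX ler_nat.
have level k : (l1 <= k)%N ->
  ((c / 512 / 2 ^+ j * k.+1%:R^-1)%:E <= \sum_(t <- Lv k) mu (near_pt (k, t) `&` cell j i `&` D))%E.
  move=> lk; pose G := [seq t <- Lv k | u + l / 8 <= pt t < v - l / 8].
  have sz := count_large l0 u0 v1 uv (large _ lk); rewrite -/G in sz.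
  have Qk := Q_gt0 k.
  have Q128 : (128 : R) <= (Q k)%:R by rewrite ler_nat (_ : 128 = 2 ^ 7)%N// leq_exp2l// leq_addl.
  have rl : rad k <= l / 8.
    have h1 := rad_small k; have h2 := large _ lk.
    have h3 : ((Q k)%:R ^+ 2)^-1 <= (7 * k + 7)%:R / (Q k)%:R :> R.
      rewrite expr2 invfM ler_pM2r ?invr_gt0//; apply: (@le_trans _ _ 1).
        by rewrite invf_le1//; lra.
      by rewrite ler1n; clear; lia.
    by have := rad_gt0 k; lra.
  apply: (@le_trans _ _ (\sum_(t <- G) mu (near_pt (k, t)))%E).
    under eq_bigr do rewrite mu_near_pt/=.
    rewrite sumEFin lee_fin big_const_seq count_predT iter_addr_0.
    have -> : 2 * rad k *+ size G = (size G)%:R * (2 * rad k) by rewrite -[LHS]mulr_natl.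
    have y : 0 <= 2 * rad k by rewrite mulr_ge0// ltW// rad_gt0.
    apply: le_trans (ler_wpM2r y sz); rewrite le_eqVlt; apply/orP; left; apply/eqP.
    have := ltr0Sn R k; rewrite /rad /l; move: (Q k)%:R Qk (k.+1%:R : R) (2 ^+ j : R) p2 => q q0 y' z z0 y0.
    by field; rewrite !lt0r_neq0.
  rewrite /G big_filter big_mkcond; apply: lee_sum => t _; case: ifP => // /andP[t1 t2].
  apply: mu_le; first exact: measurable_near_pt.
    apply: measurableI; last exact: measurable_itv.
    by apply: measurableI; [exact: measurable_near_pt|exact: measurable_cell].
  move=> x hx; have ci : cell j i x.
    move: hx; rewrite /near_pt /cell/= !in_itv/= => /andP[h1 h2].
    by rewrite -/l -/u -/v; apply/andP; split; lra.
  by split; [split|exact: cell_sub ci].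
have [N0 hN0] := harm_unbounded (2 * harm l1).
exists (maxn l1 N0) => N; rewrite geq_max => /andP[lN N0N].
rewrite big_near (@big_cat_nat _ _ _ l1)//=.
apply: (@le_trans _ _ (\sum_(l1 <= k < N) (c / 512 / 2 ^+ j * k.+1%:R^-1)%:E)%E); last first.
  rewrite -[X in (X <= _)%E]add0e; apply: leeD.
    by apply: sume_ge0 => k _; apply: sume_ge0.
  by rewrite [X in (X <= _)%E]big_nat [X in (_ <= X)%E]big_nat; apply: lee_sum => k /andP[h _]; exact: level.
rewrite sumEFin lee_fin -mulr_sumr.
have := hN0 _ N0N; rewrite /harm [in X in _ -> X](@big_cat_nat _ _ _ l1 0 N)//=.
rewrite [X in _ * _ <= X -> _](@big_cat_nat _ _ _ l1 0 N)//=.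
set b := \sum_(l1 <= _ < N) _; set a := \sum_(_ <= _ < l1) _; move: a b => a b ab.
have -> : c / 1024 / 2 ^+ j * (a + b) = c / 512 / 2 ^+ j * ((a + b) / 2) by field; rewrite lt0r_neq0.
have h512 : (0 : R) < 512 by rewrite ltr0n.
rewrite (ler_pM2l (divr_gt0 (divr_gt0 c0 h512) p2)); lra.
Qed.

Lemma near_hits_null M : mu (hits_le near_pt near_list M) = 0%E.
Proof.
apply: (@l2_borel_cantelli _ _ near_pt near_list harm (c / 1024) (2 * c + 10 * c ^+ 2)).
- exact: measurable_near_pt.
- by rewrite divr_gt0 ?ltr0n.
- by pos.
- exact: harm_unbounded.
- exact: near_first.
- have [N0 h] := harm_unbounded 1; exists N0 => N /h h1.
  apply: le_trans (near_second N) _; rewrite lee_fin [X in _ <= X]mulrDl lerD2r.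
  by rewrite ler_pM2l ?mulr_gt0// expr2 ler_peMl// (le_trans ler01).
Qed.
End Khinchin.

Section Null.
Context {R : realType}.
Notation mu := (@lebesgue_measure R).
Variables (P : set nat) (PP : P `<=` [set p | prime p]).

(** Borel-Cantelli for the neighbourhoods of reduced fractions, with constants
    tending to 0: a number of BAD_P is missed by all of them from some level on,
    for c small in terms of its lower limit. *)
Theorem BAD_of_negligible : mu.-negligible (BAD_of P : set R).
Proof.
pose c (i : nat) : R := expR (- 7) / 28 / i.+1%:R.
have c0 i : 0 < c i by rewrite !divr_gt0// expR_gt0.
have c4 i : c i <= 4^-1.
  have -> : c i = expR (- 7) * (28 * i.+1%:R)^-1 by rewrite /c invfM mulrA.
  have e1 : expR (- 7) <= 1 :> R by rewrite -[X in _ <= X]expR0 ler_expR; lra.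
  have i1 : (28 * i.+1%:R)^-1 <= 28^-1 :> R.
    by rewrite lef_pV2 ?posrE ?mulr_gt0// ler_peMr// ler1n.
  have i0 : 0 <= (28 * i.+1%:R)^-1 :> R by rewrite invr_ge0 mulr_ge0.
  apply: (@le_trans _ _ (1 * 28^-1)); last by lra.
  by apply: ler_pM => //; exact: expR_ge0.
pose Z (p : nat * nat) := hits_le (near_pt (c p.1)) near_list p.2%:R : set R.
have ZN p : mu.-negligible (Z p).
  exists (Z p); split=> //; last exact: near_hits_null.
  by apply: measurable_hits_le => t; exact: measurable_near_pt.
have [pk pkK] : exists f : nat -> nat * nat, forall p, exists n, f n = p.
  exists (fun n => odflt (0, 0)%N (choice.unpickle n)) => p; exists (choice.pickle p).
  by rewrite choice.pickleK.
apply: (negligibleS _ (negligible_bigcup (fun n => ZN (pk n)))).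
move=> x [x01 /limn_einf_gt0[c1 c10 [n0 hx]]].
have [i hi] : exists i : nat, 7 * expR 7 * c i < c1.
  pose i := Num.truncn c1^-1; exists i.
  have -> : 7 * expR 7 * c i = 4^-1 * i.+1%:R^-1.
    rewrite /c expRN; field; rewrite !lt0r_neq0 ?expR_gt0// nat1r.
  have h : i.+1%:R^-1 < c1 by rewrite -[c1]invrK ltf_pV2 ?posrE ?invr_gt0// truncnS_gt.
  have : 0 < i.+1%:R^-1 :> R by rewrite invr_gt0.
  move: h; move: (i.+1%:R^-1 : R) => y; lra.
have miss k t : (n0 <= k)%N -> t \in Lv k -> ~ near_pt (c i) (k, t) x.
  move=> nk tL; rewrite /near_pt/= in_itv/= => /andP[h1 h2].
  have [t1 t2 _ _] := mem_Lv tL; have t0 := Lv_gt0 tL.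
  have nt : (n0 <= t.2)%N.
    apply: leq_trans (leq_trans nk _) t1.
    by apply: leq_trans (ltnW (ltn_expl k (ltnSn 1))) _; rewrite leq_exp2l//; clear; lia.
  have tr : (0 : R) < t.2%:R by rewrite ltr0n.
  have := hx _ nt; apply/negP; rewrite -ltNge; apply: le_lt_trans hi.
  have hd : dist_int (t.2%:R * x) <= t.2%:R * rad (c i) k.
    apply: le_trans (dist_int_le _ t.1%:Z) _; rewrite -pmulrn.
    have -> : t.2%:R * x - t.1%:R = t.2%:R * (x - pt t) by rewrite /pt; field; rewrite lt0r_neq0.
    rewrite normrM (gtr0_norm tr) ler_pM2l// ler_norml; apply/andP; split; lra.
  have hf : f_prod P t.2 <= expR 7 * (7 * k + 7)%:R :> R.
    apply: le_trans (f_prod_mert PP _) _; apply: le_trans (@mert_le R (7 * k + 7) _); last first.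
      by clear; lia.
    by apply: mert_homo.
  have r0 := rad_gt0 (c0 i) k.
  have Qk := @Q_gt0 R k.
  have f0 : 0 <= f_prod P t.2 :> R by rewrite (le_trans ler01)// f_prod_ge1.
  have tQ : t.2%:R <= (Q k)%:R :> R by rewrite ler_nat ltnW.
  apply: (@le_trans _ _ ((Q k)%:R ^+ 2 * rad (c i) k * (expR 7 * (7 * k + 7)%:R))).
    apply: ler_pM => //; first by rewrite mulr_ge0 ?dist_int_ge0.
    rewrite expr2 -mulrA; apply: ler_pM => //; first exact: dist_int_ge0.
    by apply: (le_trans hd); rewrite ler_pM2r.
  have -> : (7 * k + 7)%:R = 7 * k.+1%:R :> R by rewrite -natrM; congr _%:R; clear; lia.
  rewrite le_eqVlt; apply/orP; left; apply/eqP.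
  have := ltr0Sn R k; rewrite /rad; move: (Q k)%:R Qk (k.+1%:R : R) (c i) (expR 7) => q q0 y z e y0.
  by field; rewrite !lt0r_neq0.
pose M := (\sum_(0 <= k < n0) size (Lv k))%N.
have [n hn] := pkK (i, M); exists n => //; rewrite hn; split.
  by move: x01; rewrite inE.
move=> N _ /=; rewrite /nhits big_near.
have lev k : \sum_(t <- Lv k) \1_(near_pt (c i) (k, t)) x <= (if (k < n0)%N then (size (Lv k))%:R else 0) :> R.
  case: ltnP => kn.
    apply: (@le_trans _ _ (\sum_(t <- Lv k) 1)).
      by apply: ler_sum => t _; rewrite indicE; case: (_ \in _).
    by rewrite big_const_seq count_predT iter_addr_0.
  by rewrite big_seq big1// => t tL; rewrite indicE memNset//; exact: miss.
apply: (@le_trans _ _ (\sum_(0 <= k < N) (if (k < n0)%N then (size (Lv k))%:R else 0))).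
  by apply: ler_sum.
apply: (@le_trans _ _ (\sum_(0 <= k < maxn n0 N) (if (k < n0)%N then (size (Lv k))%:R else 0))).
  rewrite [X in _ <= X](@big_cat_nat _ _ _ N)//= ?leq_maxr// lerDl.
  by apply: sumr_ge0 => k _; case: ifP.
rewrite (@big_cat_nat _ _ _ n0)//= ?leq_maxl// [X in _ + X]big_nat [X in _ + X]big1 ?addr0; last first.
  by move=> k /andP[h _]; rewrite ltnNge h.
rewrite big_nat /M natr_sum [X in _ <= X]big_nat; apply: ler_sum => k /andP[_ ->] //.
Qed.
End Null.

(** * Hausdorff dimension of sets between BAD and the unit interval *)


Section Cantor.
Context {R : realType}.
Variables (h : nat) (h6 : (6 <= h)%N).
Let b := (2 * h)%N.
Let m := (h - 3)%N.
(** Length of the Cantor intervals of level n. The initial factor 1/2 leaves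
    room for a single dangerous rational per interval, see [bad_close]. *)
Definition len n : R := (2 * (2 * h)%:R ^+ n)^-1.
Let gap : R := (2 * b%:R ^+ 2)^-1.

(** The i-th child, occupying the subinterval with even index 2 i, contains a
    point too close to a rational whose denominator is of the size attached to
    level n. Every positive q has q^2 in exactly one of the ranges
    [b^(n-1), b^n). *)
Definition bad n (a : R) (i : nat) : Prop := exists (p : int) (q : nat) (x : R),
  [/\ (0 < q)%N, (b ^ n <= b * q ^ 2)%N, (q ^ 2 < b ^ n)%N,
     a + (2 * i)%:R * len n.+1 <= x <= a + (2 * i + 1)%:R * len n.+1 &
     `|x - p%:~R / q%:R| < gap / q%:R ^+ 2].

Definition children n a := [seq i <- iota 0 h | ~~ `[< bad n a i >]].

Lemma b_gt0 : (0 : R) < b%:R.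
Proof. by rewrite ltr0n muln_gt0 (leq_trans _ h6). Qed.

Lemma len_gt0 n : 0 < len n.
Proof. by rewrite invr_gt0 mulr_gt0// exprn_gt0// b_gt0. Qed.

Lemma lenS n : len n = b%:R * len n.+1.
Proof. by rewrite /len exprS -/b; have := b_gt0; move: b%:R => y y0; field; rewrite expf_neq0 lt0r_neq0. Qed.

(** Rationals attached to level n are more than b^-n = 2 len n apart, and an
    interval of level n has length len n, so that only one of them can endanger
    it; the half-width of its danger zone is at most the length of a child. *)
Lemma bad_close n a i j : (i < h)%N -> bad n a i -> bad n a j -> (i <= j + 1)%N.
Proof.
move=> ih [p [q [x [q0 q1 q2 /andP[x1 x2] hx]]]] [p' [q' [x' [q0' q1' q2' /andP[x1' x2'] hx']]]].
have lt_len c z : (0 < c)%N -> (b ^ n <= b * c ^ 2)%N -> z < gap / c%:R ^+ 2 -> z < len n.+1.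
  move=> c0 hc hz; apply: (lt_le_trans hz).
  have c0r : (0 : R) < c%:R by rewrite ltr0n.
  have b0 := b_gt0.
  rewrite /gap /len -/b -invfM lef_pV2 ?posrE; last 2 first.
    by rewrite !mulr_gt0 ?exprn_gt0.
    by rewrite !mulr_gt0 ?exprn_gt0.
  rewrite -mulrA ler_pM2l// exprS expr2 -mulrA ler_pM2l//.
  by rewrite -!natrX -natrM ler_nat.
have y1 := lt_len _ _ q0 q1 hx; have y2 := lt_len _ _ q0' q1' hx'.
have l0 := len_gt0 n.+1.
case: (ltnP (j + 1) i) => // ji.
have ij2 : (2 * i)%:R >= (2 * j + 4)%:R :> R by rewrite ler_nat; clear -ji; lia.
have x'x : x' + 3 * len n.+1 <= x.
  apply: le_trans x1; apply: (@le_trans _ _ (a + (2 * j + 4)%:R * len n.+1)).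
    apply: (@le_trans _ _ (a + (2 * j + 1)%:R * len n.+1 + 3 * len n.+1)); first by rewrite lerD2r.
    rewrite -addrA lerD2l -mulrDl ler_pM2r// -natrD ler_nat; clear; lia.
  by rewrite lerD2l ler_pM2r.
move: y1 y2; rewrite !ltr_norml => /andP[y1 y2] /andP[y3 y4].
have yy : p'%:~R / q'%:R < p%:~R / q%:R :> R by lra.
have qr : (0 : R) < q%:R by rewrite ltr0n.
have qr' : (0 : R) < q'%:R by rewrite ltr0n.
have far : (q%:R * q'%:R)^-1 <= p%:~R / q%:R - p'%:~R / q'%:R :> R.
  move: yy; rewrite ltr_pdivrMr// mulrAC ltr_pdivlMr// => yy.
  have -> : p%:~R / q%:R - p'%:~R / q'%:R = (p%:~R * q'%:R - p'%:~R * q%:R) / (q%:R * q'%:R) :> R.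
    by field; rewrite !lt0r_neq0.
  rewrite -[X in X <= _]mul1r ler_pM2r ?invr_gt0 ?mulr_gt0//.
  move: yy; rewrite ![in X in X -> _]pmulrn -!intrM ltr_int => yy.
  by rewrite -intrB (ler_int _ 1); move: yy; clear; lia.
have xx : x - x' <= len n - len n.+1.
  have h1 : x <= a + (len n - len n.+1).
    apply: (le_trans x2); rewrite lerD2l.
    have -> : len n - len n.+1 = (b%:R - 1) * len n.+1 by rewrite (lenS n); ring.
    rewrite ler_pM2r//.
    rewrite lerBrDr -[X in _ + X]/(1%:R) -natrD ler_nat /b; clear -ih; lia.
  have : 0 <= (2 * j)%:R * len n.+1 by rewrite mulr_ge0// ltW.
  by lra.
have qq : len n * 2 < (q%:R * q'%:R)^-1.
  rewrite /len -/b invfM mulrAC mulVf ?mul1r; last by [].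
  rewrite ltf_pV2 ?posrE ?mulr_gt0 ?exprn_gt0 ?b_gt0//.
  rewrite -natrM -natrX ltr_nat.
  rewrite -ltn_sqr expnMn -[X in (_ < X)%N]mulnn ltn_mul//.
have l1 : 2 * len n.+1 <= len n.
  by rewrite (lenS n) ler_pM2r// ler_nat /b; clear -h6; lia.
lra.
Qed.

Lemma size_children n a : (m <= size (children n a))%N.
Proof.
rewrite size_filter -[m]/(h - 3)%N leq_subLR -{1}(size_iota 0 h).
rewrite -(count_predC (fun i => ~~ `[< bad n a i >])) addnC leq_add2r.
rewrite -size_filter; set s := [seq _ <- _ | _].
have sP i : i \in s -> (i < h)%N /\ bad n a i.
  by rewrite mem_filter mem_iota/= negbK => /andP[/asboolP ? ?].
have us : uniq s by rewrite filter_uniq// iota_uniq.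
have [->//|[i0 i0s]] : s = [::] \/ exists i, i \in s.
  by case: (s) => [|x s']; [left|right; exists x; rewrite mem_head].
have [ih bi] := sP _ i0s.
apply: (@uniq_leq_size _ s (iota i0.-1 3)) => // i /sP[jh bj].
have := bad_close ih bi bj; have := bad_close jh bj bi.
rewrite mem_iota; clear; lia.
Qed.

Lemma childP n a d : (d < m)%N -> let i := nth 0%N (children n a) d in (i < h)%N /\ ~ bad n a i.
Proof.
move=> dm i; have : i \in children n a.
  by rewrite mem_nth// (leq_trans dm)// size_children.
by rewrite mem_filter mem_iota/= => /andP[/asboolPn].
Qed.

Lemma child_inj n a d d' : (d < m)%N -> (d' < m)%N ->
  nth 0%N (children n a) d = nth 0%N (children n a) d' -> d = d'.
Proof.
move=> dm dm' /eqP; have s := size_children n a.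
rewrite nth_uniq ?(leq_trans dm)// ?(leq_trans dm')//; first by move/eqP.
by rewrite filter_uniq// iota_uniq.
Qed.

Lemma m_gt0 : (0 < m)%N.
Proof. by rewrite /m; clear -h6; lia. Qed.

(** The first n digits of t in base m, as an integer. *)
Definition prefix (t : R) n := Num.truncn (m%:R ^+ n * t).

Definition child (t : R) n a := nth 0%N (children n a) (prefix t n.+1 %% m).

Fixpoint endp (t : R) n : R :=
  if n is k.+1 then endp t k + (2 * child t k (endp t k))%:R * len k.+1 else 0.

Lemma endpS t n : exists i, [/\ (i < h)%N, ~ bad n (endp t n) i &
  endp t n.+1 = endp t n + (2 * i)%:R * len n.+1].
Proof.
have := @childP n (endp t n) (prefix t n.+1 %% m) (ltac:(by rewrite ltn_mod m_gt0)).
by move=> /= [ih nb]; exists (child t n (endp t n)).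
Qed.

Lemma nested t n k : (n <= k)%N -> endp t n <= endp t k /\ endp t k + len k <= endp t n + len n.
Proof.
move=> /subnKC <-; elim: (k - n)%N => [|j [IH1 IH2]]; first by rewrite addn0.
rewrite addnS; have [i [ih _ ->]] := endpS t (n + j).
have l0 := len_gt0 (n + j).+1; rewrite lenS in IH2.
have h0 : 0 <= (2 * i)%:R * len (n + j).+1 by rewrite mulr_ge0// ltW.
have h1 : (2 * i)%:R * len (n + j).+1 + len (n + j).+1 <= b%:R * len (n + j).+1.
  have -> : (2 * i)%:R * len (n + j).+1 + len (n + j).+1 = (2 * i + 1)%:R * len (n + j).+1.
    by rewrite natrD mulrDl mul1r.
  by rewrite ler_pM2r// ler_nat /b; clear -ih; lia.
by split; lra.
Qed.

Definition branch t : R := sup (range (endp t)).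

Lemma branchP t n : endp t n <= branch t <= endp t n + len n.
Proof.
have ub k : endp t k <= endp t n + len n.
  have [kn|/ltnW nk] := leqP k n.
    by have [h1 _] := nested t kn; have := len_gt0 n; lra.
  by have [_ h2] := nested t nk; have := len_gt0 k; lra.
have hub : ubound (range (endp t)) (endp t n + len n) by move=> _ [k _ <-].
apply/andP; split; last by apply: ge_sup => //; exists (endp t 0), 0%N.
by apply: sup_upper_bound; [split; [exists (endp t 0), 0%N|exists (endp t n + len n)]|exists n].
Qed.

(** For each q, the step at the level of q avoids all rationals of
    denominator q. *)
Lemma branch_BAD t : BAD R (branch t).
Proof.
have b2 : (1 < b)%N by rewrite /b; clear -h6; lia.
have g0 : 0 < gap by rewrite invr_gt0 mulr_gt0// exprn_gt0// b_gt0.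
split.
  have := branchP t 0; rewrite /= /len expr0 mulr1 add0r in_itv/= => /andP[-> h1]/=.
  by lra.
apply: (@gt0_limn_einf _ _ gap 1 g0) => q q0.
have qr : (0 : R) < q%:R by rewrite ltr0n.
have [p ->] := dist_int_attained (q%:R * branch t).
pose n := (trunc_log b (q ^ 2)).+1.
have /andP[q1 q2] := trunc_log_bounds b2 (ltac:(by rewrite expn_gt0 q0) : (0 < q ^ 2)%N).
have [i [ih nb e]] := endpS t n.
rewrite leNgt; apply/negP => small; apply: nb; exists p, q, (branch t); split=> //.
- by rewrite /n expnS leq_mul2l q1 orbT.
- have := branchP t n.+1; rewrite e => /andP[-> h2]/=; apply: (le_trans h2).
  by rewrite natrD mulrDl mul1r addrA.
- rewrite ltr_pdivlMr ?exprn_gt0//; apply: le_lt_trans small.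
  have -> : q%:R * branch t - p%:~R = q%:R * (branch t - p%:~R / q%:R).
    by field; rewrite lt0r_neq0.
  rewrite normrM (gtr0_norm qr); move: `|branch t - _| => z.
  by rewrite le_eqVlt; apply/orP; left; apply/eqP; ring.
Qed.

Lemma prefix_div t n : 0 <= t -> (prefix t n.+1 %/ m)%N = prefix t n.
Proof.
move=> t0; have mr : (0 : R) < m%:R by rewrite ltr0n m_gt0.
have y0 : 0 <= m%:R ^+ n * t by rewrite mulr_ge0// exprn_ge0// ltW.
rewrite /prefix exprS -mulrA; move: (m%:R ^+ n * t) y0 => y y0.
have my0 : 0 <= m%:R * y by rewrite mulr_ge0// ltW.
apply/esym/eqP; rewrite truncn_eq//.
have /andP[h1 h2] := truncn_itv my0; set k := Num.truncn _ in h1 h2 *.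
apply/andP; split.
  rewrite -(ler_pM2l mr); apply: le_trans h1; rewrite -natrM ler_nat mulnC; exact: leq_trunc_div.
rewrite -(ltr_pM2l mr); apply: (lt_le_trans h2); rewrite -natrM ler_nat mulnC.
exact: ltn_ceil m_gt0.
Qed.

(** The parameters first differ at some digit of their expansions in base m;
    the unused odd subintervals then leave a whole interval of that level
    between the two branches. *)
Lemma branch_gap t t' : 0 <= t < 1 -> 0 <= t' < 1 -> t < t' ->
  exists2 n, t' - t <= (m%:R ^+ n)^-1 & len n.+1 <= `|branch t - branch t'|.
Proof.
move=> /andP[t0 t1] /andP[t0' t1'] tt.
have mr : (0 : R) < m%:R by rewrite ltr0n m_gt0.
have ex : exists n, prefix t n != prefix t' n.
  pose k := (Num.truncn (t' - t)^-1).+1; exists k; apply/eqP => e.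
  have hm : k%:R <= m%:R ^+ k :> R.
    rewrite -natrX ler_nat ltnW// ltn_expl// /m; clear -h6; lia.
  have p0 : 0 < m%:R ^+ k :> R by rewrite exprn_gt0.
  have /andP[a1 a2] := truncn_itv (mulr_ge0 (ltW p0) t0).
  have /andP[b1 b2] := truncn_itv (mulr_ge0 (ltW p0) t0').
  rewrite /prefix in e; rewrite e in a1 a2.
  have h1 : m%:R ^+ k * (t' - t) < 1.
    by move: a1 a2 b1 b2; move: (Num.truncn _) => z; rewrite -[z.+1]addn1 natrD mulrBr; lra.
  have := truncnS_gt (t' - t)^-1; rewrite -/k; apply/negP; rewrite -leNgt.
  rewrite -[_^-1]mul1r ler_pdivlMr ?subr_gt0//; apply: le_trans (ltW h1).
  by rewrite ler_wpM2r// subr_ge0 ltW.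
case: (ex_minnP ex) => -[|n] ne mn.
  have z y : 0 <= y -> y < 1 -> Num.truncn y = 0%N :> nat.
    by move=> y0 y1; apply/eqP; rewrite truncn_eq// y0 y1.
  by move: ne; rewrite /prefix !expr0 !mul1r !z.
have same k : (k <= n)%N -> prefix t k = prefix t' k.
  by move=> kn; apply/eqP; apply: contraT => /mn; rewrite ltnNge kn.
have ae k : (k <= n)%N -> endp t k = endp t' k.
  elim: k => //= k IH kn; rewrite IH ?(ltnW kn)//.
  by rewrite /child same.
exists n.
  have p0 : 0 < m%:R ^+ n :> R by rewrite exprn_gt0.
  have /andP[a1 a2] := truncn_itv (mulr_ge0 (ltW p0) t0).
  have /andP[b1 b2] := truncn_itv (mulr_ge0 (ltW p0) t0').
  have := same n (leqnn n); rewrite /prefix => e; rewrite e in a1 a2.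
  rewrite -[_^-1]mul1r ler_pdivlMr// mulrC mulrBr.
  by move: a1 a2 b1 b2; move: (Num.truncn _) => z; rewrite -[z.+1]addn1 natrD; lra.
have l0 := len_gt0 n.+1.
have := branchP t n.+1; have := branchP t' n.+1; rewrite /= ae//.
have : child t n (endp t' n) != child t' n (endp t' n).
  apply: contra ne => /eqP/child_inj e.
  have {}e := e (ltac:(by rewrite ltn_mod m_gt0)) (ltac:(by rewrite ltn_mod m_gt0)).
  by rewrite [prefix t n.+1](divn_eq _ m) [prefix t' n.+1](divn_eq _ m) !prefix_div// e same.
set a := endp t' n; set i := child t n a; set i' := child t' n a.
clearbody i i'; clearbody a => ii.
wlog: t t' i i' ii {tt t0 t1 t0' t1' ex ne mn same ae} / (i < i')%N.
  move=> H; have [lt|lt|e] := ltngtP i i'; first exact: H.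
    by move=> h1 h2; rewrite distrC; apply: (H t' t i' i); rewrite 1?eq_sym.
  by rewrite e eqxx in ii.
move=> lt /andP[h1 h2] /andP[h3 h4].
have : (2 * i + 2)%:R * len n.+1 <= (2 * i')%:R * len n.+1.
  by rewrite ler_pM2r// ler_nat; clear -lt; lia.
rewrite natrD mulrDl; move=> h5; rewrite distrC ler_normr; apply/orP; left; lra.
Qed.

(** The inverse of the parametrisation is s-Hoelder as soon as the number m of
    children is at least b^s: t and t' agreeing in n digits are within m^-n, and
    their branches are len (n + 1), about b^-n, apart. *)
Lemma branch_hoelder (s : R) : 0 <= s -> (2 * h)%:R `^ s <= m%:R -> s <= 1 ->
  exists2 C : R, 0 < C & forall t t', 0 <= t < 1 -> 0 <= t' < 1 ->
    `|t - t'| <= C * `|branch t - branch t'| `^ s.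
Proof.
move=> s0 hs s1; have mr : (0 : R) < m%:R by rewrite ltr0n m_gt0.
have b0 := b_gt0.
have small n : (m%:R ^+ n)^-1 <= 2 * m%:R * len n.+1 `^ s.
  pose y : R := (2 * b%:R ^+ n.+1) `^ s.
  have p0 : 0 < 2 * b%:R ^+ n.+1 :> R by rewrite mulr_gt0// exprn_gt0.
  have y0 : 0 < y by exact: powR_gt0.
  have ey : len n.+1 `^ s * y = 1.
    by rewrite /y -powRM ?ltW ?len_gt0// /len -/b mulVf ?powR1// lt0r_neq0.
  have yle : y <= 2 * m%:R ^+ n.+1.
    rewrite /y powRM ?exprn_ge0 ?(ltW b0)//; apply: ler_pM; rewrite ?powR_ge0//.
      by rewrite -[X in _ <= X]powRr1// ler_powR// ler1n.
    elim: n.+1 => [|k IH]; first by rewrite !expr0 powR1.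
    rewrite !exprS powRM ?exprn_ge0 ?(ltW b0)//.
    by apply: ler_pM; rewrite ?powR_ge0.
  have -> : len n.+1 `^ s = y^-1 by apply: (mulIf (lt0r_neq0 y0)); rewrite ey mulVf ?lt0r_neq0.
  rewrite ler_pdivlMr// mulrC ler_pdivrMr ?exprn_gt0//.
  by rewrite -mulrA -exprS.
have main t t' : 0 <= t < 1 -> 0 <= t' < 1 -> t < t' ->
    `|t - t'| <= 2 * m%:R * `|branch t - branch t'| `^ s.
  move=> ht ht' lt; rewrite distrC ger0_norm; last by rewrite subr_ge0 ltW.
  have [n h1 h2] := branch_gap ht ht' lt.
  apply: (le_trans h1); apply: (le_trans (small n)).
  rewrite ler_pM2l ?mulr_gt0//; apply: ge0_ler_powR => //.
  by rewrite nnegrE ltW// len_gt0.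
exists (2 * m%:R) => [|t t' ht ht']; first by rewrite mulr_gt0.
have [lt|lt|->] := ltgtP t t'; first exact: main.
- by rewrite distrC [X in X `^ s]distrC; exact: main.
- by rewrite !subrr normr0 mulr_ge0 ?mulr_ge0 ?powR_ge0// ltW.
Qed.
End Cantor.

Section Dimension.
Context {R : realType}.
Notation mu := (@lebesgue_measure R).
Notation D := (`[0%R, 1%R[%classic : set R).

(** As s < 1, the power (2 h)^s is at most h / 2 for large h. *)
Lemma base_exists (s : R) : 0 <= s < 1 -> exists2 h, (6 <= h)%N & (2 * h)%:R `^ s <= (h - 3)%:R :> R.
Proof.
move=> /andP[s0 s1]; pose K : R := 4 `^ (1 - s)^-1.
pose h := (Num.truncn K + 6)%N; exists h; first by rewrite leq_addl.
have h6 : (6 <= h)%N by rewrite leq_addl.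
have K0 : 0 <= K by exact: powR_ge0.
have Kh : K <= (2 * h)%:R.
  by apply: le_trans (ltW (truncnS_gt K)) _; rewrite ler_nat /h; move: (Num.truncn K) => k; clear; lia.
have p0 : 0 < (2 * h)%:R :> R by rewrite ltr0n; clear -h6; lia.
have d0 : 0 < 1 - s by rewrite subr_gt0.
have four : 4 <= (2 * h)%:R `^ (1 - s).
  have : K `^ (1 - s) <= (2 * h)%:R `^ (1 - s).
    by apply: ge0_ler_powR; rewrite ?nnegrE ?(ltW d0)// ltW.
  by rewrite -powRrM mulVf ?lt0r_neq0// powRr1.
have split : (2 * h)%:R = (2 * h)%:R `^ s * (2 * h)%:R `^ (1 - s) :> R.
  rewrite -powRD; last by rewrite (lt0r_neq0 p0) implybT.
  by rewrite addrC subrK powRr1// ltW.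
have : 4 * (2 * h)%:R `^ s <= (2 * h)%:R.
  by rewrite [X in _ <= X]split mulrC ler_pM2l// powR_gt0.
have : (6 : R) <= h%:R by rewrite ler_nat.
rewrite natrM natrB ?(leq_trans _ h6)//; move: (_ `^ s) => z; lra.
Qed.

Lemma diam_ge0 (U : set R) : U != set0 -> (0 <= diam U)%E.
Proof.
move=> /set0P[x Ux]; apply: ereal_sup_ubound; exists x => //; exists x => //.
by rewrite subrr normr0.
Qed.

Lemma diam_le (U : set R) x y : U x -> U y -> (`|x - y|%:E <= diam U)%E.
Proof. by move=> Ux Uy; apply: ereal_sup_ubound; exists x => //; exists y. Qed.

Lemma premeasure_ge0 (s d : R) (E : set R) : (0 <= hausdorff_premeasure s d E)%E.
Proof.
apply: le_ereal_inf_tmp => _ [U _ <-].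
by apply: nneseries_ge0 => i _ _; exact: poweR_ge0.
Qed.

(** The mass distribution principle, the mass being Lebesgue measure on the
    parameter interval: a set of diameter d is met by parameters within an
    interval of length O(d^s), so a cover with small sum of d^s could not
    account for all parameters. *)
Lemma hausdorff_measure_gt0 (E : set R) (f : R -> R) (C s : R) : 0 <= s -> 0 < C ->
  (forall t, D t -> E (f t)) ->
  (forall t t', D t -> D t' -> `|t - t'| <= C * `|f t - f t'| `^ s) ->
  (0 < hausdorff_measure s E)%E.
Proof.
move=> s0 C0 fE hf; rewrite ltNge; apply/negP => H0.
have e0 : 0 < (4 * C)^-1 by rewrite invr_gt0 mulr_gt0.
have : (hausdorff_premeasure s 1 E < (4 * C)^-1%:E)%E.
  apply: le_lt_trans (_ : (0 < _)%E); last by rewrite lte_fin.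
  apply: le_trans H0; apply: ereal_sup_ubound; exists 1 => //; exact: ltr01.
move=> /ereal_inf_lt[_ [U [EU dU] <-] hs].
pose J i : set R := if pselect (exists t, D t /\ U i (f t)) is left e then
  let r := C * fine (diam (U i)) `^ s in `[sval (cid e) - r, sval (cid e) + r]%classic else set0.
have mJ i : measurable (J i) by rewrite /J; case: pselect => [e|_] //; exact: measurable_itv.
have fd i : U i != set0 -> diam (U i) \is a fin_num.
  move=> ne; rewrite fin_numE gt_eqF ?(lt_le_trans _ (diam_ge0 ne)) ?ltNyr//=.
  by rewrite lt_eqF// (le_lt_trans (dU i)) ?ltry.
have DJ : D `<=` \bigcup_(i in ~` `I_0) J i.
  move=> t Dt; have [i _ Ui] := EU _ (fE _ Dt); exists i => //.
  rewrite /J; case: pselect => [e|[]]; last by exists t.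
  case: (cid e) => t0 [Dt0 Ut0] /=; rewrite in_itv/=.
  have ne : U i != set0 by apply/set0P; exists (f t).
  have h1 := hf _ _ Dt Dt0.
  have h2 : `|f t - f t0| <= fine (diam (U i)).
    by rewrite -lee_fin fineK ?fd//; exact: diam_le.
  have h3 : `|f t - f t0| `^ s <= fine (diam (U i)) `^ s.
    by apply: ge0_ler_powR; rewrite ?nnegrE// (le_trans _ h2).
  have := le_trans h1 (ler_wpM2l (ltW C0) h3); rewrite ler_norml => /andP[h4 h5].
  by apply/andP; split; lra.
have mD : measurable D by exact: measurable_itv.
have muD : mu D = 1%E by rewrite lebesgue_measure_itv/= lte01 -EFinB subr0.
have : (1 <= \sum_(0 <= i <oo) mu (J i))%E.
  have := measure_sigma_subadditive_tail (@lebesgue_measure R) mJ mD DJ.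
  by rewrite [X in (X <= _)%E -> _](_ : _ = 1%E)//; exact: muD.
apply/negP; rewrite -ltNge.
have t0 i : (0 <= diam (U i) `^ s)%E by exact: poweR_ge0.
apply: (@le_lt_trans _ _ ((2 * C)%:E * \sum_(0 <= i <oo | U i != set0) diam (U i) `^ s)%E).
  rewrite -nneseriesZl// [X in (_ <= X)%E]eseries_mkcond; apply: lee_nneseries => [//|i _].
  rewrite /J; case: pselect => [e|_]; last first.
    by rewrite measure0; case: ifP => // _; rewrite mule_ge0// lee_fin mulr_ge0// ltW.
  have ne : U i != set0 by case: e => t [_ Ut]; apply/set0P; exists (f t).
  rewrite ne mu_centred ?mulr_ge0 ?powR_ge0 ?(ltW C0)//.
  by rewrite -[diam (U i)]fineK ?fd// poweR_EFin -EFinM lee_fin mulrA.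
apply: (@le_lt_trans _ _ ((2 * C)%:E * (4 * C)^-1%:E)%E).
  by rewrite lee_pmul2l ?lte_fin ?mulr_gt0//; exact: ltW.
rewrite -EFinM lte_fin.
have -> : 2 * C / (4 * C) = 2^-1 by field; rewrite lt0r_neq0.
by lra.
Qed.

Lemma hausdorff_dim_ge1 (E : set R) : BAD R `<=` E -> (1 <= hausdorff_dim E)%E.
Proof.
move=> BE; apply: le_ereal_inf_tmp => _ [s [s0 Hs] <-]; rewrite lee_fin leNgt; apply/negP => s1.
have [h h6 hh] := base_exists (ltac:(by rewrite s0 s1) : 0 <= s < 1).
have [C C0 hC] := branch_hoelder h6 s0 hh (ltW s1).
have := @hausdorff_measure_gt0 E (@branch R h) C s s0 C0.
rewrite Hs ltxx; move=> H; apply: (_ : ~ false); first by [].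
apply: H => [t _|t t' Dt Dt']; first by apply: BE; exact: branch_BAD.
by apply: hC; [move: Dt|move: Dt']; rewrite /= in_itv.
Qed.

(** Cover by N intervals of length 1 / N; the sum N^(1-s) tends to 0 for s > 1. *)
Lemma hausdorff_dim_le1 (E : set R) : E `<=` D -> (hausdorff_dim E <= 1)%E.
Proof.
move=> ED; apply/lee_addgt0Pr => e e0.
rewrite -EFinD; apply: ereal_inf_lbound; exists (1 + e) => //; split; first by lra.
apply/eqP; rewrite eq_le; apply/andP; split; last first.
  apply: le_trans (premeasure_ge0 (1 + e) 1 E) _; apply: ereal_sup_ubound; exists 1 => //; exact: ltr01.
apply: ge_ereal_sup => _ [d /= d0 <-].
apply/lee_addgt0Pr => eta eta0; rewrite add0e.
pose N := (Num.truncn (Num.max d^-1 (eta^-1 `^ e^-1))).+1.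
have Nr : (0 : R) < N%:R by rewrite ltr0n.
have hN := truncnS_gt (Num.max d^-1 (eta^-1 `^ e^-1)); rewrite -/N in hN.
have N1 : N%:R^-1 <= d.
  rewrite -[d]invrK lef_pV2 ?posrE ?invr_gt0//; apply: le_trans (ltW hN).
  by rewrite le_max lexx.
have N2 : N%:R `^ (- e) <= eta.
  rewrite powRN -[eta]invrK lef_pV2 ?posrE ?invr_gt0 ?powR_gt0//.
  have h1 : eta^-1 `^ e^-1 <= N%:R by apply: le_trans (ltW hN); rewrite le_max lexx orbT.
  have : (eta^-1 `^ e^-1) `^ e <= N%:R `^ e.
    by apply: ge0_ler_powR; rewrite ?nnegrE ?powR_ge0 ?(ltW e0) ?(ltW Nr).
  by rewrite -powRrM mulVf ?lt0r_neq0// powRr1// invr_ge0 ltW.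
pose U (i : nat) : set R := if (i < N)%N then `[i%:R / N%:R, i.+1%:R / N%:R]%classic else set0.
have dU i : (diam (U i) <= N%:R^-1%:E)%E.
  apply: ge_ereal_sup => _ [x Ux [y Uy <-]]; rewrite lee_fin.
  move: Ux Uy; rewrite /U; case: ifP => // _; rewrite /= !in_itv/= -[i.+1%:R]natr1 mulrDl mul1r.
  by move=> /andP[x1 x2] /andP[y1 y2]; rewrite ler_norml; apply/andP; split; lra.
apply: (@le_trans _ _ (\sum_(0 <= i <oo | U i != set0) diam (U i) `^ (1 + e))%E).
  apply: ereal_inf_lbound; exists U => //; split; last first.
    by move=> i; apply: le_trans (dU i) _; rewrite lee_fin.
  move=> x /ED/=; rewrite in_itv/= => /andP[x0 x1].
  have y0 : 0 <= N%:R * x by rewrite mulr_ge0// ltW.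
  have /andP[h1 h2] := truncn_itv y0.
  exists (Num.truncn (N%:R * x)) => //; rewrite /U.
  have -> : (Num.truncn (N%:R * x) < N)%N.
    by rewrite -(ltr_nat R); apply: le_lt_trans h1 _; rewrite gtr_pMr.
  by rewrite /= in_itv/= ler_pdivrMr// ler_pdivlMr// ![x * _]mulrC h1 ltW.
rewrite eseries_mkcond (nneseries_split _ N); last first.
  by move=> k _; case: ifP => // _; exact: poweR_ge0.
rewrite [X in (_ + X)%E]eseries0 ?adde0; last first.
  by move=> i /= Ni _; rewrite /U ltnNge Ni/= eqxx.
apply: (@le_trans _ _ (\sum_(0 <= k < N) (N%:R^-1 `^ (1 + e))%:E)%E).
  apply: lee_sum => k _; case: ifPn => [ne|_]; last by rewrite lee_fin powR_ge0.
  have f := diam_ge0 ne; move: f (dU k); case: (diam (U k)) => [r| |]//.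
  rewrite poweR_EFin !lee_fin => r0 rN; apply: ge0_ler_powR => //.
    by rewrite addr_ge0// ltW.
  by rewrite nnegrE invr_ge0 ltW.
rewrite sumEFin lee_fin sumr_const_nat subn0 -[_ *+ _]mulr_natl; apply: le_trans N2.
have e1 : N%:R = N%:R `^ 1 :> R by rewrite powRr1// ltW.
have e2 : N%:R^-1 = N%:R `^ (- 1) :> R by rewrite powRN -e1.
rewrite e2 {1}e1 -powRrM -powRD ?(lt0r_neq0 Nr) ?implybT//.
by rewrite le_eqVlt; apply/orP; left; apply/eqP; congr (_ `^ _); ring.
Qed.

Theorem hausdorff_dim_eq1 (E : set R) : BAD R `<=` E -> E `<=` D -> hausdorff_dim E = 1%E.
Proof.
by move=> BE ED; apply/eqP; rewrite eq_le hausdorff_dim_le1// hausdorff_dim_ge1.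
Qed.
End Dimension.

(** * From the asymptotic conditions to dyadic blocks *)


Section Transfer.
Context {R : realType}.
Variables (A P : set nat) (PP : P `<=` [set p | prime p]).

Lemma vinogradov_nat (f g : R -> R) : vinogradov f g ->
  exists2 C : R, 0 < C & exists N, forall n : nat, (N <= n)%N -> `|f n%:R| <= C * `|g n%:R|.
Proof.
move=> [C C0 [x [_ hx]]]; exists C => //; exists (Num.truncn x).+1 => n hn; apply: hx.
by apply: lt_le_trans (truncnS_gt x) _; rewrite ler_nat.
Qed.

Lemma density_nat (x : nat) :
  card_nat [set n | [/\ A n, (x%:R : R) <= n%:R & (n%:R : R) < 2 * x%:R]] = cnt A x (2 * x).
Proof. by apply: card_nat_itv => n /=; rewrite ler_nat -natrM ltr_nat. Qed.

Lemma euler_nat (x : nat) :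
  \prod_(0 <= p < (Num.truncn (x%:R : R)).+1 | p \in P) (1 - p%:R^-1) = eul P x.+1 :> R.
Proof. by rewrite natrK. Qed.

(** The Euler product of the hypothesis includes the primes p <= x; at a power
    of 2 the end point is composite. *)
Lemma eul_pow2 k : (1 < k)%N -> eul P (2 ^ k).+1 = eul P (2 ^ k) :> R.
Proof.
move=> k1; rewrite /eul prod_recr_cond ifF ?mulr1//; apply/negbTE.
by apply: contra (not_prime_pow2 k1); rewrite inE => /PP.
Qed.

Section Density.
Let density : R -> R := fun x => (card_nat [set n | [/\ A n, x <= n%:R & n%:R < 2 * x]])%:R / x.
Let euler : R -> R := fun x => \prod_(0 <= p < (Num.truncn x).+1 | p \in P) (1 - p%:R^-1).

Lemma density_ge : vinogradov euler density -> exists2 C : R, 0 < C &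
  exists N, forall x : nat, (N <= x)%N -> x%:R * eul P x.+1 <= C * (cnt A x (2 * x))%:R.
Proof.
move=> /vinogradov_nat[C C0 [N hN]]; exists C => //; exists N.+1 => x Nx.
have x0 : (0 : R) < x%:R by rewrite ltr0n (leq_trans _ Nx).
have := hN x (ltnW Nx); rewrite /euler /density density_nat euler_nat ger0_norm; last first.
  exact: ltW (eul_gt0 PP _).
by rewrite ger0_norm ?divr_ge0// mulrA ler_pdivlMr// mulrC.
Qed.

Lemma density_le : vinogradov density euler -> exists2 C : R, 0 < C &
  exists N, forall x : nat, (N <= x)%N -> (cnt A x (2 * x))%:R <= C * (x%:R * eul P x.+1).
Proof.
move=> /vinogradov_nat[C C0 [N hN]]; exists C => //; exists N.+1 => x Nx.
have x0 : (0 : R) < x%:R by rewrite ltr0n (leq_trans _ Nx).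
have := hN x (ltnW Nx); rewrite /euler /density density_nat euler_nat.
rewrite [X in _ <= _ * X]ger0_norm; last exact: ltW (eul_gt0 PP _).
by rewrite ger0_norm ?divr_ge0// ler_pdivrMr// -mulrA [x%:R * _]mulrC.
Qed.

Lemma density_log (delta : R) : vinogradov density (fun x : R => 1 / (ln x `^ delta)) ->
  exists2 C : R, 0 < C &
  exists N, forall k : nat, (N <= k)%N -> (cnt A (2 ^ k) (2 * 2 ^ k))%:R * k%:R `^ delta <= C * 2 ^+ k.
Proof.
move=> /vinogradov_nat[C C0 [N hN]].
have l2 : 0 < ln 2 :> R by rewrite ln_gt0// ltr1n.
exists (C / (ln 2 `^ delta)); first by rewrite divr_gt0// powR_gt0.
exists N.+1 => k Nk.
have Nk2 : (N <= 2 ^ k)%N by rewrite (leq_trans (ltnW Nk))// ltnW// ltn_expl.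
have := hN _ Nk2; rewrite /density density_nat div1r natrX.
have k0 : (0 : R) < k%:R by rewrite ltr0n (leq_trans _ Nk).
have p2 : (0 : R) < 2 ^+ k by rewrite exprn_gt0.
rewrite lnXn// -[ln 2 *+ k]mulr_natl powRM ?ler0n ?(ltW l2)//.
have y0 : 0 < k%:R `^ delta :> R by exact: powR_gt0.
have z0 : 0 < ln 2 `^ delta :> R by exact: powR_gt0.
rewrite !ger0_norm ?divr_ge0 ?invr_ge0 ?mulr_ge0 ?(ltW y0) ?(ltW z0)// ?(ltW p2)//.
move: y0 z0 p2; move: (k%:R `^ delta) (ln 2 `^ delta) (2 ^+ k : R) => y z w y0 z0 w0.
rewrite ler_pdivrMr// => h; have := ler_wpM2r (ltW y0) h.
suff -> : C * (y * z)^-1 * w * y = C / z * w by [].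
by field; rewrite !lt0r_neq0.
Qed.
End Density.

(** Choose M >= 1 / rho: then M 2^I <= k gives 2^(2^I) <= 2^(rho k). *)
Lemma sieve_range (rho : R) : 0 < rho ->
  (\forall k \near \oo, forall n : nat, A n -> (2 ^ k <= n)%N ->
     forall p : nat, P p -> p%:R <= 2 `^ (rho * k%:R) -> ~~ (p %| n)%N) ->
  exists N M, (48 <= M)%N /\ forall I k n p, (N <= k)%N -> (M * 2 ^ I <= k)%N ->
    A n -> (2 ^ k <= n)%N -> P p -> (p < 2 ^ (2 ^ I))%N -> ~~ (p %| n)%N.
Proof.
move=> r0 [N _ hN]; exists N, (maxn 48 (Num.truncn rho^-1).+1); split; first exact: leq_maxl.
move=> I k n p Nk MIk An kn Pp pI; apply: (hN k Nk n An kn p Pp).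
apply: (@le_trans _ _ (2 `^ (2 ^ I)%:R)).
  by rewrite powR_mulrn// -natrX ler_nat ltnW.
rewrite ler_powR ?ler1n// -ler_pdivrMl//.
apply: (@le_trans _ _ ((maxn 48 (Num.truncn rho^-1).+1)%:R * (2 ^ I)%:R)); last by rewrite -natrM ler_nat.
rewrite ler_wpM2r//; apply: le_trans (ltW (truncnS_gt _)) _.
by rewrite ler_nat leq_maxr.
Qed.

Lemma discrepancy_ge (alpha : R) (N : nat) (a b : R) : 0 <= a -> a < b -> b <= 1 ->
  `|\sum_(0 <= n < N.+1 | n \in A) (frac_part (n%:R * alpha) \in `[a, b])%:R
    - (cnt A 0 N.+1)%:R * (b - a)| <= discrepancy A alpha N%:R.
Proof.
move=> a0 ab b1.
have c1 : card_nat [set n | A n /\ (n%:R : R) <= N%:R] = cnt A 0 N.+1.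
  by apply: card_nat_itv => n /=; rewrite ler_nat ltnS; split=> [[]|[]].
have c2 a' b' : card_nat [set n | [/\ A n, (n%:R : R) <= N%:R & frac_part (n%:R * alpha) \in `[a', b']]]
    = cnt [set n | A n /\ frac_part (n%:R * alpha) \in `[a', b']] 0 N.+1.
  apply: card_nat_itv => n /=; rewrite ler_nat ltnS.
  by split=> [[? ? ?]|[[? ?] ? ?]].
apply: sup_upper_bound; last first.
  exists a, b; split=> //; rewrite c1 c2; congr (`|_ - _|).
  rewrite /cnt natr_sum big_mkcond [RHS]big_mkcond; apply: eq_bigr => n _.
  have -> : (n \in [set n | A n /\ frac_part (n%:R * alpha) \in `[a, b]]) =
      (n \in A) && (frac_part (n%:R * alpha) \in `[a, b]).
    by apply/idP/andP => [/set_mem[? ?]|[/set_mem ? ?]]; [split=> //|]; exact: mem_set.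
  by case: (n \in A) => //=; case: (_ \in `[a, b]).
split; first by eexists; exists a, b; split=> //.
exists (N.+1%:R + N.+1%:R) => _ [a' [b' [a0' ab' b1' ->]]]; rewrite c1 c2.
have le1 B : (cnt B 0 N.+1)%:R <= N.+1%:R :> R by rewrite ler_nat (leq_trans (cnt_le _ _ _))// subn0.
apply: le_trans (ler_normB _ _) _; rewrite normrM !ger0_norm// ?subr_ge0 ?(ltW ab')//.
apply: lerD => //; apply: le_trans (le1 A); rewrite ler_piMr//; lra.
Qed.

(** Difference of the discrepancies up to 2^(k+1) - 1 and 2^k - 1. The exponent
    eps may exceed 1, in which case x^(1 - eps) is decreasing; so eps is lowered to
    at most 1/2, and the bound at the larger end point serves for both. *)
Lemma discrepancy_dyadic (alpha eps : R) : 0 < eps ->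
  vinogradov (discrepancy A alpha) (fun x : R => x `^ (1 - eps)) ->
  exists2 C : R, 0 < C & exists2 u : R, 0 < u < 1 & exists N,
  forall (k : nat) (a b : R), (N <= k)%N -> 0 <= a -> a < b -> b <= 1 ->
    `|\sum_(n <- Alist A k) (frac_part (n%:R * alpha) \in `[a, b])%:R - (Ncard A k)%:R * (b - a)|
      <= C * (2 ^+ k * u ^+ k).
Proof.
move=> e0 /vinogradov_nat[C C0 [N hN]].
pose e : R := Num.min eps 2^-1.
have e1 : 0 < e by rewrite lt_min e0 invr_gt0 ltr0n.
have e2 : e <= 2^-1 by rewrite ge_min lexx orbT.
have ee : e <= eps by rewrite ge_min lexx.
pose u : R := 2 `^ (- e).
have u01 : 0 < u < 1.
  rewrite powR_gt0//= /u powRN invf_lt1 ?powR_gt0//.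
  have := @gt0_ltr_powR R e e1 1 2; rewrite !nnegrE powR1; apply=> //.
  by rewrite ltr1n.
have /andP[u0 u1] := u01.
exists (4 * C); first by rewrite mulr_gt0.
exists u => //; exists N.+1 => k a b Nk a0 ab b1.
have disc n : (N <= n)%N -> (0 < n)%N -> (n <= 2 ^ k.+1)%N ->
    discrepancy A alpha n%:R <= 2 * C * (2 ^+ k * u ^+ k).
  move=> Nn n0 nk; apply: le_trans (ler_norm _) _; apply: le_trans (hN n Nn) _.
  have n1 : 1 <= n%:R :> R by rewrite ler1n.
  rewrite ger0_norm ?powR_ge0// [2 * C]mulrC -mulrA ler_pM2l//.
  apply: (@le_trans _ _ (n%:R `^ (1 - e))); first by rewrite ler_powR//; lra.
  apply: (@le_trans _ _ ((2 ^ k.+1)%:R `^ (1 - e))).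
    by apply: ge0_ler_powR; rewrite ?nnegrE ?ler0n ?ler_nat//; lra.
  rewrite natrX -powR_mulrn// -powRrM.
  have -> : k.+1%:R * (1 - e) = k.+1%:R + (- e) * k%:R + - e by rewrite -[k.+1%:R]natr1; ring.
  rewrite !powRD ?implybT//; last 2 first.
    by rewrite pnatr_eq0 implybT.
    by rewrite pnatr_eq0 implybT.
  have -> : 2 `^ k.+1%:R = 2 * 2 ^+ k :> R by rewrite powR_mulrn// exprS.
  have -> : 2 `^ (- e * k%:R) = u ^+ k by rewrite powRrM powR_mulrn// ltW.
  rewrite -/u -!mulrA ler_pM2l// ler_pM2l ?exprn_gt0//.
  by rewrite ler_piMr ?exprn_ge0 ?ltW.
have k2 : (0 < 2 ^ k)%N by rewrite expn_gt0.
have h1 := @discrepancy_ge alpha (2 ^ k).-1 a b a0 ab b1.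
have h2 := @discrepancy_ge alpha (2 ^ k.+1).-1 a b a0 ab b1.
rewrite !prednK ?expn_gt0// in h1 h2.
have Nk2 : (N < 2 ^ k)%N by apply: leq_trans (ltn_expl N (ltnSn 1)) _; rewrite leq_exp2l// ltnW.
have two : (2 <= 2 ^ k)%N.
  by rewrite -[X in (X <= _)%N]expn1 leq_exp2l// (leq_trans _ Nk).
have kk : (2 ^ k <= 2 ^ k.+1)%N by rewrite leq_exp2l.
have d1 : discrepancy A alpha (2 ^ k).-1%:R <= 2 * C * (2 ^+ k * u ^+ k).
  by apply: disc; move: Nk2 two kk; clear; lia.
have d2 : discrepancy A alpha (2 ^ k.+1).-1%:R <= 2 * C * (2 ^+ k * u ^+ k).
  by apply: disc; move: Nk2 two kk; clear; lia.
pose z := C * (2 ^+ k * u ^+ k).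
have z2 : 2 * C * (2 ^+ k * u ^+ k) = 2 * z by rewrite /z; ring.
have z4 : 4 * C * (2 ^+ k * u ^+ k) = 4 * z by rewrite /z; ring.
rewrite z2 in d1 d2; rewrite z4; move: z {z2 z4} d1 d2 => z d1 d2.
have {}h1 := le_trans h1 d1; have {}h2 := le_trans h2 d2.
rewrite (cnt_cat A (leq0n (2 ^ k)) kk) natrD (@big_cat_nat _ _ _ (2 ^ k))//= in h2.
rewrite [X in _ - X]mulrDl in h2.
rewrite /Alist big_filter /Ncard.
move: h1 h2; rewrite !ler_norml => /andP[h1 h1'] /andP[h2 h2'].
by apply/andP; split; lra.
Qed.
End Transfer.

(** * The intersection over all psi *)

Unset Implicit Arguments.
Set Strict Implicit.
Set Printing Implicit Defensive.

Theorem theorem1 (R : realType) (A P : set nat) (eps delta rho : R)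
  (A_pos : A `<=` [set n | (0 < n)%N])
  (A_inf : infinite_set A)
  (P_prime : P `<=` [set p | prime p])
  (eps_gt0 : 0 < eps) (delta_gt0 : 0 < delta) (rho_gt0 : 0 < rho)
  (condI : \forall k \near \oo,
     forall n : nat, A n -> (2 ^ k <= n)%N ->
     forall p : nat, P p -> p%:R <= 2 `^ (rho * k%:R) -> ~~ (p %| n)%N)
  (condII :
     let density : R -> R := fun x =>
       (card_nat [set n | [/\ A n, x <= n%:R & n%:R < 2 * x]])%:R / x in
     let euler : R -> R := fun x =>
       \prod_(0 <= p < (Num.truncn x).+1 | p \in P) (1 - p%:R^-1) in
     [/\ vinogradov density (fun x : R => 1 / (ln x `^ delta)),
         vinogradov density euler & vinogradov euler density])
  (condIII : forall alpha : R, BAD R alpha ->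
     vinogradov (discrepancy A alpha) (fun x : R => x `^ (1 - eps))) :
  let X := \bigcap_(psi in M_class A) @K_set R A psi in
  [/\ BAD R `<=` X,
      X `<=` BAD_of P,
      lebesgue_measure.-negligible X &
      hausdorff_dim X = 1%E].
Proof.
move=> X.
have [Cl Cl0 [Nl hl]] : exists2 C : R, 0 < C & exists N, forall x : nat, (N <= x)%N ->
    x%:R * eul P x.+1 <= C * (cnt A x (2 * x))%:R.
  by apply: (density_ge P_prime); case: condII.
have [Cu Cu0 [Nu hu]] : exists2 C : R, 0 < C & exists N, forall x : nat, (N <= x)%N ->
    (cnt A x (2 * x))%:R <= C * (x%:R * eul P x.+1).
  by apply: (density_le P_prime); case: condII.
have [Cd Cd0 [Nd hd]] : exists2 C : R, 0 < C & exists N, forall k : nat, (N <= k)%N ->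
    (cnt A (2 ^ k) (2 * 2 ^ k))%:R * k%:R `^ delta <= C * 2 ^+ k.
  by apply: density_log; case: condII.
have [Ns [M [M48 hs]]] := sieve_range rho_gt0 condI.
have BX : BAD R `<=` X.
  move=> alpha Ba psi Mpsi.
  have [c0 c00 bad] := BAD_const Ba.
  have [C3 C30 [u u01 [Nt ht]]] := discrepancy_dyadic eps_gt0 (condIII _ Ba).
  pose k1 := (maxn 2 (maxn (maxn Nl Nu) (maxn Nd (maxn Ns Nt))))%N.
  pose C1 : R := Cl + Cu + Cl * Cd.
  have CC : 0 < Cl * Cd by exact: mulr_gt0.
  have k1P k : (k1 <= k)%N -> [/\ (1 < k)%N, (Nl <= 2 ^ k)%N, (Nu <= 2 ^ k)%N & [/\ (Nd <= k)%N, (Ns <= k)%N & (Nt <= k)%N]].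
    rewrite !geq_max => /and3P[k2 /andP[a1 a2] /and3P[a3 a4 a5]]; split=> //.
      by rewrite (leq_trans a1)// ltnW// ltn_expl.
    by rewrite (leq_trans a2)// ltnW// ltn_expl.
  have sE k : (1 < k)%N -> sdens P k = (2 ^ k)%:R * eul P (2 ^ k).+1 :> R.
    by move=> k2; rewrite /sdens /Edens (eul_pow2 P_prime k2) natrX.
  have NE k : Ncard A k = cnt A (2 ^ k) (2 * 2 ^ k) by rewrite /Ncard expnS.
  have low k : (k1 <= k)%N -> sdens P k <= Cl * (Ncard A k)%:R :> R.
    by move=> /k1P[k2 a1 _ _]; rewrite sE// NE; exact: hl.
  split; first by case: Ba.
  apply: (T_set_full P_prime A_pos c00 bad (C1 := C1) (k1 := k1) _ C30 u01 delta_gt0 _ _ _ M48 _ _ Mpsi).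
  - by rewrite /C1 !addr_gt0.
  - move=> k kk; apply: le_trans (low k kk) _; rewrite ler_wpM2r// /C1; lra.
  - move=> k /k1P[k2 _ a2 _]; rewrite sE// NE; apply: le_trans (hu _ a2) _.
    rewrite ler_wpM2r ?mulr_ge0// ?(ltW (eul_gt0 P_prime _))// /C1; lra.
  - move=> k kk; have [_ _ _ [a3 _ _]] := k1P k kk; have h1 := low k kk; have h2 := hd k a3.
    rewrite -NE in h2.
    have p2 : (0 : R) < 2 ^+ k by rewrite exprn_gt0.
    have y0 := powR_ge0 (k%:R : R) delta.
    apply: (@le_trans _ _ (Cl * Cd)); last by rewrite /C1; lra.
    rewrite -(ler_pM2l p2); apply: (@le_trans _ _ (Cl * (Ncard A k)%:R * k%:R `^ delta)).
      by rewrite mulrA ler_wpM2r.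
    rewrite -mulrA; apply: le_trans (ler_wpM2l (ltW Cl0) h2) _.
    by rewrite mulrA mulrC.
  - by move=> I k n p /k1P[_ _ _ [_ a4 _]]; exact: hs.
  - by move=> k a b /k1P[_ _ _ [_ _ a5]]; exact: ht.
have XB : X `<=` BAD_of P.
  by move=> alpha; apply: (bigcap_K_set_sub_BAD_of P_prime Cl0 hl A_inf).
have XD : X `<=` `[0%R, 1%R[%classic.
  by move=> x /XB[]; rewrite inE.
split=> //.
- have [Z [mZ Z0 BZ]] := @BAD_of_negligible R P P_prime.
  by exists Z; split=> //; exact: subset_trans XB BZ.
- exact: hausdorff_dim_eq1.
Qed.
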